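(* Let $n\ge3$ be an odd integer, put $\alpha=\pi/n$, and fix two distinct points $p,q$ of the plane. Then there are uncountably many $n$-wedges of the form $\overline U=\langle\eta,p,\alpha\rangle=\langle\nu,q,\alpha\rangle$ that tile the disk.
   Context: Tile: if $\gamma$ is a simple closed plane curve bounding an open contractible region $U$, the closure $\overline U=U\cup\gamma$ is called a tile, with boundary $\gamma$. A tile has a fixed position in the plane. A monohedral tiling of a closed disk is a set of pairwise congruent tiles (congruent by an isometry, possibly orientation reversing), meeting pairwise only along their boundaries, whose union is the disk. A tile ''tiles the disk'' if copies of it (tiles congruent to it) form a monohedral tiling of a closed disk. Rotation: for an angle $\alpha$ and a point $p$, $\alpha_p$ denotes the anticlockwise rotation of the plane by $\alpha$ about $p$. Radial generation: let $\eta$ be a continuous planar curve segment with no self-intersections, $p$ a point on $\eta$, and $\alpha\in(0,2\pi)$. The union of $\eta$, $\eta'=\alpha_p(\eta)$ and the circular arcs centred at $p$ connecting the end-points of $\eta$ with the corresponding end-points of $\eta'$ is a contour $\gamma=[\eta,p,\alpha]$. It is the boundary of a tile if and only if it is simple; in that case the tile $\overline U$ is said to be radially generated by $\eta$, $p$ and $\alpha$, written $\overline U=\langle\eta,p,\alpha\rangle$. (In this case $p$ is an end-point of $\eta$ and exactly one arc is added.) Wedge: a tile is generated by a point $p$ if it equals $\langle\eta,p,\alpha\rangle$ for some $\eta,\alpha$. A wedge is a tile that is radially generated by exactly two points (vertices of its boundary). For an odd integer $n\ge3$, an $n$-wedge is a wedge of the form $\langle\eta,p,\pi/n\rangle=\langle\nu,q,\pi/n\rangle$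 with $p\ne q$. *)

(* Defs.v *)
From HB Require Import structures.
From mathcomp Require Import all_boot all_order all_algebra.
From mathcomp Require Import all_classical all_reals all_analysis.
Set Implicit Arguments.
Unset Strict Implicit.
Unset Printing Implicit Defensive.
Import Order.TTheory GRing.Theory Num.Theory.
Import numFieldNormedType.Exports.
Local Open Scope classical_set_scope.
Local Open Scope ring_scope.

Section Plane.
Variable R : realType.

(* The plane is R * R.  Its library topology is the Euclidean one, but its
   library norm is the sup norm, so the Euclidean distance is spelled out. *)
Definition eucl_dist (x y : R * R) : R :=
  Num.sqrt ((x.1 - y.1) ^+ 2 + (x.2 - y.2) ^+ 2).

Definition rotation (p : R * R) (t : R) (x : R * R) : R * R :=
  (p.1 + (cos t * (x.1 - p.1) - sin t * (x.2 - p.2)),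
   p.2 + (sin t * (x.1 - p.1) + cos t * (x.2 - p.2))).

(* An isometry of the plane; orientation may be reversed, and surjectivity is
   automatic. *)
Definition isometry (f : R * R -> R * R) : Prop :=
  forall x y, eucl_dist (f x) (f y) = eucl_dist x y.

Definition congruent (A B : set (R * R)) : Prop :=
  exists2 f, isometry f & f @` A = B.

Definition closed_disk (c : R * R) (r : R) : set (R * R) :=
  [set x | eucl_dist c x <= r].

Definition curve_segment (eta : R -> R * R) : Prop :=
  {within `[0, 1], continuous eta} /\ {in `[0, 1] &, injective eta}.

Definition simple_closed_curve (gamma : set (R * R)) : Prop :=
  exists f : R -> R * R,
    [/\ {within `[0, 1], continuous f}, f 0 = f 1,
        {in `[0, 1[ &, injective f} & gamma = f @` `[0, 1]].

Definition contractible (U : set (R * R)) : Prop :=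
  exists x0 : R * R, exists H : R * (R * R) -> R * R,
    [/\ U x0, {within `[0, 1] `*` U, continuous H},
        forall t x, t \in `[0, 1] -> U x -> U (H (t, x)) &
        forall x, U x -> H (0, x) = x /\ H (1, x) = x0].

(* By the Jordan curve theorem such a U is the bounded complementary component
   of gamma, and closure U = U `|` gamma. *)
Definition bounds (gamma U : set (R * R)) : Prop :=
  [/\ simple_closed_curve gamma, open U, bounded_set U, contractible U &
      closure U `\` U = gamma].

Definition tile_boundary (T gamma : set (R * R)) : Prop :=
  exists2 U, bounds gamma U & T = U `|` gamma.

Definition tile (T : set (R * R)) : Prop := exists gamma, tile_boundary T gamma.

(* A tile has only one boundary, so it does not matter how gamma1 and gamma2
   are quantified. *)
Definition meet_along_boundaries (T1 T2 : set (R * R)) : Prop :=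
  exists gamma1 gamma2,
    [/\ tile_boundary T1 gamma1, tile_boundary T2 gamma2 &
        T1 `&` T2 `<=` gamma1 `&` gamma2].

Definition monohedral_tiling (D : set (R * R)) (tau : set (set (R * R))) : Prop :=
  [/\ forall T, tau T -> tile T,
      forall T1 T2, tau T1 -> tau T2 -> congruent T1 T2,
      forall T1 T2, tau T1 -> tau T2 -> T1 <> T2 -> meet_along_boundaries T1 T2 &
      \bigcup_(T in tau) T = D].

Definition tiles_the_disk (T : set (R * R)) : Prop :=
  exists c : R * R, exists r : R, exists tau : set (set (R * R)),
    [/\ 0 < r, monohedral_tiling (closed_disk c r) tau &
        forall T', tau T' -> congruent T T'].

(* The arc swept by e; it is reduced to the point p when e = p. *)
Definition circular_arc (p : R * R) (a : R) (e : R * R) : set (R * R) :=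
  [set rotation p t e | t in `[0, a]].

Definition contour (eta : R -> R * R) (p : R * R) (a : R) : set (R * R) :=
  eta @` `[0, 1] `|` rotation p a @` (eta @` `[0, 1])
  `|` circular_arc p a (eta 0) `|` circular_arc p a (eta 1).

(* T = <eta, p, a>.  Being the boundary of a tile makes the contour simple,
   which forces p to be an end-point of eta. *)
Definition radially_generated
    (T : set (R * R)) (eta : R -> R * R) (p : R * R) (a : R) : Prop :=
  [/\ curve_segment eta, (eta @` `[0, 1]) p, 0 < a < 2 * pi &
      tile_boundary T (contour eta p a)].

Definition generated_by (T : set (R * R)) (p : R * R) : Prop :=
  exists eta : R -> R * R, exists a : R, radially_generated T eta p a.

Definition wedge (T : set (R * R)) : Prop :=
  tile T /\ exists p q : R * R, p <> q /\ generated_by T = [set p; q].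

Definition wedge_form (n : nat) (p q : R * R) (T : set (R * R)) : Prop :=
  exists eta nu : R -> R * R,
    radially_generated T eta p (pi / n%:R) /\
    radially_generated T nu q (pi / n%:R).

Definition n_wedge (n : nat) (T : set (R * R)) : Prop :=
  wedge T /\ exists p q : R * R, p <> q /\ wedge_form n p q T.

End Plane.

(* Main.v *)
Require Import Defs.
From mathcomp Require Import all_boot all_order all_algebra.
From mathcomp Require Import all_classical all_reals all_analysis.
From mathcomp Require Import ring lra zify.
Set Implicit Arguments.
Unset Strict Implicit.
Unset Printing Implicit Defensive.
Import Order.TTheory GRing.Theory Num.Theory.
Import numFieldNormedType.Exports.
Local Open Scope classical_set_scope.
Local Open Scope ring_scope.

(** Take the regular [n]-gon that has [pq] as a longest diagonal, and on each of
    its sides the circular sector of opening [pi / n] and radius [r] whose apex is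
    the opposite vertex; for [r] slightly larger than [|pq|] the union of these
    sectors is a Reuleaux polygon with its corners notched.  The tile is the part
    of this union on the larger side of the line [pq] that lies outside the mirror
    image of the smaller part.  The rotation [rho] by [pi / n] about [p] maps the
    reflected sectors to sectors, so the outer chain of the boundary is the [rho]
    image of the inner one, up to one circular arc about [p]; the mirror symmetry
    exchanging [p] and [q] gives the same for [q].

    The inner region and the outer region are star-shaped about the midpoint of
    [pq], and the former lies inside the latter: the tile is the part of a
    half-plane between the unit balls of two gauges, and is parametrized by a
    rectangle.  The outer region is the union of [rho] (inner region) and of one
    sector about [p]; hence an orbit of [rho] that starts in this sector stays in
    the inner region until it enters the tile, and then never meets it again within
    one turn, so that the [2 n] rotates of the tile fill the disk without overlap.

    A generating point [x] lies on the boundary, which moreover contains a circular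
    arc centred at [x]; but the only centres of boundary arcs that belong to the
    tile are [p] and [q].  The radius [r] ranges over an interval and can be read
    off the tile. *)

(** * Regions between two gauges *)

(** Put [p = (-1, 0)], [q = (1, 0)], [tau = pi / (2 n)] and [rho = 1 / cos tau], so that [pq] is a
    longest diagonal of a regular [n]-gon of circumradius [rho]. The delicate point is that the
    inner region lies in the interior of the outer one; both bounds [2 < r < 2 rho] come from there.
    An inner sector of radius 2 has its three corners within distance 2 of every outer apex, and a
    quadratic inequality carries this over to larger radii. Along the axis the inner region ends at
    abscissa 1 and the outer one at [r - 1], hence [2 < r]. As [r < 2 rho], an inner sector that
    points at a vertex of the polygon stops before it, so it cannot escape through the notch between
    two adjacent outer sectors. The definition of a tile leaves its boundary existentially
    quantified. To find the generating points, the contour of an arbitrary generation must therefore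
    be identified with the known edge; this rests on the fact that a simple closed curve contained
    in another one fills it. All computations are made for these two points; a similarity transports
    the result to arbitrary ones. *)

Lemma continuous_at_pair (T U V : topologicalType) (a : T -> U) (b : T -> V) (x : T) :
  {for x, continuous a} -> {for x, continuous b} ->
  {for x, continuous (fun t => (a t, b t))}.
Proof. by move=> ca cb; exact: (@cvg_pair _ _ _ _ (nbhs (a x)) (nbhs (b x)) _ _ _ a b ca cb). Qed.

Lemma continuous_at_norm (R : realType) (T : topologicalType) (a : T -> R) (x : T) :
  {for x, continuous a} -> {for x, continuous (fun t => `|a t|)}.
Proof. by move=> ca; apply: cvg_norm. Qed.

Lemma continuous_fst (R : realType) : continuous (fun z : R * R => z.1).
Proof. by move=> z; exact: cvg_fst. Qed.

Lemma continuous_snd (R : realType) : continuous (fun z : R * R => z.2).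
Proof. by move=> z; exact: cvg_snd. Qed.

Lemma unit_circle_angle (R : realType) (x y : R) : x ^+ 2 + y ^+ 2 = 1 ->
  exists t, [/\ 0 <= t, t < 2 * pi, cos t = x & sin t = y].
Proof.
move=> xy1; have x1 : -1 <= x <= 1 by nra.
have cx : cos (acos x) = x by apply: acosK; rewrite in_itv.
have sx : sin (acos x) = `|y|.
  by rewrite sin_acos// -xy1 [_ + y ^+ 2]addrC addrK sqrtr_sqr.
have a0 := acos_ge0 x1; have api := acos_lepi x1; have pi0 := pi_gt0 R.
have [y0|y0] := leP 0 y.
  exists (acos x); split => //; first by lra.
  by rewrite sx ger0_norm.
have sgt0 : 0 < sin (acos x) by rewrite sx ltr0_norm// oppr_gt0.
have an0 : acos x != 0.
  by apply/eqP => e; move: sgt0; rewrite e sin0 ltxx.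
have agt0 : 0 < acos x by rewrite lt_neqAle eq_sym an0.
exists (2 * pi - acos x).
rewrite cosB sinB mulr_natl cos2pi sin2pi cx sx ltr0_norm//.
by split; [lra|lra|ring|ring].
Qed.

Lemma polar_coordinates (R : realType) (x y : R) :
  exists d t, [/\ 0 <= d, 0 <= t, t < 2 * pi & x = d * cos t /\ y = d * sin t].
Proof.
pose d := Num.sqrt (x ^+ 2 + y ^+ 2).
have d2 : d ^+ 2 = x ^+ 2 + y ^+ 2 by rewrite sqr_sqrtr; nra.
have [d0|dn0] := eqVneq d 0.
  exists 0, 0; have pi0 := pi_gt0 R; have : x ^+ 2 + y ^+ 2 = 0 by rewrite -d2 d0; ring.
  by move=> ?; split => //; [lra|split; rewrite mul0r; nra].
have [|t [t0 tpi ct st]] := @unit_circle_angle R (x / d) (y / d).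
  by rewrite !expr_div_n -mulrDl -d2 divff// expf_neq0.
exists d, t; split => //; first exact: sqrtr_ge0.
by rewrite ct st; split; field.
Qed.

Section PolarRegion.
Variables (R : realType) (f g : R * R -> R).

(** A Minkowski functional without convexity: unions of sectors are star-shaped only, and the
    minimum of two gauges has to be a gauge again. *)
Definition gauge (f : R * R -> R) :=
  [/\ continuous f, forall t z, 0 < t -> f (t * z.1, t * z.2) = t * f z &
      forall z, z <> (0, 0) -> 0 < f z].

Hypotheses (gf : gauge f) (gg : gauge g).
Hypothesis fg : forall z, z <> (0, 0) -> 0 <= z.2 -> f z < g z.

Definition polar_closed := [set z : R * R | [/\ 0 <= z.2, f z <= 1 & 1 <= g z]].
Definition polar_open := [set z : R * R | [/\ 0 < z.2, f z < 1 & 1 < g z]].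

Let rect := [set w : R * R | [/\ -1 <= w.1, w.1 <= 1, 0 <= w.2 & w.2 <= 1]].
Let orect := [set w : R * R | [/\ -1 < w.1, w.1 < 1, 0 < w.2 & w.2 < 1]].

(** [e] runs over the upper half of the unit circle of the sum norm, which parametrizes the
    directions without trigonometry. [k] is the radius in that direction, interpolated between the
    inner curve at [w.2 = 0] and the outer curve at [w.2 = 1]. *)
Let e (x : R) : R * R := (x, 1 - `|x|).
Let k (w : R * R) := (1 - w.2) / g (e w.1) + w.2 / f (e w.1).

Definition polar_map (w : R * R) : R * R := (k w * w.1, k w * (1 - `|w.1|)).
(** The radius is [|z.1| + z.2], which gives back the direction. The second coordinate [l] solves
    [K = (1 - l) / G + l / F], written with [f z = K * F] and [g z = K * G]. *)
Definition polar_inv (z : R * R) : R * R :=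
  (z.1 / (`|z.1| + z.2), f z * (g z - 1) / (g z - f z)).

Let e_neq0 x : e x <> (0, 0).
Proof. by move=> [-> /eqP]; rewrite normr0 subr0 oner_eq0. Qed.

Lemma gauge0 (h : R * R -> R) : gauge h -> h (0, 0) = 0.
Proof. by case=> _ hom _; have := hom 2 (0, 0) ltac:(lra); rewrite /= !mulr0; lra. Qed.

Lemma gauge_scale (h : R * R -> R) t z : gauge h -> 0 <= t ->
  h (t * z.1, t * z.2) = t * h z.
Proof.
move=> gh; rewrite le_eqVlt => /orP[/eqP <-|t0]; last by case: gh => _ ->.
by rewrite !mul0r gauge0.
Qed.

Let k_gt0 w : rect w -> 0 < k w.
Proof.
move=> [_ _ w0 w1]; have F0 : 0 < (f (e w.1))^-1.
  by rewrite invr_gt0; case: gf => _ _; apply; exact: e_neq0.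
have G0 : 0 < (g (e w.1))^-1.
  by rewrite invr_gt0; case: gg => _ _; apply; exact: e_neq0.
by rewrite /k; nra.
Qed.

Lemma polar_fg w : rect w ->
  [/\ f (polar_map w) = k w * f (e w.1), g (polar_map w) = k w * g (e w.1),
      0 < f (e w.1) & f (e w.1) < g (e w.1)].
Proof.
move=> rw; have k0 := k_gt0 rw.
rewrite /polar_map -/(e w.1); split.
- by rewrite -(gauge_scale (e w.1) gf (ltW k0)).
- by rewrite -(gauge_scale (e w.1) gg (ltW k0)).
- by case: gf => _ _; apply; exact: e_neq0.
- apply: fg; first exact: e_neq0.
  by case: rw => ? ? _ _; rewrite /= subr_ge0 ler_norml; apply/andP; split; lra.
Qed.

Lemma polar_mapK w : rect w -> polar_inv (polar_map w) = w.
Proof.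
move=> rw; have [Ef Eg F0 FG] := polar_fg rw; have k0 := k_gt0 rw.
rewrite /polar_inv Ef Eg /polar_map /=; case: w rw k0 Ef Eg F0 FG => x l rw k0 _ _ /= F0 FG.
have kn0 : k (x, l) != 0 by rewrite gt_eqF.
have Fn0 : f (e x) != 0 by rewrite gt_eqF.
have Gn0 : g (e x) != 0 by rewrite gt_eqF//; lra.
have GFn0 : g (e x) - f (e x) != 0 by rewrite gt_eqF//; lra.
congr pair.
  rewrite normrM (gtr0_norm k0) -mulrDr addrCA subrr addr0 mulr1.
  by field.
have aux (K F G : R) : K != 0 -> G - F != 0 ->
    K * F * (K * G - 1) / (K * G - K * F) = F * (K * G - 1) / (G - F).
  by move=> K0 GF0; rewrite -mulrBr; field; rewrite K0 GF0.
rewrite aux//.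
by rewrite /k /=; field; rewrite Fn0 Gn0 GFn0.
Qed.

Lemma polar_map_closed w : rect w -> polar_closed (polar_map w).
Proof.
move=> rw; have [Ef Eg F0 FG] := polar_fg rw; have k0 := k_gt0 rw.
have G0 : 0 < g (e w.1) by lra.
rewrite /polar_closed /= Ef Eg; case: rw => ? ? l0 l1; split.
- by rewrite mulr_ge0 ?(ltW k0)// subr_ge0 ler_norml; apply/andP; split.
- rewrite /k; have -> : ((1 - w.2) / g (e w.1) + w.2 / f (e w.1)) * f (e w.1) =
    1 - (1 - w.2) * ((g (e w.1) - f (e w.1)) / g (e w.1)).
    by field; rewrite !gt_eqF.
  have : 0 <= (g (e w.1) - f (e w.1)) / g (e w.1) by rewrite divr_ge0//; lra.
  by nra.
- rewrite /k; have -> : ((1 - w.2) / g (e w.1) + w.2 / f (e w.1)) * g (e w.1) =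
    1 + w.2 * ((g (e w.1) - f (e w.1)) / f (e w.1)).
    by field; rewrite !gt_eqF.
  have : 0 <= (g (e w.1) - f (e w.1)) / f (e w.1) by rewrite divr_ge0//; lra.
  by nra.
Qed.

Lemma polar_map_open w : orect w -> polar_open (polar_map w).
Proof.
move=> [? ? l0 l1]; have rw : rect w by split; apply: ltW.
have [Ef Eg F0 FG] := polar_fg rw; have k0 := k_gt0 rw.
have G0 : 0 < g (e w.1) by lra.
rewrite /polar_open /= Ef Eg; split.
- by rewrite mulr_gt0// subr_gt0 ltr_norml; apply/andP; split.
- rewrite /k; have -> : ((1 - w.2) / g (e w.1) + w.2 / f (e w.1)) * f (e w.1) =
    1 - (1 - w.2) * ((g (e w.1) - f (e w.1)) / g (e w.1)).
    by field; rewrite !gt_eqF.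
  have : 0 < (g (e w.1) - f (e w.1)) / g (e w.1) by rewrite divr_gt0//; lra.
  by nra.
- rewrite /k; have -> : ((1 - w.2) / g (e w.1) + w.2 / f (e w.1)) * g (e w.1) =
    1 + w.2 * ((g (e w.1) - f (e w.1)) / f (e w.1)).
    by field; rewrite !gt_eqF.
  have : 0 < (g (e w.1) - f (e w.1)) / f (e w.1) by rewrite divr_gt0//; lra.
  by nra.
Qed.

Let closed_neq0 z : polar_closed z -> z <> (0, 0).
Proof. by move=> [_ _ g1] z0; move: g1; rewrite z0 gauge0//; lra. Qed.

Let norm_gt0 z : polar_closed z -> 0 < `|z.1| + z.2.
Proof.
move=> zc; have := closed_neq0 zc; case: zc => y0 _ _; case: z y0 => x y /= y0 zn.
rewrite lt_neqAle addr_ge0// andbT eq_sym; apply/eqP => xy0.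
have := normr_ge0 x => ?; apply: zn; have -> : y = 0 by lra.
by have /normr0_eq0 -> : `|x| = 0 by lra.
Qed.

Lemma polar_inv_rect z : polar_closed z -> rect (polar_inv z).
Proof.
move=> zc; have n0 := norm_gt0 zc; have f0 : 0 < f z by case: gf => _ _; apply; exact: closed_neq0.
have FG := fg (closed_neq0 zc) (let: And3 y _ _ := zc in y).
case: zc => y0 f1 g1; rewrite /polar_inv /rect /=; split.
- by rewrite ler_pdivlMr// mulN1r lerNl; have := ler_norm (- z.1); rewrite normrN; lra.
- by rewrite ler_pdivrMr// mul1r; have := ler_norm z.1; lra.
- by rewrite divr_ge0 ?mulr_ge0//; lra.
- by rewrite ler_pdivrMr ?mul1r; nra.
Qed.

Lemma polar_inv_orect z : polar_open z -> orect (polar_inv z).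
Proof.
move=> [y0 f1 g1]; have zc : polar_closed z by split; apply: ltW.
have n0 := norm_gt0 zc; have f0 : 0 < f z by case: gf => _ _; apply; exact: closed_neq0.
have FG := fg (closed_neq0 zc) (ltW y0).
rewrite /polar_inv /orect /=; split.
- by rewrite ltr_pdivlMr// mulN1r ltrNl; have := ler_norm (- z.1); rewrite normrN; lra.
- by rewrite ltr_pdivrMr// mul1r; have := ler_norm z.1; lra.
- by rewrite divr_gt0 ?mulr_gt0//; lra.
- by rewrite ltr_pdivrMr ?mul1r; nra.
Qed.

Lemma polar_invK z : polar_closed z -> polar_map (polar_inv z) = z.
Proof.
move=> zc; have n0 := norm_gt0 zc; have f0 : 0 < f z by case: gf => _ _; apply; exact: closed_neq0.
have FG := fg (closed_neq0 zc) (let: And3 y _ _ := zc in y).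
have [y0 _ _] := zc; set N := `|z.1| + z.2 in n0 *.
have nn0 : N != 0 by rewrite gt_eqF.
have Ee : e (z.1 / N) = (N^-1 * z.1, N^-1 * z.2).
  rewrite /e mulrC; congr pair; rewrite normrM gtr0_norm ?invr_gt0// -{1}(mulVf nn0) -mulrBr.
  by congr (_ * _); rewrite /N; ring.
have kE : k (polar_inv z) = N.
  rewrite /k /polar_inv /= -/N Ee !gauge_scale ?invr_ge0 ?(ltW n0)//.
  by field; rewrite nn0 !gt_eqF//; lra.
rewrite /polar_map kE /= -/N.
have -> : 1 - `|z.1 / N| = N^-1 * z.2 by case: Ee.
have aux (a b K : R) : K != 0 -> (K * (a / K), K * (K^-1 * b)) = (a, b).
  by move=> K0; congr pair; field.
by rewrite aux// -surjective_pairing.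
Qed.

Let fe_cont (h : R * R -> R) w : gauge h -> {for w, continuous (fun w : R * R => (h (e w.1))^-1)}.
Proof.
move=> [ch _ h0]; apply: continuousV; first by rewrite gt_eqF// h0//; exact: e_neq0.
apply: (@continuous_comp _ _ _ (fun w : R * R => e w.1) h); last exact: ch.
apply: continuous_at_pair; first exact: continuous_fst.
apply: continuousB; first exact: cvg_cst.
exact: (continuous_at_norm (@continuous_fst R w)).
Qed.

Lemma continuous_polar_map : continuous polar_map.
Proof.
move=> w; have kc : {for w, continuous k}.
  apply: continuousD; apply: continuousM; try exact: fe_cont; last exact: continuous_snd.
  by apply: continuousB; [exact: cvg_cst|exact: continuous_snd].
change {for w, continuous (fun w : R * R => (k w * w.1, k w * (1 - `|w.1|)))}.
have kn : {for w, continuous (fun w : R * R => 1 - `|w.1|)}.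
  apply: continuousB; first exact: cvg_cst.
  exact: (continuous_at_norm (@continuous_fst R w)).
exact: continuous_at_pair (continuousM kc (@continuous_fst R w)) (continuousM kc kn).
Qed.

Lemma continuous_polar_inv z : polar_closed z -> {for z, continuous polar_inv}.
Proof.
move=> zc; have n0 := norm_gt0 zc.
have FG := fg (closed_neq0 zc) (let: And3 y _ _ := zc in y).
have cf : {for z, continuous f} by case: gf => c _ _; exact: c.
have cg : {for z, continuous g} by case: gg => c _ _; exact: c.
change {for z, continuous (fun z : R * R =>
  (z.1 / (`|z.1| + z.2), f z * (g z - 1) / (g z - f z)))}.
apply: continuous_at_pair; apply: continuousM.
- exact: continuous_fst.
- apply: continuousV; first by rewrite gt_eqF.
  apply: continuousD; last exact: continuous_snd.
  exact: (continuous_at_norm (@continuous_fst R z)).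
- by apply: continuousM => //; apply: continuousB => //; exact: cvg_cst.
- apply: continuousV; first by rewrite gt_eqF// subr_gt0.
  exact: continuousB.
Qed.

Lemma polar_closedE : polar_closed = polar_map @` rect.
Proof.
apply/seteqP; split=> z.
  by move=> zc; exists (polar_inv z); [exact: polar_inv_rect|exact: polar_invK].
by move=> [w rw <-]; exact: polar_map_closed.
Qed.

Let rectE : rect = `[-1, 1]%classic `*` `[0, 1]%classic.
Proof.
apply/seteqP; split=> w; rewrite /rect /= !in_itv /=.
  by move=> [-> -> -> ->].
by move=> [/andP[? ?] /andP[? ?]].
Qed.

Lemma compact_polar_closed : compact polar_closed.
Proof.
rewrite polar_closedE; apply: continuous_compact.
  by apply: continuous_subspaceT; exact: continuous_polar_map.
by rewrite rectE; apply: compact_setX; exact: segment_compact.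
Qed.

Lemma open_polar_open : open polar_open.
Proof.
have -> : polar_open = [set z | 0 < z.2] `&` ([set z | f z < 1] `&` [set z | 1 < g z]).
  by apply/seteqP; split=> z; [move=> []|move=> [? []]].
apply: openI.
  apply: (@open_comp _ _ (fun z : R * R => z.2) [set y | 0 < y]); last exact: open_gt.
  by move=> *; exact: continuous_snd.
apply: openI.
  apply: (@open_comp _ _ f [set y | y < 1]); last exact: open_lt.
  by move=> *; case: gf.
apply: (@open_comp _ _ g [set y | 1 < y]); last exact: open_gt.
by move=> *; case: gg.
Qed.

Lemma closure_polar_open : closure polar_open = polar_closed.
Proof.
apply/seteqP; split.
  have /closure_id -> : closed polar_closed.
    apply: compact_closed; [exact: norm_hausdorff|exact: compact_polar_closed].
  by apply: closureS => z [? ? ?]; split; apply: ltW.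
rewrite polar_closedE => _ [w rw <-] B BP.
(* The segment from [w] to the centre [(0, 1 / 2)] of the rectangle is in the open rectangle as soon
   as [t > 0], so its image approaches the given point from inside. *)
pose u (t : R) := ((1 - t) * w.1, (1 - t) * w.2 + t / 2).
have cu : {for 0, continuous u}.
  apply: continuous_at_pair.
    apply: continuousM; last exact: cvg_cst.
    by apply: continuousB; [exact: cvg_cst|exact: cvg_id].
  apply: continuousD; apply: continuousM; try exact: cvg_cst; last exact: cvg_id.
  by apply: continuousB; [exact: cvg_cst|exact: cvg_id].
have cPu : {for 0, continuous (polar_map \o u)}.
  by apply: continuous_comp => //; exact: continuous_polar_map.
have /cPu : nbhs ((polar_map \o u) 0) B.
  by rewrite /= /u !subr0 !mul1r mul0r addr0 -surjective_pairing.
rewrite /= => /nbhs_ballP[d /= d0 dB].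
pose t := Num.min (d / 2) (1 / 2).
have t0 : 0 < t by rewrite lt_min; apply/andP; split; lra.
have t1 : t <= 1 / 2 by rewrite ge_min lexx orbT.
have td : t <= d / 2 by rewrite ge_min lexx.
exists (polar_map (u t)); split.
  by apply: polar_map_open; case: rw => ? ? ? ?; split; rewrite /u /=; nra.
by apply: dB; rewrite /ball /= sub0r normrN gtr0_norm//; lra.
Qed.

(** The rectangle is convex: its straight-line homotopy to the centre is conjugated by
    [polar_map]. *)
Lemma contractible_polar_open : contractible polar_open.
Proof.
pose H (tz : R * (R * R)) : R * R := let w := polar_inv tz.2 in
  polar_map ((1 - tz.1) * w.1, (1 - tz.1) * w.2 + tz.1 / 2).
have sub z : polar_open z -> polar_closed z by move=> [? ? ?]; split; apply: ltW.
exists (polar_map (0, 1 / 2)), H; split.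
- by apply: polar_map_open; split; rewrite /=; lra.
- apply: continuous_in_subspaceT => -[t z]; rewrite inE => -[/= _ /sub zc].
  apply: (@continuous_comp _ _ _ _ polar_map); last exact: continuous_polar_map.
  move: (continuous_polar_inv zc); generalize polar_inv => Q cQz.
  have cQ : {for (t, z), continuous (fun tz : R * (R * R) => Q tz.2)}.
    have c : {for (t, z), continuous (snd : R * (R * R) -> R * R)} by exact: cvg_snd.
    exact: (@continuous_comp _ _ _ (snd : R * (R * R) -> R * R) Q (t, z) c cQz).
  have c1 : {for (t, z), continuous (fun tz : R * (R * R) => (Q tz.2).1)}.
    exact: (@continuous_comp _ _ _ _ (fun z : R * R => z.1) (t, z) cQ (@continuous_fst R _)).
  have c2 : {for (t, z), continuous (fun tz : R * (R * R) => (Q tz.2).2)}.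
    exact: (@continuous_comp _ _ _ _ (fun z : R * R => z.2) (t, z) cQ (@continuous_snd R _)).
  have ct : {for (t, z), continuous (fun tz : R * (R * R) => tz.1)} by exact: cvg_fst.
  have c1t : {for (t, z), continuous (fun tz : R * (R * R) => 1 - tz.1)}.
    by apply: continuousB => //; exact: cvg_cst.
  apply: continuous_at_pair; first exact: continuousM.
  apply: continuousD; first exact: continuousM.
  by apply: continuousM => //; exact: cvg_cst.
- move=> t z; rewrite in_itv /= => /andP[t0 t1] /polar_inv_orect.
  rewrite /H; case: (polar_inv z) => x l [/= x0 x1 l0 l1].
  have h1 : 0 <= (1 - t) * (x + 1) by apply: mulr_ge0; lra.
  have h2 : 0 <= (1 - t) * (1 - x) by apply: mulr_ge0; lra.
  have h3 : 0 <= (1 - t) * l by apply: mulr_ge0; lra.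
  have h4 : 0 <= (1 - t) * (1 - l) by apply: mulr_ge0; lra.
  apply: polar_map_open; move: t0; rewrite le_eqVlt => /orP[/eqP <-|t0].
    by split; rewrite /= subr0 mul1r ?mul0r ?addr0.
  by split; rewrite /=; lra.
- move=> z zo; rewrite /H; split; last first.
    by rewrite subrr !mul0r add0r.
  by rewrite subr0 !mul1r mul0r addr0 -surjective_pairing polar_invK//; exact: sub.
Qed.

Lemma polar_simple_closed_curve : simple_closed_curve (polar_closed `\` polar_open).
Proof.
(* Dividing a point of the unit circle by its sup norm [N] projects it onto the boundary of a
   square; [w] then squeezes the second coordinate into the unit interval. *)
pose N (t : R) := Num.max `|cos (2 * pi * t)| `|sin (2 * pi * t)|.
have N0 t : 0 < N t.
  rewrite lt_max; apply/orP; have cs1 := cos2Dsin2 (2 * pi * t).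
  have [c0|c0] := eqVneq (cos (2 * pi * t)) 0; last by left; rewrite normr_gt0.
  by right; rewrite normr_gt0; apply/eqP => s0; move: cs1; rewrite c0 s0; lra.
pose w (t : R) := (cos (2 * pi * t) / N t, (sin (2 * pi * t) / N t + 1) / 2).
have side t : [/\ rect (w t) & ~ orect (w t)].
  have n0 := N0 t; split.
    have ci : `|cos (2 * pi * t)| <= N t by rewrite le_max lexx.
    have si : `|sin (2 * pi * t)| <= N t by rewrite le_max lexx orbT.
    move: ci si; rewrite !ler_norml => /andP[? ?] /andP[? ?].
    have n1 : -1 <= cos (2 * pi * t) / N t by rewrite ler_pdivlMr//; lra.
    have n2 : cos (2 * pi * t) / N t <= 1 by rewrite ler_pdivrMr//; lra.
    have n3 : -1 <= sin (2 * pi * t) / N t by rewrite ler_pdivlMr//; lra.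
    have n4 : sin (2 * pi * t) / N t <= 1 by rewrite ler_pdivrMr//; lra.
    by split; rewrite /=; lra.
  move=> [/= c1 c2 s1 s2].
  have : N t < N t.
    rewrite {1}/N gt_max !ltr_norml; apply/andP; split; apply/andP; split.
    - by move: c1; rewrite ltr_pdivlMr// mulN1r.
    - by move: c2; rewrite ltr_pdivrMr// mul1r.
    - have : -1 < sin (2 * pi * t) / N t by lra.
      by rewrite ltr_pdivlMr// mulN1r.
    - have : sin (2 * pi * t) / N t < 1 by lra.
      by rewrite ltr_pdivrMr// mul1r.
  by rewrite ltxx.
have ccos : continuous (fun t : R => cos (2 * pi * t)).
  move=> t; apply: (@continuous_comp _ _ _ (fun t => 2 * pi * t) cos); last exact: continuous_cos.
  by apply: continuousM; [exact: cvg_cst|exact: cvg_id].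
have csin : continuous (fun t : R => sin (2 * pi * t)).
  move=> t; apply: (@continuous_comp _ _ _ (fun t => 2 * pi * t) sin); last exact: continuous_sin.
  by apply: continuousM; [exact: cvg_cst|exact: cvg_id].
have cN : continuous N.
  move=> t; apply: (@continuous_max _ _ (fun t => `|cos (2 * pi * t)|) (fun t => `|sin (2 * pi * t)|)).
    exact: (continuous_at_norm (ccos t)).
  exact: (continuous_at_norm (csin t)).
have cNV t : {for t, continuous (fun t => (N t)^-1)}.
  by apply: continuousV; [rewrite gt_eqF|exact: cN].
have cw : continuous w.
  move=> t; apply: (continuous_at_pair (continuousM (ccos t) (cNV t))).
  apply: continuousM; last exact: cvg_cst.
  by apply: continuousD; [exact: continuousM (csin t) (cNV t)|exact: cvg_cst].
exists (polar_map \o w); split.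
- apply: continuous_subspaceT => t; apply: continuous_comp; first exact: cw.
  exact: continuous_polar_map.
- rewrite /= /w /N mulr0 mulr1 cos0 sin0 [2 * pi]mulr_natl cos2pi sin2pi//.
- move=> t t'; rewrite !in_itv /= => /andP[t0 t1] /andP[t'0 t'1] /(congr1 polar_inv).
  have [r1 _] := side t; have [r2 _] := side t'.
  rewrite !polar_mapK// => -[]; set c := cos _; set c' := cos _; set s := sin _; set s' := sin _.
  have n0 := N0 t; have n'0 := N0 t'; move: (N t) (N t') n0 n'0 => n n' n0 n'0 ec es.
  have cs : c ^+ 2 + s ^+ 2 = 1 by exact: cos2Dsin2.
  have cs' : c' ^+ 2 + s' ^+ 2 = 1 by exact: cos2Dsin2.
  have {}es : s / n = s' / n' by lra.
  (* The projected point has squared Euclidean length [1 / n ^+ 2], which determines [n]. *)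
  have nn : n = n'.
    have : (c / n) ^+ 2 + (s / n) ^+ 2 = (c' / n') ^+ 2 + (s' / n') ^+ 2 by rewrite ec es.
    rewrite !expr_div_n -!mulrDl cs cs' !mul1r => /(congr1 GRing.inv); rewrite !invrK.
    by move=> /eqP; rewrite eqrXn2 ?ltW// => /eqP.
  have cc : c = c' by move: ec; rewrite nn => /(mulIf (invr_neq0 (lt0r_neq0 n'0))).
  have ss : s = s' by move: es; rewrite nn => /(mulIf (invr_neq0 (lt0r_neq0 n'0))).
  have : cos (2 * pi * (t - t')) = 1.
    by rewrite mulrBr cosB -/c -/c' -/s -/s' cc ss -cs'; ring.
  have pi0 := pi_gt0 R.
  wlog tt' : t t' t0 t1 t'0 t'1 {c c' s s' ec es cs cs' cc ss r1 r2} / t' <= t.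
    move=> W; have [?|/ltW ?] := leP t' t; first exact: W.
    rewrite -cosN -mulrN opprB => ?; apply/esym; exact: W.
  move=> c1; have [//|] := eqVneq t t'; rewrite -subr_eq0 => d0; exfalso.
  have {}d0 : 0 < t - t' by rewrite lt_neqAle eq_sym d0/= subr_ge0.
  have d1 : t - t' < 1 by lra.
  have : 0 < sin (pi * (t - t')) by apply: sin_gt0_pi; apply/andP; split; nra.
  have := c1; rewrite -mulrA mulr_natl cos_mulr2n => c1'.
  have := cos2Dsin2 (pi * (t - t')); rewrite -mulr_natl in c1'; nra.
- apply/seteqP; split=> z.
    move=> [zc zo]; have [x1 x2 y1 y2] := polar_inv_rect zc; have Pz := polar_invK zc.
    have no : ~ orect (polar_inv z) by move=> /polar_map_open; rewrite Pz.
    case: (polar_inv z) x1 x2 y1 y2 Pz no => x l /= x1 x2 y1 y2 Pz no.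
    pose y := 2 * l - 1.
    have m1 : Num.max `|x| `|y| = 1.
      apply/eqP; rewrite eq_le; apply/andP; split.
        by rewrite ge_max !ler_norml; apply/andP; split; apply/andP; split; rewrite /y; lra.
      rewrite leNgt; apply/negP; rewrite gt_max !ltr_norml => /andP[/andP[X1 X2] /andP[Y1 Y2]].
      by apply: no; rewrite /y in Y1 Y2; split => //=; lra.
    pose M := Num.sqrt (x ^+ 2 + y ^+ 2).
    have M2 : M ^+ 2 = x ^+ 2 + y ^+ 2 by rewrite sqr_sqrtr; nra.
    have M0 : 0 < M.
      rewrite sqrtr_gt0; move: m1 => m1; rewrite lt_neqAle addr_ge0 ?sqr_ge0// andbT eq_sym.
      apply/eqP => xy0; have x0 : x = 0 by nra.
      have y0 : y = 0 by nra.
      by move: m1; rewrite x0 y0 normr0 maxxx; lra.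
    have Mn : M != 0 by rewrite gt_eqF.
    have [|t [t0 t1 ct st]] := @unit_circle_angle R (x / M) (y / M).
      by rewrite !expr_div_n -mulrDl -M2 divff// expf_neq0.
    have pi0 := pi_gt0 R; have p2 : 0 < 2 * pi :> R by lra.
    have tE : 2 * pi * (t / (2 * pi)) = t by rewrite mulrC divfK// gt_eqF.
    exists (t / (2 * pi)).
      rewrite /= in_itv /=; apply/andP; split; first by rewrite divr_ge0// ltW.
      by rewrite ler_pdivrMr// mul1r ltW.
    rewrite /= -Pz /w /N tE ct st !normrM !normfV (gtr0_norm M0).
    rewrite -maxr_pMl ?invr_ge0 ?(ltW M0)// m1.
    congr (polar_map (_, _)); first by field.
    by rewrite mul1r invrK divfK// /y; field.
  move=> [t _ <-]; have [r no] := side t; split; first exact: polar_map_closed.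
  by move=> /polar_inv_orect; rewrite /= polar_mapK.
Qed.

Let open_closed : polar_open `<=` polar_closed.
Proof. by move=> z [? ? ?]; split; apply: ltW. Qed.

Lemma bounds_polar : bounds (polar_closed `\` polar_open) polar_open.
Proof.
split.
- exact: polar_simple_closed_curve.
- exact: open_polar_open.
- have := compact_bounded compact_polar_closed.
  by rewrite /= /bounded_near; apply: filterS => M bM z /open_closed; exact: bM.
- exact: contractible_polar_open.
- by rewrite closure_polar_open.
Qed.

Lemma tile_boundary_polar :
  tile_boundary polar_closed (polar_closed `\` polar_open).
Proof. by exists polar_open; [exact: bounds_polar|rewrite setDUK]. Qed.

(** A point of [V] can be moved a little downwards, outwards and inwards without leaving the closed
    region, and each of these moves makes one of the three inequalities strict. This is the
    maximality that uniqueness of the boundary relies on. *)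
Lemma polar_open_max V : open V -> V `<=` polar_closed -> V `<=` polar_open.
Proof.
move=> oV Vc z Vz; have zc := Vc _ Vz; have zn := closed_neq0 zc.
have f0 : 0 < f z by case: gf => _ _; apply.
have g0 : 0 < g z by case: gg => _ _; apply.
have /nbhs_ballP[d /= d0 dV] : nbhs z V by exact: open_nbhs_nbhs.
have inV a b : `|z.1 - a| < d -> `|z.2 - b| < d -> V (a, b) by move=> ? ?; apply: dV.
(* Scaling by a factor within [eps] of 1 moves each coordinate of [z] by less than [d]. *)
pose eps := d / (2 * (`|z.1| + `|z.2| + 1)).
have n1 := normr_ge0 z.1; have n2 := normr_ge0 z.2.
have D0 : 0 < 2 * (`|z.1| + `|z.2| + 1) by lra.
have eps0 : 0 < eps by rewrite divr_gt0.
have small x : `|x| <= `|z.1| + `|z.2| -> `|eps * x| < d.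
  move=> xz; rewrite normrM gtr0_norm// /eps mulrAC ltr_pdivrMr// ltr_pM2l//; lra.
have scale t : `|1 - t| <= eps -> V (t * z.1, t * z.2).
  move=> te; apply: inV.
    rewrite -{1}[z.1]mul1r -mulrBl normrM; apply: le_lt_trans (small z.1 _); last by lra.
    by rewrite normrM (gtr0_norm eps0) ler_wpM2r.
  rewrite -{1}[z.2]mul1r -mulrBl normrM; apply: le_lt_trans (small z.2 _); last by lra.
  by rewrite normrM (gtr0_norm eps0) ler_wpM2r.
pose t := Num.min eps (1 / 2).
have t0 : 0 < t by rewrite lt_min eps0; lra.
have t1 : t <= 1 / 2 by rewrite ge_min lexx orbT.
have te : t <= eps by rewrite ge_min lexx.
split.
- have := Vc _ (inV z.1 (z.2 - d / 2) _ _) => -[||/= + _ _]; last by lra.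
    by rewrite subrr normr0.
  by rewrite opprB addrCA subrr addr0 gtr0_norm; lra.
- have [|_ fs _] := Vc _ (scale (1 + t) _); first by rewrite opprD addrA subrr sub0r normrN gtr0_norm.
  by move: fs; rewrite gauge_scale//; [nra|lra].
- have [|_ _ gs] := Vc _ (scale (1 - t) _); first by rewrite opprB addrCA subrr addr0 gtr0_norm.
  by move: gs; rewrite gauge_scale//; [nra|lra].
Qed.

(** In the rectangle the path follows the bottom side for [t <= 1 / 2], which gives the inner curve,
    and then climbs the right side, which gives a segment of the positive first axis. *)
Definition polar_path (t : R) : R * R :=
  polar_map (Num.min (4 * t - 1) 1, Num.max 0 (2 * t - 1)).

Let path_cases (t : R) : 0 <= t <= 1 ->
  (t <= 1 / 2 /\ (Num.min (4 * t - 1) 1, Num.max 0 (2 * t - 1)) = (4 * t - 1, 0)) \/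
  (1 / 2 <= t /\ (Num.min (4 * t - 1) 1, Num.max 0 (2 * t - 1)) = (1, 2 * t - 1)).
Proof.
move=> t01; have [t2|t2] := leP t (1 / 2); [left|right]; split => //; try exact: ltW.
  by rewrite min_l ?max_l//; lra.
by rewrite min_r ?max_r//; lra.
Qed.

Let path_rect (t : R) : 0 <= t <= 1 -> rect (Num.min (4 * t - 1) 1, Num.max 0 (2 * t - 1)).
Proof. by move=> t01; have [[t2 ->]|[t2 ->]] := path_cases t01; split; rewrite /=; lra. Qed.

Lemma polar_path_segment : curve_segment polar_path.
Proof.
split.
  apply: continuous_subspaceT => t.
  have lin (a b : R) : {for t, continuous (fun t : R => a * t - b)}.
    by apply: continuousB; [apply: continuousM; [exact: cvg_cst|exact: cvg_id]|exact: cvg_cst].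
  have c1 : {for t, continuous (fun t : R => Num.min (4 * t - 1) 1)}.
    by apply: (@continuous_min R R (fun t => 4 * t - 1) (fun=> 1)); [exact: lin|exact: cvg_cst].
  have c2 : {for t, continuous (fun t : R => Num.max 0 (2 * t - 1))}.
    by apply: (@continuous_max R R (fun=> 0) (fun t => 2 * t - 1)); [exact: cvg_cst|exact: lin].
  exact: (@continuous_comp _ _ _ _ polar_map t (continuous_at_pair c1 c2) (@continuous_polar_map _)).
move=> t u; rewrite !in_itv /= => t01 u01 /(congr1 polar_inv).
rewrite !polar_mapK; try exact: path_rect.
have [[t2 ->]|[t2 ->]] := path_cases t01; have [[u2 ->]|[u2 ->]] := path_cases u01 => -[]; lra.
Qed.

Let polar_map_bottom w : rect w -> w.2 = 0 -> g (polar_map w) = 1.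
Proof.
move=> rw w0; have [_ -> F0 FG] := polar_fg rw.
by rewrite /k w0 subr0 mul0r addr0 mul1r mulVf// gt_eqF//; lra.
Qed.

Let polar_map_right w : rect w -> w.1 = 1 -> polar_map w = (k w, 0).
Proof. by move=> rw w1; rewrite /polar_map w1 normr1 subrr mulr0 mulr1. Qed.

Lemma polar_path_image : polar_path @` `[0, 1] =
  [set z | polar_closed z /\ (g z = 1 \/ z.2 = 0 /\ 0 < z.1)].
Proof.
apply/seteqP; split=> z.
  move=> [t /=]; rewrite in_itv /= => t01 <-; have rw := path_rect t01.
  split; first exact: polar_map_closed.
  rewrite /polar_path; move: rw; have [[t2 ->]|[t2 ->]] := path_cases t01 => rw.
    by left; rewrite polar_map_bottom.
  by right; rewrite polar_map_right//; split => //; exact: k_gt0.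
move=> [zc zE]; have ri := polar_inv_rect zc; have zi := polar_invK zc.
case: zE => [gz|[z2 z1]].
  have l0 : (polar_inv z).2 = 0 by rewrite /polar_inv /= gz subrr mulr0 mul0r.
  case: (polar_inv z) ri zi l0 => x l /= [/= x1 x2 _ _] zi l0.
  exists ((x + 1) / 4); first by rewrite /= in_itv /=; lra.
  by rewrite /polar_path min_l ?max_l; [|lra|lra]; rewrite -zi l0; congr (polar_map (_, _)); lra.
have x1 : (polar_inv z).1 = 1 by rewrite /polar_inv /= z2 addr0 gtr0_norm// divff// gt_eqF.
case: (polar_inv z) ri zi x1 => x l /= [/= _ _ l0 l1] zi x1.
exists ((l + 1) / 2); first by rewrite /= in_itv /=; lra.
by rewrite /polar_path min_r ?max_r; [|lra|lra]; rewrite -zi x1; congr (polar_map (_, _)); lra.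
Qed.

Lemma polar_path0 : polar_path 0 = (- (g (-1, 0))^-1, 0).
Proof.
rewrite /polar_path mulr0 sub0r min_l ?max_l; [|lra|lra].
by rewrite /polar_map /k /e /= normrN1 subrr mulr0 subr0 mul0r addr0 mul1r mulrN1.
Qed.

Lemma polar_path1 : polar_path 1 = ((f (1, 0))^-1, 0).
Proof.
rewrite /polar_path !mulr1 min_r ?max_r; [|lra|lra].
have -> : 2 - 1 = 1 :> R by ring.
by rewrite /polar_map /k /e /= normr1 !subrr !mulr0 mul0r add0r mulr1 mul1r.
Qed.

End PolarRegion.

(** * Uniqueness of the boundary of a tile *)

Section UnitInterval.
Variable R : realType.

(** Precomposition with [clamp] extends a curve on the unit interval to a continuous curve on the
    whole line, constant on either side. *)
Definition clamp (t : R) : R := Num.max 0 (Num.min t 1).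

Lemma clamp_in t : `[0, 1]%classic (clamp t).
Proof.
by rewrite /= in_itv /= /clamp le_max lexx /= ge_max ler01 ge_min lexx orbT.
Qed.

Lemma clampK t : `[0, 1]%classic t -> clamp t = t.
Proof.
rewrite /= in_itv /= /clamp => /andP[t0 t1].
by rewrite (min_idPl t1) (max_idPr t0).
Qed.

Lemma continuous_clamp : continuous clamp.
Proof.
move=> t; change {for t, continuous (fun t : R => Num.max 0 (Num.min t 1))}.
apply: (@continuous_max R R (fun=> 0) (fun t => Num.min t 1)); first exact: cvg_cst.
by apply: (@continuous_min _ _ id (fun=> 1)); [exact: cvg_id|exact: cvg_cst].
Qed.

Lemma continuous_comp_clamp (T : topologicalType) (f : R -> T) :
  {within `[0, 1], continuous f} -> continuous (f \o clamp).
Proof.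
move=> /subspace_continuousP cf t B fB.
have : nbhs (clamp t) [set x | `[0, 1]%classic x -> B (f x)] by exact: (cf _ (clamp_in t) _ fB).
move=> /(@continuous_clamp t) cB; change (nbhs t ((f \o clamp) @^-1` B)).
have {}cB : nbhs t (clamp @^-1` [set x | `[0, 1]%classic x -> B (f x)]) by exact: cB.
by apply: filterS cB => x; apply; exact: clamp_in.
Qed.

(** Otherwise the preimages of [A] and [B] would disconnect the interval. *)
Lemma closed_cover_meet (T : topologicalType) (f : R -> T) (x y : R) (A B : set T) :
  x <= y -> continuous f -> closed A -> closed B -> A (f x) -> B (f y) ->
  (forall c, x <= c <= y -> A (f c) \/ B (f c)) ->
  exists2 c, x <= c <= y & A (f c) /\ B (f c).
Proof.
move=> xy cf cA cB Ax By cov.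
have cVA : closed (f @^-1` A) by apply: preimage_closed => // *; exact: cf.
have cVB : closed (f @^-1` B) by apply: preimage_closed => // *; exact: cf.
apply: contrapT => nmeet.
have E : `[x, y] `&` f @^-1` A = `[x, y]%classic.
  apply: (@segment_connected R x y).
  - by exists x; split => //=; rewrite in_itv /= lexx.
  - exists (~` (f @^-1` B)); first exact: closed_openC.
    apply/seteqP; split=> c [/= cxy fc]; split => //.
      by move=> fB; apply: nmeet; exists c => //; move: cxy; rewrite in_itv.
    by have [] := cov c; move: cxy; rewrite ?in_itv.
  - by exists (f @^-1` A).
have : `[x, y]%classic y by rewrite /= in_itv /= lexx andbT.
by rewrite -E => -[_ Ay]; apply: nmeet; exists y => //; rewrite lexx andbT.
Qed.

Lemma simple_closed_curve_rebase (c : set (R * R)) z : simple_closed_curve c -> c z ->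
  exists f : R -> R * R, [/\ continuous f, f 0 = z, f 1 = z,
    {in `[0, 1[ &, injective f} & c = f @` `[0, 1]].
Proof.
move=> [k [ck k01 kinj ->]] [s /=]; rewrite in_itv /= => /andP[s0 s1] <- {z}.
wlog slt : s s0 s1 / s < 1.
  move=> W; have [|s1'] := ltP s 1; first exact: W.
  have -> : s = 1 by apply/eqP; rewrite eq_le s1.
  by rewrite -k01; apply: W => //; lra.
pose K (t : R) := k (clamp t).
have cK : continuous K by exact: continuous_comp_clamp.
have KE t : 0 <= t <= 1 -> K t = k t by move=> t01; rewrite /K clampK//= in_itv.
have clampl t : t <= 0 -> clamp t = 0.
  move=> t0; rewrite /clamp (min_idPl _) ?(max_idPl _)//; lra.
have clampr t : 1 <= t -> clamp t = 1.
  by move=> t1; rewrite /clamp (min_idPr t1) (max_idPr ler01).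
(* Outside the unit interval [K] keeps the value [k 0 = k 1], so one of the two terms always cancels
   [k 0]. The loop with shifted origin is thus a sum of continuous functions. *)
pose f (t : R) := (K (t + s) + K (t + s - 1) - k 0).
have f1 t : t + s <= 1 -> f t = K (t + s).
  by move=> ts; rewrite /f {2}/K clampl ?addrK//; lra.
have f2 t : 1 <= t + s -> f t = K (t + s - 1).
  by move=> ts; rewrite /f {1}/K clampr// -k01 addrC addKr.
have inE' (t : R) : t \in `[0, 1[ -> 0 <= t /\ t < 1 by rewrite in_itv => /andP[].
exists f; split.
- move=> t; apply: cvgB; last exact: cvg_cst.
  apply: cvgD.
    apply: (@continuous_comp _ _ _ (fun t => t + s) K); last exact: cK.
    by apply: continuousD; [exact: cvg_id|exact: cvg_cst].
  apply: (@continuous_comp _ _ _ (fun t => t + s - 1) K); last exact: cK.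
  by apply: continuousB; [apply: continuousD; [exact: cvg_id|exact: cvg_cst]|exact: cvg_cst].
- by rewrite f1 ?add0r ?KE//; lra.
- by rewrite f2 ?KE; [congr (k _); ring| |]; lra.
- move=> t u /inE'[t0 t1] /inE'[u0 u1].
  wlog tu : t u t0 t1 u0 u1 / t <= u.
    by move=> W; have [?|/ltW ?] := leP t u; [exact: W|move=> /esym e; apply/esym; exact: W].
  have inj x y : 0 <= x < 1 -> 0 <= y < 1 -> k x = k y -> x = y.
    by move=> x01 y01; apply: kinj; rewrite in_itv.
  have [us|us] := leP 1 (u + s); have [ts|ts] := leP 1 (t + s).
  + by rewrite !f2// !KE; [move/inj => e; have := e _ _; lra|lra|lra].
  + rewrite (f2 u)// (f1 t) ?ltW// !KE; [move/inj => e; exfalso|lra|lra].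
    by have := e ltac:(lra) ltac:(lra); lra.
  + have : u + s < u + s by lra.
    by rewrite ltxx.
  + by rewrite !f1 ?ltW// !KE; [move/inj => e; have := e _ _; lra|lra|lra].
- apply/seteqP; split=> y [t /=]; rewrite in_itv /= => /andP[t0 t1] <-.
    have [ts|ts] := leP s t.
      exists (t - s); first by rewrite /= in_itv /=; lra.
      by rewrite f1 subrK ?KE//; lra.
    exists (t - s + 1); first by rewrite /= in_itv /=; lra.
    by rewrite f2 ?KE; [congr k; ring|lra|lra].
  have [ts|ts] := leP (t + s) 1.
    by rewrite f1// KE; [exists (t + s) => //=; rewrite in_itv /=; lra|lra].
  by rewrite f2 ?(ltW ts)// KE; [exists (t + s - 1) => //=; rewrite in_itv /=; lra|lra].
Qed.

(** If [d] had a point off [c], cutting [d] open there would leave an arc that contains the loop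
    [c]. Two points of [c] bound two halves of it, and by connectedness each half passes through the
    point [k v] of the arc strictly between them, so [f] takes the value [k v] twice. *)
Lemma simple_closed_curve_maximal (c d : set (R * R)) :
  simple_closed_curve c -> simple_closed_curve d -> c `<=` d -> c = d.
Proof.
move=> sc sd cd; apply/seteqP; split => // z dz; apply: contrapT => ncz.
have [k [ck k0 k1 kinj dE]] := simple_closed_curve_rebase sd dz.
have [w cw] : c !=set0.
  by case: sc => f [_ _ _ ->]; exists (f 0), 0 => //=; rewrite in_itv /= lexx ler01.
have [f [cf f0 f1 finj cE]] := simple_closed_curve_rebase sc cw.
have cfin t : 0 <= t <= 1 -> c (f t) by move=> t01; rewrite cE; exists t => //=; rewrite in_itv.
have par t : 0 <= t <= 1 -> exists2 s, 0 < s < 1 & k s = f t.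
  move=> /cfin cft; have := cd _ cft; rewrite dE => -[s /=]; rewrite in_itv /= => /andP[s0 s1] ks.
  exists s => //; apply/andP; split; rewrite lt_neqAle.
    by rewrite s0 andbT; apply/eqP => e; apply: ncz; rewrite -k0 e ks.
  by rewrite s1 andbT; apply/eqP => e; apply: ncz; rewrite -k1 -e ks.
have kinj' x y : 0 < x < 1 -> 0 < y < 1 -> k x = k y -> x = y.
  by move=> ? ?; apply: kinj; rewrite in_itv /=; lra.
have finj' x y : 0 <= x < 1 -> 0 <= y < 1 -> f x = f y -> x = y.
  by move=> ? ?; apply: finj; rewrite in_itv /=.
have [s0 s0i ks0] := par 0 ltac:(lra).
have [s1 s1i ks1] := par (1 / 2) ltac:(lra).
have s01 : s0 != s1.
  by apply/eqP => e; have := finj' 0 (1 / 2) ltac:(lra) ltac:(lra); rewrite -ks0 -ks1 e => /(_ erefl); lra.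
pose v := (s0 + s1) / 2.
pose lo := k @` `[0, v]; pose hi := k @` `[v, 1].
have clim (a b : R) : closed (k @` `[a, b]).
  apply: compact_closed; first exact: norm_hausdorff.
  by apply: continuous_compact; [exact: continuous_subspaceT|exact: segment_compact].
have meet x y : 0 <= x -> x <= y -> y <= 1 -> forall a b, 0 < a < 1 -> 0 < b < 1 ->
    k a = f x -> k b = f y -> (a < v < b) \/ (b < v < a) ->
    exists2 c, x <= c <= y & f c = k v.
  move=> x0 xy y1 a b a01 b01 ka kb ab.
  have cov e : x <= e <= y -> lo (f e) \/ hi (f e).
    move=> exy; have [s s01' <-] := par e ltac:(lra); have [sv|sv] := leP s v.
      by left; exists s => //=; rewrite in_itv /=; lra.
    by right; exists s => //=; rewrite in_itv /=; lra.
  have fin e : lo (f e) -> hi (f e) -> 0 <= e <= 1 -> f e = k v.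
    move=> [p /=]; rewrite in_itv /= => /andP[p0 pv] kp [q /=]; rewrite in_itv /= => /andP[qv q1] kq e01.
    have [s ss ks] := par e e01; have v01 : 0 < v < 1 by rewrite /v; lra.
    have p_0 : p != 0.
      by apply/eqP => p0'; apply: ncz; rewrite -k0 -p0' kp; exact: cfin.
    have q_1 : q != 1.
      by apply/eqP => q1'; apply: ncz; rewrite -k1 -q1' kq; exact: cfin.
    have pgt : 0 < p by rewrite lt_neqAle eq_sym p_0.
    have qlt : q < 1 by rewrite lt_neqAle q_1.
    have pq : p = q by apply: kinj'; [lra|lra|rewrite kp kq].
    by rewrite -kp; congr k; lra.
  have loP u : 0 <= u <= v -> lo (k u) by move=> ?; exists u => //=; rewrite in_itv.
  have hiP u : v <= u <= 1 -> hi (k u) by move=> ?; exists u => //=; rewrite in_itv.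
  case: ab => ab.
    have [|||||e exy [le he]] := @closed_cover_meet _ f x y lo hi xy cf; try exact: clim.
    - by rewrite -ka; apply: loP; lra.
    - by rewrite -kb; apply: hiP; lra.
    - exact: cov.
    by exists e => //; apply: fin => //; lra.
  have [|||||e exy [he le]] := @closed_cover_meet _ f x y hi lo xy cf; try exact: clim.
  - by rewrite -ka; apply: hiP; lra.
  - by rewrite -kb; apply: loP; lra.
  - by move=> e /cov[]; [right|left].
  by exists e => //; apply: fin => //; lra.
have vs : (s0 < v < s1) \/ (s1 < v < s0).
  by move: s01; rewrite neq_lt => /orP[?|?]; [left|right]; rewrite /v; lra.
have [c1 c1i fc1] := meet 0 (1 / 2) ltac:(lra) ltac:(lra) ltac:(lra) _ _ s0i s1i ks0 ks1 vs.
have ks0' : k s0 = f 1 by rewrite ks0 f0 f1.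
have vs' : (s1 < v < s0) \/ (s0 < v < s1) by case: vs; [right|left].
have [c2 c2i fc2] := meet (1 / 2) 1 ltac:(lra) ltac:(lra) ltac:(lra) _ _ s1i s0i ks1 ks0' vs'.
have v01 : 0 < v < 1 by rewrite /v; lra.
have c11 : c1 <> 1 / 2.
  by move=> e; have /kinj' : k s1 = k v by [rewrite ks1 -e]; move=> /(_ s1i v01); lra.
have c21 : c2 <> 1.
  by move=> e; have /kinj' : k s0 = k v by [rewrite ks0' -e]; move=> /(_ s0i v01); lra.
have c2lt : c2 < 1 by rewrite lt_neqAle; apply/andP; split; [exact/eqP|lra].
have c1lt : c1 < 1 / 2 by rewrite lt_neqAle; apply/andP; split; [exact/eqP|lra].
by have := finj' c1 c2 ltac:(lra) ltac:(lra); rewrite fc1 fc2 => /(_ erefl); lra.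
Qed.

(** An open set that makes up [T] together with [d] lies in [U] by maximality. Hence [d] contains
    [c], and nested simple closed curves coincide. *)
Lemma tile_boundary_unique (T U c d : set (R * R)) :
  bounds c U -> T = U `|` c -> (forall V, open V -> V `<=` T -> V `<=` U) ->
  tile_boundary T d -> d = c.
Proof.
move=> bU TE maxU [V bV TE']; have [scd oV _ _ clV] := bV; have [scc oU _ _ clU] := bU.
have VU : V `<=` U by apply: maxU => // z Vz; rewrite TE'; left.
apply/esym/simple_closed_curve_maximal => // z cz.
have : T z by rewrite TE; right.
rewrite TE' => -[/VU Uz|//].
by move: cz; rewrite -clU => -[_].
Qed.

End UnitInterval.

(** * Transport along similarities *)

Section Transport.
Variable R : realType.
Implicit Types (T U A B : set (R * R)) (p q x y z : R * R).

Lemma within_continuous_precomp (X Y Z : topologicalType) (g : X -> Y) (h : Y -> Z)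
    (A : set X) (B : set Y) :
  continuous g -> (forall u, A u -> B (g u)) -> {within B, continuous h} ->
  {within A, continuous (h \o g)}.
Proof.
move=> cg AB /subspace_continuousP ch; apply/subspace_continuousP => u Au V hV.
have : nbhs (g u) [set v | B v -> V (h v)] by exact: (ch _ (AB _ Au) _ hV).
move=> /(cg u) gV; have {}gV : nbhs u (g @^-1` [set v | B v -> V (h v)]) by exact: gV.
change (nbhs u [set v | A v -> V (h (g v))]).
by apply: filterS gV => v hv /AB; exact: hv.
Qed.

Lemma bounded_set_continuous_image (f : R * R -> R * R) A :
  continuous f -> bounded_set A -> bounded_set (f @` A).
Proof.
move=> cf; rewrite /= /bounded_near => -[M [Mreal bM]].
have {}bM := bM (`|M| + 1) ltac:(by have := ler_norm M; lra).
pose m := `|M| + 1.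
have cK : compact (`[- m, m]%classic `*` `[- m, m]%classic : set (R * R)).
  by apply: compact_setX; exact: segment_compact.
have : bounded_set (f @` (`[- m, m]%classic `*` `[- m, m]%classic)).
  by apply: compact_bounded; apply: continuous_compact => //; exact: continuous_subspaceT.
rewrite /= /bounded_near; apply: filterS => N bN _ [z Az <-]; apply: bN; exists z => //.
have : `|z| <= `|M| + 1 := bM _ Az.
rewrite prod_normE ge_max /= => /andP[].
by rewrite !ler_norml !in_itv.
Qed.

Section Homeomorphism.
Variables (f g : R * R -> R * R).
Hypotheses (cf : continuous f) (cg : continuous g) (fK : cancel f g) (gK : cancel g f).

Let imageE A : f @` A = g @^-1` A.
Proof.
by apply/seteqP; split=> [_ [z Az <-]|z Az]; [rewrite /= fK|exists (g z)].
Qed.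

Lemma simple_closed_curve_image c : simple_closed_curve c -> simple_closed_curve (f @` c).
Proof.
move=> [k [ck k01 kinj ->]]; exists (f \o k); split.
- by apply: within_continuous_comp => //; move=> z _; exact: cf.
- by rewrite /= k01.
- by move=> s t s01 t01 /(can_inj fK); exact: kinj.
- by rewrite image_comp.
Qed.

Lemma contractible_image U : contractible U -> contractible (f @` U).
Proof.
move=> [x0 [H [Ux0 cH HU H01]]].
exists (f x0), (fun tz => f (H (tz.1, g tz.2))); split.
- by exists x0.
- have cgg : continuous (fun tz : R * (R * R) => (tz.1, g tz.2)).
    move=> [t z]; apply: continuous_at_pair; first exact: cvg_fst.
    by apply: (@continuous_comp _ _ _ (snd : R * (R * R) -> R * R) g (t, z));
      [exact: cvg_snd|exact: cg].
  have cHg : {within `[0, 1] `*` (f @` U), continuous (H \o (fun tz : R * (R * R) => (tz.1, g tz.2)))}.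
    by apply: (within_continuous_precomp cgg _ cH) => -[t z] /= [t01 [w Uw <-]]; rewrite fK.
  exact: (@within_continuous_comp _ _ _ _ _ f (fun z _ => @cf z) cHg).
- by move=> t _ t01 [w Uw <-]; exists (H (t, w)); [exact: HU|rewrite /= fK].
- by move=> _ [w Uw <-]; have [H0 H1] := H01 _ Uw; rewrite /= fK H0 H1.
Qed.

Lemma closure_image A : closure (f @` A) = f @` closure A.
Proof.
apply/seteqP; split=> [z clz|_ [z clz <-]].
  exists (g z) => // B Bz; have [] := clz (g @^-1` B); first exact: cg.
  by move=> _ [[w Aw <-]]; rewrite /= fK => Bw; exists w.
move=> B Bz; have [w [Aw Bw]] := clz _ (cf Bz).
by exists (f w); split => //; exists w.
Qed.

Lemma tile_boundary_image T c : tile_boundary T c -> tile_boundary (f @` T) (f @` c).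
Proof.
move=> [U [sc oU bU cU clU] ->]; exists (f @` U); last by rewrite image_setU.
split.
- exact: simple_closed_curve_image.
- by rewrite imageE; apply: open_comp => // *; exact: cg.
- exact: bounded_set_continuous_image.
- exact: contractible_image.
- rewrite closure_image -clU; apply/seteqP; split=> z.
    by move=> [[w cw <-] nU]; exists w => //; split => // Uw; apply: nU; exists w.
  by move=> [w [cw nU] <-]; split; [exists w|move=> [v Uv /(can_inj fK) e]; apply: nU; rewrite -e].
Qed.

Lemma meet_along_boundaries_image T1 T2 :
  meet_along_boundaries T1 T2 -> meet_along_boundaries (f @` T1) (f @` T2).
Proof.
move=> [c1 [c2 [b1 b2 sub]]]; exists (f @` c1), (f @` c2); split.
- exact: tile_boundary_image.
- exact: tile_boundary_image.
- move=> z [[w1 T1w <-] [w2 T2w /(can_inj fK) e]].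
  have [] := sub w1; first by split => //; rewrite -e.
  by move=> ? ?; split; exists w1.
Qed.

End Homeomorphism.

Lemma curve_segment_comp (f g : R * R -> R * R) (eta : R -> R * R) :
  continuous f -> cancel f g -> curve_segment eta -> curve_segment (f \o eta).
Proof.
move=> cf fK [ce ie]; split.
  by apply: within_continuous_comp => //; move=> z _; exact: cf.
by move=> s t s01 t01 /(can_inj fK); exact: ie.
Qed.

(** The affine map [c + a z] of the complex plane. It preserves orientation, so it conjugates a
    rotation to a rotation by the same angle, and it can send two given distinct points to any other
    two. *)
Definition similarity (c a : R * R) z : R * R :=
  (c.1 + (a.1 * z.1 - a.2 * z.2), c.2 + (a.2 * z.1 + a.1 * z.2)).

Lemma continuous_similarity c a : continuous (similarity c a).
Proof.
move=> z; have c1 := @continuous_fst R z; have c2 := @continuous_snd R z.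
change {for z, continuous (fun z : R * R =>
  (c.1 + (a.1 * z.1 - a.2 * z.2), c.2 + (a.2 * z.1 + a.1 * z.2)))}.
have k (b : R) : {for z, continuous (fun _ : R * R => b)} by exact: cvg_cst.
apply: continuous_at_pair.
  exact: (continuousD (k c.1) (continuousB (continuousM (k a.1) c1) (continuousM (k a.2) c2))).
exact: (continuousD (k c.2) (continuousD (continuousM (k a.2) c1) (continuousM (k a.1) c2))).
Qed.

Lemma similarity_inv c a : a <> (0, 0) -> exists c' a',
  [/\ cancel (similarity c a) (similarity c' a'),
      cancel (similarity c' a') (similarity c a) & a' <> (0, 0)].
Proof.
case: c a => c1 c2 [a1 a2] an0; pose k := a1 ^+ 2 + a2 ^+ 2.
have k0 : k != 0.
  apply/eqP => k0; apply: an0.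
  by congr pair; rewrite /k in k0; nra.
(* [(b1, b2)] is the complex inverse of [a]: the conjugate over the squared modulus. *)
pose b1 := a1 / k; pose b2 := - a2 / k.
exists (- (b1 * c1 - b2 * c2), - (b2 * c1 + b1 * c2)), (b1, b2); split.
- move=> [x y]; rewrite /similarity /= /b1 /b2; congr pair.
    by transitivity ((a1 ^+ 2 + a2 ^+ 2) / k * x); [ring|rewrite -/k divff// mul1r].
  by transitivity ((a1 ^+ 2 + a2 ^+ 2) / k * y); [ring|rewrite -/k divff// mul1r].
- move=> [x y]; rewrite /similarity /= /b1 /b2; congr pair.
    transitivity ((a1 ^+ 2 + a2 ^+ 2) / k * (x - c1) + c1); first ring.
    by rewrite -/k divff// mul1r subrK.
  transitivity ((a1 ^+ 2 + a2 ^+ 2) / k * (y - c2) + c2); first ring.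
  by rewrite -/k divff// mul1r subrK.
- move=> [b10 b20]; apply: an0.
  have -> : a1 = b1 * k by rewrite /b1 divfK.
  have -> : a2 = - (b2 * k) by rewrite /b2 divfK// opprK.
  by rewrite b10 b20 !mul0r oppr0.
Qed.

Lemma eucl_dist_similarity c a x y :
  eucl_dist (similarity c a x) (similarity c a y) =
  Num.sqrt (a.1 ^+ 2 + a.2 ^+ 2) * eucl_dist x y.
Proof. by rewrite /eucl_dist -sqrtrM ?addr_ge0 ?sqr_ge0//=; congr Num.sqrt; ring. Qed.

Lemma similarity_rotation c a p t z :
  similarity c a (rotation p t z) = rotation (similarity c a p) t (similarity c a z).
Proof. by rewrite /similarity /rotation /=; congr pair; ring. Qed.

Lemma rotationE p t z :
  rotation p t z = similarity (p.1 - (cos t * p.1 - sin t * p.2),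
    p.2 - (sin t * p.1 + cos t * p.2)) (cos t, sin t) z.
Proof. by rewrite /similarity /rotation /=; congr pair; ring. Qed.

Lemma continuous_rotation p t : continuous (rotation p t).
Proof.
have -> : rotation p t = similarity (p.1 - (cos t * p.1 - sin t * p.2),
    p.2 - (sin t * p.1 + cos t * p.2)) (cos t, sin t).
  by apply/funext => z; exact: rotationE.
exact: continuous_similarity.
Qed.

Lemma rotationD p s t z : rotation p s (rotation p t z) = rotation p (s + t) z.
Proof. by rewrite /rotation /= cosD sinD; congr pair; ring. Qed.

Lemma rotation0 p z : rotation p 0 z = z.
Proof. by rewrite /rotation cos0 sin0 [RHS]surjective_pairing; congr pair; ring. Qed.

Lemma rotationK p t : cancel (rotation p t) (rotation p (- t)).
Proof. by move=> z; rewrite rotationD addNr rotation0. Qed.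

Lemma rotationVK p t : cancel (rotation p (- t)) (rotation p t).
Proof. by move=> z; rewrite rotationD subrr rotation0. Qed.

Lemma rotation_isometry p t : Defs.isometry (rotation p t).
Proof.
by move=> x y; rewrite !rotationE eucl_dist_similarity /= cos2Dsin2 sqrtr1 mul1r.
Qed.

Lemma tile_boundary_congruent_rotation p t T c :
  tile_boundary T c -> tile_boundary (rotation p t @` T) (rotation p t @` c).
Proof.
apply: (@tile_boundary_image _ (rotation p (- t))).
- exact: continuous_rotation.
- exact: continuous_rotation.
- exact: rotationK.
- exact: rotationVK.
Qed.

Section SimilarityTransport.
Variables (c a : R * R).
Hypothesis a0 : a <> (0, 0).
Let S := similarity c a.

Lemma contour_similarity eta p t : contour (S \o eta) (S p) t = S @` contour eta p t.
Proof.
apply/seteqP; split=> z.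
  move=> [[[[s s01 <-]|[_ [s s01 <-] <-]]|[s s01 <-]]|[s s01 <-]].
  - by exists (eta s) => //; left; left; left; exists s.
  - exists (rotation p t (eta s)); last exact: similarity_rotation.
    by left; left; right; exists (eta s) => //; exists s.
  - by exists (rotation p s (eta 0)); [left; right; exists s|exact: similarity_rotation].
  - by exists (rotation p s (eta 1)); [right; exists s|exact: similarity_rotation].
move=> [_ [[[[s s01 <-]|[_ [s s01 <-] <-]]|[s s01 <-]]|[s s01 <-]] <-].
- by left; left; left; exists s.
- left; left; right; exists (S (eta s)); first by exists s.
  by rewrite /S similarity_rotation.
- by left; right; exists s => //; rewrite /S similarity_rotation.
- by right; exists s => //; rewrite /S similarity_rotation.
Qed.

Lemma tile_boundary_similarity T b : tile_boundary T b -> tile_boundary (S @` T) (S @` b).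
Proof.
have [c' [a' [SK KS _]]] := similarity_inv c a0.
by apply: (tile_boundary_image _ _ SK KS); exact: continuous_similarity.
Qed.

Lemma radially_generated_similarity T eta p t :
  radially_generated T eta p t -> radially_generated (S @` T) (S \o eta) (S p) t.
Proof.
have [c' [a' [SK KS _]]] := similarity_inv c a0.
move=> [ce ep t0 tb]; split => //.
- exact: (curve_segment_comp (@continuous_similarity _ _) SK).
- by rewrite -image_comp; exists p.
- by rewrite contour_similarity; exact: tile_boundary_similarity.
Qed.

Lemma congruent_similarity A B : congruent A B -> congruent (S @` A) (S @` B).
Proof.
have [c' [a' [SK KS _]]] := similarity_inv c a0.
(* Conjugation by the similarity scales distances down and up again by the same factor. *)
move=> [f fi fE]; exists (S \o f \o similarity c' a').
  move=> x y; rewrite /= /S eucl_dist_similarity fi -(eucl_dist_similarity c) !KS//.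
rewrite image_comp; apply/seteqP; split=> z.
  move=> [w Aw <-] /=; rewrite SK; exists (f w) => //; rewrite -fE; exact: imageP.
by rewrite -fE => -[_ [w Aw <-] <-]; exists w; rewrite //= SK.
Qed.

Lemma closed_disk_similarity x r : 0 <= r ->
  S @` closed_disk x r = closed_disk (S x) (Num.sqrt (a.1 ^+ 2 + a.2 ^+ 2) * r).
Proof.
have [c' [a' [SK KS _]]] := similarity_inv c a0.
have k0 : 0 < Num.sqrt (a.1 ^+ 2 + a.2 ^+ 2).
  rewrite sqrtr_gt0 lt_neqAle addr_ge0 ?sqr_ge0// andbT eq_sym; apply/eqP => e; apply: a0.
  by case: a e => a1 a2 /= e; congr pair; nra.
move=> r0; apply/seteqP; split=> z.
  by move=> [w /= wr <-]; rewrite /closed_disk /= /S eucl_dist_similarity ler_pM2l.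
move=> /= zr; exists (similarity c' a' z); last exact: KS.
by move: zr; rewrite /closed_disk /= -{1}(KS z) /S eucl_dist_similarity ler_pM2l.
Qed.

Lemma tiles_the_disk_similarity T : tiles_the_disk T -> tiles_the_disk (S @` T).
Proof.
have [c' [a' [SK KS _]]] := similarity_inv c a0.
have k0 : 0 < Num.sqrt (a.1 ^+ 2 + a.2 ^+ 2).
  rewrite sqrtr_gt0 lt_neqAle addr_ge0 ?sqr_ge0// andbT eq_sym; apply/eqP => e; apply: a0.
  by case: a e => a1 a2 /= e; congr pair; nra.
move=> [x [r [tau [r0 [ttile tcong tmeet tcov] congT]]]].
exists (S x), (Num.sqrt (a.1 ^+ 2 + a.2 ^+ 2) * r), [set S @` T' | T' in tau]; split.
- exact: mulr_gt0.
- split.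
  + by move=> _ [T' tT' <-]; have [b tb] := ttile _ tT'; exists (S @` b); exact: tile_boundary_similarity.
  + by move=> _ _ [T1 t1 <-] [T2 t2 <-]; apply: congruent_similarity; exact: tcong.
  + move=> _ _ [T1 t1 <-] [T2 t2 <-] ne.
    apply: (meet_along_boundaries_image _ _ SK KS); try exact: continuous_similarity.
    by apply: tmeet => // e; apply: ne; rewrite e.
  + rewrite -(closed_disk_similarity _ (ltW r0)) -tcov; apply/seteqP; split=> z.
      by move=> [_ [T' tT' <-] [w Tw <-]]; exists w => //; exists T'.
    by move=> [w [T' tT' Tw] <-]; exists (S @` T'); [exists T'|exists w].
- by move=> _ [T' tT' <-]; apply: congruent_similarity; exact: congT.
Qed.

End SimilarityTransport.

Lemma generated_by_similarity c a T p : a <> (0, 0) ->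
  generated_by T p -> generated_by (similarity c a @` T) (similarity c a p).
Proof.
move=> a0 [eta [t rg]]; exists (similarity c a \o eta), t.
exact: radially_generated_similarity.
Qed.

Lemma wedge_similarity c a T : a <> (0, 0) -> wedge T -> wedge (similarity c a @` T).
Proof.
move=> a0 [[b tb] [p [q [pq gE]]]].
have [c' [a' [SK KS a'0]]] := similarity_inv c a0.
split; first by exists (similarity c a @` b); exact: tile_boundary_similarity.
exists (similarity c a p), (similarity c a q); split; first by move=> /(can_inj SK).
apply/seteqP; split=> z.
  move=> /(generated_by_similarity c' a'0).
  rewrite image_comp (_ : _ @` T = T); last first.
    by apply/seteqP; split=> [_ [w Tw <-]|w Tw]; [rewrite /= SK|exists w; rewrite /= ?SK].
  have -> : generated_by T (similarity c' a' z) = [set p; q] (similarity c' a' z) by rewrite gE.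
  by move=> [<-|<-]; [left|right]; rewrite KS.
have gp : generated_by T p by rewrite gE; left.
have gq : generated_by T q by rewrite gE; right.
by move=> [->|->]; exact: generated_by_similarity.
Qed.

Lemma wedge_form_similarity c a n p q T : a <> (0, 0) ->
  wedge_form n p q T ->
  wedge_form n (similarity c a p) (similarity c a q) (similarity c a @` T).
Proof.
move=> a0 [eta [nu [rp rq]]]; exists (similarity c a \o eta), (similarity c a \o nu).
by split; exact: radially_generated_similarity.
Qed.

End Transport.

(** * Circular arcs meet lines and other circles finitely often *)

Section CircularArcs.
Variable R : realType.

Lemma finite_set_at_most2 (T : choiceType) (A : set T) :
  (forall x y z, A x -> A y -> A z -> [\/ x = y, y = z | x = z]) -> finite_set A.
Proof.
move=> h; have [->|/set0P[a Aa]] := eqVneq A set0; first exact: finite_set0.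
have [Aone|/existsNP[b /not_implyP[Ab ba]]] := pselect (forall b, A b -> b = a).
  by apply: (sub_finite_set _ (finite_set1 a)) => b /Aone.
apply: (sub_finite_set _ (finite_set2 a b)) => x Ax.
by have [->|e|->] := h x a b Ax Aa Ab; [left| |right] => //; case: ba.
Qed.

(** Two solutions [u] and [v] make [(P, Q)] parallel to the direction of angle [(u + v) / 2]. Three
    solutions would give two such directions, differing by [(y - z) / 2], which is not a multiple of
    [pi]. *)
Lemma finite_trigonometric_level (P Q C : R) : (P, Q) <> (0, 0) ->
  finite_set [set t : R | 0 <= t < 2 * pi /\ P * cos t + Q * sin t = C].
Proof.
move=> PQ; apply: finite_set_at_most2 => x y z [xi xC] [yi yC] [zi zC].
have [|/eqP xy] := eqVneq x y; first by move=> ?; apply: Or31.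
have [|/eqP yz] := eqVneq y z; first by move=> ?; apply: Or32.
have [|/eqP xz] := eqVneq x z; first by move=> ?; apply: Or33.
exfalso; have pi0 := pi_gt0 R.
have sn (u v : R) : 0 <= u < 2 * pi -> 0 <= v < 2 * pi -> u <> v -> sin ((u - v) / 2) != 0.
  move=> ui vi uv; have [lt_uv|lt_vu|//] := ltgtP u v.
    by rewrite (_ : (u - v) / 2 = - ((v - u) / 2)) ?sinN ?oppr_eq0 ?gt_eqF ?sin_gt0_pi//; lra.
  by rewrite gt_eqF ?sin_gt0_pi//; lra.
have chord (u v : R) : 0 <= u < 2 * pi -> 0 <= v < 2 * pi -> u <> v ->
    P * cos u + Q * sin u = C -> P * cos v + Q * sin v = C ->
    P * sin ((u + v) / 2) = Q * cos ((u + v) / 2).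
  move=> ui vi uv uC vC; have n0 := sn _ _ ui vi uv.
  apply/eqP; rewrite -(inj_eq (mulIf n0)); apply/eqP.
  have cu : cos u = cos ((u + v) / 2 + (u - v) / 2) by congr cos; field.
  have su : sin u = sin ((u + v) / 2 + (u - v) / 2) by congr sin; field.
  have cv : cos v = cos ((u + v) / 2 - (u - v) / 2) by congr cos; field.
  have sv : sin v = sin ((u + v) / 2 - (u - v) / 2) by congr sin; field.
  by move: uC vC; rewrite cu su cv sv cosD sinD cosB sinB; lra.
have e1 := chord _ _ xi yi xy xC yC; have e2 := chord _ _ xi zi xz xC zC.
have : sin (((y - z) / 2)) = 0.
  have -> : (y - z) / 2 = (x + y) / 2 - (x + z) / 2 by field.
  rewrite sinB.
  move: (cos ((x + y) / 2)) (sin ((x + y) / 2)) (cos ((x + z) / 2)) (sin ((x + z) / 2)) e1 e2.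
  move=> a b c d e1 e2.
  have p0 : P * (b * c - a * d) = 0.
    by transitivity ((P * b) * c - a * (P * d)); [ring|rewrite e1 e2; ring].
  have q0 : Q * (b * c - a * d) = 0.
    by transitivity (b * (Q * c) - (Q * a) * d); [ring|rewrite -e1 -e2; ring].
  move/eqP: p0; rewrite mulf_eq0 => /orP[/eqP P0|/eqP //].
  move/eqP: q0; rewrite mulf_eq0 => /orP[/eqP Q0|/eqP //].
  by case: PQ; rewrite P0 Q0.
by move/eqP: (sn _ _ yi zi yz).
Qed.

(** Along the circle the linear form is a constant plus [P * cos t + Q * sin t]. Here
    [P ^+ 2 + Q ^+ 2] is the product of the squared lengths of [(A, B)] and of [e - p], hence
    nonzero. *)
Lemma finite_arc_line (p e : R * R) (A B C : R) : (A, B) <> (0, 0) -> e <> p ->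
  finite_set [set t : R | 0 <= t < 2 * pi /\
    A * (rotation p t e).1 + B * (rotation p t e).2 = C].
Proof.
case: p e => p1 p2 [e1 e2] AB ep; pose u := e1 - p1; pose v := e2 - p2.
have PQ : (A * u + B * v, B * u - A * v) <> (0, 0).
  move=> [P0 Q0]; apply: ep.
  have AB0 : A ^+ 2 + B ^+ 2 != 0.
    apply/eqP => h; apply: AB; congr pair; nra.
  have : (A ^+ 2 + B ^+ 2) * (u ^+ 2 + v ^+ 2) = 0.
    by transitivity ((A * u + B * v) ^+ 2 + (B * u - A * v) ^+ 2); [ring|rewrite P0 Q0; ring].
  move/eqP; rewrite mulf_eq0 (negbTE AB0) /= => /eqP uv.
  have sum0 (x y : R) : x ^+ 2 + y ^+ 2 = 0 -> x = 0 /\ y = 0 by move=> ?; split; nra.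
  by have [u0 v0] := sum0 _ _ uv; congr pair; rewrite /u /v in u0 v0; lra.
apply: (sub_finite_set _ (@finite_trigonometric_level _ _ (C - A * p1 - B * p2) PQ)).
by move=> t [ti tC]; split => //; rewrite -tC /rotation /u /v /=; ring.
Qed.

(** The moving point keeps its distance from [p]. Subtracting the equation of that circle from the
    other one leaves a line with normal vector [2 (p - k)], the radical axis of the two circles. *)
Lemma finite_arc_circle (p e k : R * R) (C : R) : k <> p -> e <> p ->
  finite_set [set t : R | 0 <= t < 2 * pi /\
    ((rotation p t e).1 - k.1) ^+ 2 + ((rotation p t e).2 - k.2) ^+ 2 = C].
Proof.
move=> kp ep; have kp' : (2 * (p.1 - k.1), 2 * (p.2 - k.2)) <> (0, 0).
  move=> [h1 h2]; apply: kp; case: p k h1 h2 {ep} => p1 p2 [k1 k2] /= h1 h2.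
  by congr pair; lra.
apply: (sub_finite_set _ (@finite_arc_line p e _ _
  (C - ((e.1 - p.1) ^+ 2 + (e.2 - p.2) ^+ 2) - (p.1 - k.1) ^+ 2 - (p.2 - k.2) ^+ 2
   + 2 * (p.1 - k.1) * p.1 + 2 * (p.2 - k.2) * p.2) kp' ep)).
move=> t [ti tC]; split => //; rewrite -tC /rotation /=.
have c1 := cos2Dsin2 t; move: (cos t) (sin t) c1 => c s c1.
set u := e.1 - p.1; set v := e.2 - p.2.
have -> : u ^+ 2 + v ^+ 2 = (c ^+ 2 + s ^+ 2) * (u ^+ 2 + v ^+ 2) by rewrite c1 mul1r.
ring.
Qed.

(** A countable set has Lebesgue measure zero, whereas this interval has measure [b - a]. *)
Lemma uncountable_segment (a b : R) : a < b -> ~ countable [set x : R | a <= x < b].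
Proof.
move=> ab /countable_lebesgue_measure0.
have -> : [set x : R | a <= x < b] = `[a, b[%classic.
  by apply/seteqP; split=> x /=; rewrite in_itv.
rewrite lebesgue_measure_itv /= lte_fin ab -EFinD => -[] /eqP.
by rewrite subr_eq0 gt_eqF.
Qed.

Lemma infinite_segment (a b : R) : a < b -> ~ finite_set [set x : R | a <= x < b].
Proof. by move=> ab /finite_set_countable; exact: uncountable_segment. Qed.

End CircularArcs.

(** * Trigonometric estimates *)

Section Trigonometry.
Variable R : realType.
Implicit Types x y a b d t : R.

Lemma cos_mono x y : 0 <= x -> x <= y -> y <= pi -> cos y <= cos x.
Proof.
move=> x0 xy ypi; rewrite le_eqVlt in xy; case/orP: xy => [/eqP->//|xy].
by rewrite ltW// ltr_cos// in_itv /=; lra.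
Qed.

Lemma cos_mono_norm x y : `|x| <= y -> y <= pi -> cos y <= cos x.
Proof. by move=> xy ypi; rewrite -(cos_norm x); exact: cos_mono. Qed.

Lemma cosBpi x : cos (pi - x) = - cos x.
Proof. by rewrite cosB cospi sinpi; ring. Qed.

Lemma sinBpi x : sin (pi - x) = sin x.
Proof. by rewrite sinB cospi sinpi; ring. Qed.

Lemma sin_mono_sym t x : 0 <= t -> t <= x -> x <= pi - t -> sin t <= sin x.
Proof.
move=> t0 tx xt; have aux y : t <= y -> y <= pi / 2 -> sin t <= sin y.
  move=> ty ypi; rewrite le_eqVlt in ty; case/orP: ty => [/eqP->//|ty].
  by rewrite ltW// ltr_sin// in_itv /=; lra.
have [xpi|xpi] := leP x (pi / 2); first exact: aux.
by rewrite -(sinBpi x); apply: aux; lra.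
Qed.

Lemma cos_cos x y : 2 * (cos x * cos y) = cos (x + y) + cos (x - y).
Proof. by rewrite (cosD x y) (cosB x y); ring. Qed.

Lemma sin_sin x y : 2 * (sin x * sin y) = cos (x - y) - cos (x + y).
Proof. by rewrite (cosD x y) (cosB x y); ring. Qed.

Lemma cos_sin x y : 2 * (cos x * sin y) = sin (x + y) - sin (x - y).
Proof. by rewrite (sinD x y) (sinB x y); ring. Qed.

Lemma cosx2 x : cos (2 * x) = 1 - 2 * sin x ^+ 2.
Proof. by rewrite mulr_natl cos_mulr2n cos2sin2; ring. Qed.

Lemma cos_three_halves x : 0 <= x -> x <= pi -> cos (3 / 2 * x) <= cos x ^+ 2.
Proof.
move=> x0 xpi; pose k := cos (x / 2); pose l := sin (x / 2).
have kl : l ^+ 2 = 1 - k ^+ 2 by rewrite /l sin2cos2.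
have k0 : 0 <= k by apply: cos_ge0_pihalf; lra.
have k1 : k <= 1 by exact: cos_le1.
have cx : cos x = 2 * k ^+ 2 - 1.
  by rewrite (_ : x = x / 2 + x / 2) ?cosD -/k -/l; [nra|field].
have sx : sin x = 2 * k * l by rewrite (_ : x = x / 2 + x / 2) ?sinD -/k -/l; [ring|field].
have -> : cos (3 / 2 * x) = 4 * k ^+ 3 - 3 * k.
  rewrite (_ : 3 / 2 * x = x + x / 2) ?cosD -/k -/l ?cx ?sx; last by field.
  have -> : 2 * k * l * l = 2 * k * l ^+ 2 by ring.
  by rewrite kl; ring.
rewrite cx -subr_ge0.
have -> : (2 * k ^+ 2 - 1) ^+ 2 - (4 * k ^+ 3 - 3 * k) = (1 - k) * (1 + 4 * k * (1 - k ^+ 2)) by ring.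
apply: mulr_ge0; first by lra.
have : 0 <= k * (1 - k ^+ 2) by apply: mulr_ge0; nra.
lra.
Qed.

Variable tau : R.
Hypotheses (tau0 : 0 < tau) (tau6 : 6 * tau <= pi).
Let c := cos tau.
Let s := sin tau.

Ltac tau_hyps := have pi0 := pi_gt0 R; have t0 := tau0; have t6 := tau6.

Lemma cos_tau_gt0 : 0 < c.
Proof. by tau_hyps; apply: cos_gt0_pihalf; lra. Qed.

Lemma sin_tau_gt0 : 0 < s.
Proof. by tau_hyps; apply: sin_gt0_pi; lra. Qed.

Let cs : c ^+ 2 = 1 - s ^+ 2. Proof. exact: cos2sin2. Qed.

Lemma sin_tau_le : s <= 1 / 2.
Proof.
tau_hyps; have c0 := cos_tau_gt0; have s0 := sin_tau_gt0.
have : 0 <= cos (3 * tau) by apply: cos_ge0_pihalf; lra.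
rewrite (_ : 3 * tau = tau + (tau + tau)); last by ring.
rewrite !cosD sinD -/c -/s.
have -> : c * (c * c - s * s) - s * (s * c + c * s) = c * (c ^+ 2 - 3 * s ^+ 2) by ring.
by rewrite pmulr_rge0// cs; nra.
Qed.

Lemma cos_2tau_gt0 : 0 < cos (2 * tau).
Proof. by tau_hyps; apply: cos_gt0_pihalf; lra. Qed.

Lemma sin_2tau_gt0 : 0 < sin (2 * tau).
Proof. by tau_hyps; apply: sin_gt0_pi; lra. Qed.

(** The right side is [2 * cos x ^+ 2], and [2 * x - tau >= 3 / 2 * x] is the same as
    [2 * tau <= x]. The bound serves the inner sectors that do not point at the notch under
    consideration. *)
Lemma two_cos_le x : 2 * tau <= x -> 2 * x - tau <= pi -> 2 * cos (2 * x - tau) <= 1 + cos (2 * x).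
Proof.
tau_hyps => tx xpi; have : cos (2 * x - tau) <= cos (3 / 2 * x) by apply: cos_mono; lra.
have : cos (3 / 2 * x) <= cos x ^+ 2 by apply: cos_three_halves; lra.
rewrite cosx2 cos2sin2; lra.
Qed.

(* [(v1, v2)] is [cos tau] times the vector from the apex of an inner sector, of
   axis [2 a - tau], to the apex of an outer sector, of axis [2 b + tau]. *)
Section Apexes.
Variables a b : R.
Hypotheses (a_ge : 2 * tau <= a) (a_le : 2 * a <= pi - 2 * tau).
Hypotheses (b_ge : 0 <= b) (b_le : 2 * b <= pi - 2 * tau).
(** Both angles are going to be multiples of [2 * tau]. The list isolates [b - a = 0] and
    [b - a = - 2 * tau]: each is the exceptional position for one side of the inner sector, where
    the comparison of cosines used elsewhere fails. *)
Hypothesis ab : [\/ b + 4 * tau <= a, b + 2 * tau = a, b = a | a + 2 * tau <= b].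

Ltac apex_hyps := tau_hyps; have a1 := a_ge; have a2 := a_le; have b1 := b_ge; have b2 := b_le.

Let v1 := cos (2 * a - tau) - cos (2 * b + tau).
Let v2 := 2 * s + sin (2 * a - tau) - sin (2 * b + tau).
Let d := b - a.

Let s_b : s <= sin (2 * b + tau). Proof. by apex_hyps; apply: sin_mono_sym; lra. Qed.
Let s_a : s <= sin (2 * a + tau). Proof. by apex_hyps; apply: sin_mono_sym; lra. Qed.
Let s_a3 : s <= sin (2 * a - 3 * tau). Proof. by apex_hyps; apply: sin_mono_sym; lra. Qed.

Lemma apex_norm : v1 ^+ 2 + v2 ^+ 2 =
  2 - 2 * cos (2 * d + 2 * tau) + 4 * s ^+ 2 +
  4 * s * (sin (2 * a - tau) - sin (2 * b + tau)).
Proof.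
rewrite (_ : 2 * d + 2 * tau = (2 * b + tau) - (2 * a - tau)); last by rewrite /d; ring.
rewrite cosB /v1 /v2.
have := cos2sin2 (2 * a - tau); have := cos2sin2 (2 * b + tau).
move: (cos _) (sin _) (cos _) (sin _) => x y z w; rewrite ![_ ^+ 2]expr2 => e1 e2.
nra.
Qed.

Lemma apex_right : cos (2 * a) * v1 + sin (2 * a) * v2 =
  c - cos (2 * d + tau) + 2 * s * sin (2 * a).
Proof.
rewrite -[c]cosN (_ : - tau = (2 * a - tau) - 2 * a); last by ring.
rewrite (_ : 2 * d + tau = (2 * b + tau) - 2 * a); last by rewrite /d; ring.
by rewrite !(cosB _ (2 * a)) /v1 /v2; ring.
Qed.

Lemma apex_left : cos (2 * a - 2 * tau) * v1 + sin (2 * a - 2 * tau) * v2 =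
  c - cos (2 * d + 3 * tau) + 2 * s * sin (2 * a - 2 * tau).
Proof.
have -> : c = cos ((2 * a - tau) - (2 * a - 2 * tau)) by congr cos; ring.
rewrite (_ : 2 * d + 3 * tau = (2 * b + tau) - (2 * a - 2 * tau)); last by rewrite /d; ring.
by rewrite !(cosB _ (2 * a - 2 * tau)) /v1 /v2; ring.
Qed.

(** Divided by [c ^+ 2], this bounds the distance of the two apexes by 2. Likewise [apex_right_ge]
    and [apex_left_ge] say that [2 e - v / c] has length at most 2 for the unit vectors [e] along
    the sides of the inner sector. Together they put the apex and both corners of the inner sector
    of radius 2 in the disk of radius 2 about the outer apex. *)
Lemma apex_dist : v1 ^+ 2 + v2 ^+ 2 <= 4 * c ^+ 2.
Proof.
apex_hyps; have s0 := sin_tau_gt0.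
rewrite apex_norm cs; have c2 := cosx2 tau.
have sb : 0 <= s * (sin (2 * b + tau) - s) by have := s_b; have := s_a; have := s_a3 => ? ? ?; apply: mulr_ge0; lra.
have := sin_sin tau (2 * a - tau); rewrite -/s.
rewrite -(cosN (tau - _)) (_ : - (tau - _) = 2 * a - 2 * tau); last by ring.
rewrite (_ : tau + (2 * a - tau) = 2 * a) => [sa|]; last by ring.
suff : 0 <= cos (2 * tau) + cos (2 * d + 2 * tau) - cos (2 * a - 2 * tau) + cos (2 * a).
  by rewrite c2 -/s; nra.
have [d0|d0] : 0 <= d \/ d <= - 2 * tau by case: ab => ?; rewrite /d; [right|right|left|left]; lra.
  have : cos (pi - 2 * a) <= cos (2 * d + 2 * tau) by apply: cos_mono; rewrite /d in d0 *; lra.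
  have : cos (2 * a - 2 * tau) <= cos (2 * tau) by apply: cos_mono; lra.
  by rewrite cosBpi; lra.
have : cos (2 * a - 2 * tau) <= cos (2 * d + 2 * tau).
  by apply: cos_mono_norm; rewrite ?ler_norml; rewrite /d in d0 *; lra.
have : cos (pi - 2 * tau) <= cos (2 * a) by apply: cos_mono; lra.
by rewrite cosBpi; lra.
Qed.

Lemma apex_right_gt0 : 0 < cos (2 * a) * v1 + sin (2 * a) * v2.
Proof.
apex_hyps; have s0 := sin_tau_gt0; rewrite apex_right.
have : 0 < s * sin (2 * a) by apply: mulr_gt0 => //; apply: sin_gt0_pi; lra.
suff : cos (2 * d + tau) <= c by lra.
have [d0|d0] : 0 <= d \/ d <= - 2 * tau by case: ab => ?; rewrite /d; [right|right|left|left]; lra.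
  by apply: cos_mono; rewrite /d in d0 *; lra.
rewrite -cosN; apply: cos_mono; rewrite /d in d0 *; lra.
Qed.

Lemma apex_left_gt0 : 0 < cos (2 * a - 2 * tau) * v1 + sin (2 * a - 2 * tau) * v2.
Proof.
apex_hyps; have s0 := sin_tau_gt0; rewrite apex_left.
have : 0 < s * sin (2 * a - 2 * tau) by apply: mulr_gt0 => //; apply: sin_gt0_pi; lra.
suff : cos (2 * d + 3 * tau) <= c by lra.
have [d0|d0] : 0 <= d \/ d <= - 2 * tau by case: ab => ?; rewrite /d; [right|right|left|left]; lra.
  by apply: cos_mono; rewrite /d in d0 *; lra.
rewrite -cosN; apply: cos_mono; rewrite /d in d0 *; lra.
Qed.

Lemma apex_right_ge : v1 ^+ 2 + v2 ^+ 2 <= 4 * c * (cos (2 * a) * v1 + sin (2 * a) * v2).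
Proof.
apex_hyps; have s0 := sin_tau_gt0; rewrite apex_norm apex_right.
have c2 := cosx2 tau; rewrite -/s in c2.
have e1 := cos_cos tau (2 * d + tau); rewrite -/c in e1.
rewrite (_ : tau + _ = 2 * d + 2 * tau) in e1; last by ring.
rewrite -(cosN (tau - _)) (_ : - (tau - _) = 2 * d) in e1; last by ring.
have e2 := cos_sin tau (2 * a); rewrite -/c in e2.
rewrite (_ : tau + _ = 2 * a + tau) in e2; last by ring.
rewrite (_ : tau - _ = - (2 * a - tau)) ?sinN in e2; last by ring.
have sa : 0 <= s * (sin (2 * a + tau) - s) by have := s_b; have := s_a; have := s_a3 => ? ? ?; apply: mulr_ge0; lra.
have sb : 0 <= s * (sin (2 * b + tau) - s) by have := s_b; have := s_a; have := s_a3 => ? ? ?; apply: mulr_ge0; lra.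
have e2' : 2 * s * (c * sin (2 * a)) = s * sin (2 * a + tau) + s * sin (2 * a - tau).
  by rewrite -mulrA mulrCA e2; ring.
(* Each sine is at least [s], so the first two terms leave at least [4 * s ^+ 2]. The last term is
   negative only for [d = 0], and then it equals [- 4 * s ^+ 2]. *)
suff : 0 <= 4 * s * (sin (2 * a + tau) + sin (2 * b + tau)) - 4 * s ^+ 2
      + 2 * (cos (2 * tau) - cos (2 * d)).
  move=> ?; have -> : 4 * c * (c - cos (2 * d + tau) + 2 * s * sin (2 * a)) =
    4 * c ^+ 2 - 2 * (2 * (c * cos (2 * d + tau))) + 4 * (2 * s * (c * sin (2 * a))) by ring.
  by rewrite e1 e2' cs; lra.
have [d0|d0] : d = 0 \/ cos (2 * d) <= cos (2 * tau); last by nra.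
  case: ab => abE; [right|right|left|right].
  - by rewrite -(cosN (2 * d)); apply: cos_mono; rewrite /d; lra.
  - by rewrite -(cosN (2 * d)); apply: cos_mono; rewrite /d; lra.
  - by rewrite /d abE subrr.
  - by apply: cos_mono; rewrite /d; lra.
by rewrite d0 mulr0 cos0 c2; nra.
Qed.

Lemma apex_left_ge : v1 ^+ 2 + v2 ^+ 2 <=
  4 * c * (cos (2 * a - 2 * tau) * v1 + sin (2 * a - 2 * tau) * v2).
Proof.
apex_hyps; have s0 := sin_tau_gt0; rewrite apex_norm apex_left.
have c2 := cosx2 tau; rewrite -/s in c2.
have e1 := cos_cos tau (2 * d + 3 * tau); rewrite -/c in e1.
rewrite (_ : tau + _ = 2 * d + 4 * tau) in e1; last by ring.
rewrite -(cosN (tau - _)) (_ : - (tau - _) = 2 * d + 2 * tau) in e1; last by ring.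
have e2 := cos_sin tau (2 * a - 2 * tau); rewrite -/c in e2.
rewrite (_ : tau + _ = 2 * a - tau) in e2; last by ring.
rewrite (_ : tau - _ = - (2 * a - 3 * tau)) ?sinN in e2; last by ring.
have sa : 0 <= s * (sin (2 * a - 3 * tau) - s) by have := s_b; have := s_a; have := s_a3 => ? ? ?; apply: mulr_ge0; lra.
have sb : 0 <= s * (sin (2 * b + tau) - s) by have := s_b; have := s_a; have := s_a3 => ? ? ?; apply: mulr_ge0; lra.
have e2' : 2 * s * (c * sin (2 * a - 2 * tau)) = s * sin (2 * a - 3 * tau) + s * sin (2 * a - tau).
  by rewrite -mulrA mulrCA e2; ring.
suff : 0 <= 4 * s * (sin (2 * a - 3 * tau) + sin (2 * b + tau)) - 4 * s ^+ 2
      + 2 * (cos (2 * tau) - cos (2 * d + 4 * tau)).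
  move=> ?; have -> : 4 * c * (c - cos (2 * d + 3 * tau) + 2 * s * sin (2 * a - 2 * tau)) =
    4 * c ^+ 2 - 2 * (2 * (c * cos (2 * d + 3 * tau))) + 4 * (2 * s * (c * sin (2 * a - 2 * tau))).
    by ring.
  by rewrite e1 e2' cs; lra.
have [d0|d0] : d = - 2 * tau \/ cos (2 * d + 4 * tau) <= cos (2 * tau); last by nra.
  case: ab => abE; [right|left|right|right].
  - by rewrite -(cosN (2 * d + 4 * tau)); apply: cos_mono; rewrite /d; lra.
  - by rewrite /d; lra.
  - by apply: cos_mono; rewrite /d; lra.
  - by apply: cos_mono; rewrite /d; lra.
by rewrite d0 (_ : 2 * (- 2 * tau) + _ = 0) ?cos0 ?c2; [nra|ring].
Qed.

End Apexes.

End Trigonometry.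

(** * Inner and outer sectors *)

Section Sectors.
Variables (R : realType) (m : nat) (r : R).

(** With [n = 2 * m + 1] this is [pi / (2 n)], half the opening of a sector. [rho] is the
    circumradius of the regular [n]-gon whose longest diagonals have length 2, and [height] is the
    distance from its centre to such a diagonal. *)
Definition tau : R := pi / (4 * m%:R + 2).
Definition rho : R := (cos tau)^-1.
Definition height : R := sin tau * rho.
Definition ang (k : nat) : R := 2 * tau * k%:R.

(* A circular sector of radius [r] and opening [2 tau] with apex
   [(0, o) - rho (cos t, sin t)] and axis in direction [t]; its sides are at
   distance [height] from [(0, o)]. *)
Definition side_left (o t : R) (z : R * R) : R :=
  cos (t + tau) * (z.2 - o) - sin (t + tau) * z.1.
Definition side_right (o t : R) (z : R * R) : R :=
  sin (t - tau) * z.1 - cos (t - tau) * (z.2 - o).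
Definition apex_dist2 (o t : R) (z : R * R) : R :=
  (z.1 + rho * cos t) ^+ 2 + (z.2 - o + rho * sin t) ^+ 2.

(** Consecutive axes differ by [4 * tau], the central angle of the polygon. Continuing [outer_axis]
    beyond [m] would give the sectors on the other side of the line of the poles; their reflections
    in that line are the [inner] ones, centred at [(0, - height)]. *)
Definition inner_axis (i : nat) : R := 2 * ang i - tau.
Definition outer_axis (j : nat) : R := 2 * ang j + tau.

Definition inner (i : nat) : set (R * R) := [set z |
  [/\ side_left (- height) (inner_axis i) z <= height,
      side_right (- height) (inner_axis i) z <= height &
      apex_dist2 (- height) (inner_axis i) z <= r ^+ 2]].
Definition inner_int (i : nat) : set (R * R) := [set z |
  [/\ side_left (- height) (inner_axis i) z < height,
      side_right (- height) (inner_axis i) z < height &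
      apex_dist2 (- height) (inner_axis i) z < r ^+ 2]].

(* The outer sectors [0] and [m] have a side on the first coordinate axis; it is
   dropped, since they are only used in the upper half-plane. *)
Definition outer (j : nat) : set (R * R) := [set z |
  [/\ (j < m)%N -> side_left height (outer_axis j) z <= height,
      (0 < j)%N -> side_right height (outer_axis j) z <= height &
      apex_dist2 height (outer_axis j) z <= r ^+ 2]].
Definition outer_int (j : nat) : set (R * R) := [set z |
  [/\ (j < m)%N -> side_left height (outer_axis j) z < height,
      (0 < j)%N -> side_right height (outer_axis j) z < height &
      apex_dist2 height (outer_axis j) z < r ^+ 2]].

Definition inners := [set z | exists2 i, (0 < i <= m)%N & inner i z].
Definition inners_int := [set z | exists2 i, (0 < i <= m)%N & inner_int i z].
Definition outers := [set z | exists2 j, (j <= m)%N & outer j z].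
Definition outers_int := [set z | exists2 j, (j <= m)%N & outer_int j z].

Hypothesis m0 : (0 < m)%N.

Let m1 : 1 <= m%:R :> R. Proof. by rewrite -[1]/(1%:R) ler_nat. Qed.

Lemma tau_pi : (4 * m%:R + 2) * tau = pi.
Proof. by rewrite /tau mulrC divfK// gt_eqF//; have := m1; lra. Qed.

Lemma tau_gt0 : 0 < tau.
Proof. by rewrite /tau divr_gt0 ?pi_gt0//; have := m1; lra. Qed.

Lemma tau_le6 : 6 * tau <= pi.
Proof. by have := tau_gt0; have := m1; rewrite -tau_pi; nra. Qed.

Let t0 := tau_gt0.
Let t6 := tau_le6.
Let c := cos tau.
Let s := sin tau.
Let c0 : 0 < c. Proof. exact: cos_tau_gt0 t0 t6. Qed.
Let s0 : 0 < s. Proof. exact: sin_tau_gt0 t0 t6. Qed.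

Lemma rho_gt0 : 0 < rho. Proof. by rewrite /rho invr_gt0. Qed.

Lemma rho_cos : rho * c = 1. Proof. by rewrite /rho mulVf// gt_eqF. Qed.

Lemma height_gt0 : 0 < height. Proof. by rewrite /height mulr_gt0// rho_gt0. Qed.

Lemma height_cos : height * c = s.
Proof. by rewrite /height -mulrA rho_cos mulr1. Qed.

Lemma ang0 : ang 0 = 0. Proof. by rewrite /ang mulr0. Qed.

Lemma angS k : ang k.+1 = ang k + 2 * tau.
Proof. by rewrite /ang -natr1; ring. Qed.

Lemma angm : 2 * ang m = pi - 2 * tau.
Proof. by rewrite /ang -tau_pi; ring. Qed.

Lemma ang_le k l : (k <= l)%N -> ang k <= ang l.
Proof. by move=> kl; rewrite /ang ler_wpM2l ?ler_nat// mulr_ge0// ltW. Qed.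

Lemma ang_lt k l : (k < l)%N -> ang k + 2 * tau <= ang l.
Proof. by rewrite -angS; exact: ang_le. Qed.

Lemma ang_ge0 k : 0 <= ang k.
Proof. by rewrite -ang0; exact: ang_le. Qed.

Lemma ang_le_max k : (k <= m)%N -> 2 * ang k <= pi - 2 * tau.
Proof. by move=> /ang_le; rewrite -angm; lra. Qed.

Lemma ang_gt0 k : (0 < k)%N -> 2 * tau <= ang k.
Proof. by move=> /ang_lt; rewrite ang0 add0r. Qed.

Lemma ang_cases i j :
  [\/ ang j + 4 * tau <= ang i, ang j + 2 * tau = ang i, ang j = ang i |
      ang i + 2 * tau <= ang j].
Proof.
have [ij|ji|->] := ltngtP i j; [exact: Or44 (ang_lt ij)| |exact: Or43].
move: ji; rewrite leq_eqVlt => /orP[/eqP <-|ji]; first by apply: Or42; rewrite angS.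
by apply: Or41; have := ang_lt ji; rewrite angS; lra.
Qed.

(** Oblique coordinates from the apex along the two sides of the sector; each one is the distance to
    the other side, divided by [sin (2 * tau)]. *)
Lemma sector_polar o t z : side_left o t z <= height -> side_right o t z <= height ->
  exists x y, [/\ 0 <= x, 0 <= y,
    apex_dist2 o t z = x ^+ 2 + y ^+ 2 + 2 * x * y * cos (2 * tau),
    z.1 = - rho * cos t + x * cos (t - tau) + y * cos (t + tau) &
    z.2 = o - rho * sin t + x * sin (t - tau) + y * sin (t + tau)].
Proof.
have s20 : 0 < sin (2 * tau) := sin_2tau_gt0 t0 t6.
have s2 : sin (2 * tau) = 2 * s * c by rewrite mulr_natl sin_mulr2n -/c -/s; ring.
have c2 : cos (2 * tau) = c ^+ 2 - s ^+ 2 by rewrite (_ : 2 * tau = tau + tau) ?cosD -/c -/s; ring.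
rewrite /side_left /side_right /apex_dist2 => hl hr.
pose u := z.1 + rho * cos t; pose v := z.2 - o + rho * sin t.
have hs : height = s * rho by [].
have cs1 : c ^+ 2 + s ^+ 2 = 1 := cos2Dsin2 tau.
have tt1 : cos t ^+ 2 + sin t ^+ 2 = 1 := cos2Dsin2 t.
pose X := sin (t + tau) * u - cos (t + tau) * v.
pose Y := cos (t - tau) * v - sin (t - tau) * u.
have X0 : 0 <= X.
  have -> : X = height * (cos t ^+ 2 + sin t ^+ 2) - (cos (t + tau) * (z.2 - o) - sin (t + tau) * z.1).
    by rewrite /X /u /v hs sinD cosD -/c -/s; ring.
  by rewrite tt1 mulr1 subr_ge0.
have Y0 : 0 <= Y.
  have -> : Y = height * (cos t ^+ 2 + sin t ^+ 2) - (sin (t - tau) * z.1 - cos (t - tau) * (z.2 - o)).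
    by rewrite /Y /u /v hs sinB cosB -/c -/s; ring.
  by rewrite tt1 mulr1 subr_ge0.
have uE : u * sin (2 * tau) = X * cos (t - tau) + Y * cos (t + tau).
  rewrite -[u in LHS]mulr1 -{1}tt1 s2 /X /Y sinD cosD sinB cosB -/c -/s; ring.
have vE : v * sin (2 * tau) = X * sin (t - tau) + Y * sin (t + tau).
  rewrite -[v in LHS]mulr1 -{1}tt1 s2 /X /Y sinD cosD sinB cosB -/c -/s; ring.
have n0 : sin (2 * tau) != 0 by rewrite gt_eqF.
have {}uE : u = X / sin (2 * tau) * cos (t - tau) + Y / sin (2 * tau) * cos (t + tau).
  by apply: (mulIf n0); rewrite uE; field.
have {}vE : v = X / sin (2 * tau) * sin (t - tau) + Y / sin (2 * tau) * sin (t + tau).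
  by apply: (mulIf n0); rewrite vE; field.
exists (X / sin (2 * tau)), (Y / sin (2 * tau)); split.
- by rewrite divr_ge0// ltW.
- by rewrite divr_ge0// ltW.
- rewrite -/u -/v uE vE; move: (X / _) (Y / _) => x y.
  rewrite (_ : 2 * tau = (t + tau) - (t - tau)); last by ring.
  rewrite (cosB (t + tau) (t - tau)); have e1 := cos2Dsin2 (t + tau); have e2 := cos2Dsin2 (t - tau).
  set p := cos (t + tau) in e1 *; set q := sin (t + tau) in e1 *.
  set a := cos (t - tau) in e2 *; set b := sin (t - tau) in e2 *.
  transitivity (x ^+ 2 * (a ^+ 2 + b ^+ 2) + y ^+ 2 * (p ^+ 2 + q ^+ 2) + 2 * x * y * (p * a + q * b)).
    ring.
  by rewrite e1 e2 !mulr1.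
- by rewrite -addrA -uE /u; ring.
- by rewrite -addrA -vE /v; ring.
Qed.

Hypotheses (r2 : 2 < r) (rc : r * c < 2).

(** With [V] the squared distance of the apexes and [P], [Q] the inner products of the vector
    joining them with the sides, the corner estimates read [V <= 4], [V <= 4 P] and [V <= 4 Q]. The
    squared distance [N - 2 (x P + y Q) + V] is then at most [N + V (1 - (x + y) / 2)]. For
    [x + y >= 2] this is at most [N <= r ^+ 2]; for [x + y < 2] it is at most 4, since
    [N <= (x + y) ^+ 2]. *)
Lemma inner_disc i j z : (0 < i <= m)%N -> (j <= m)%N -> inner i z ->
  apex_dist2 height (outer_axis j) z < r ^+ 2.
Proof.
move=> /andP[i0 im] jm [hl hr hd].
have [x [y [x0 y0 dE z1 z2]]] := sector_polar hl hr; rewrite dE in hd.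
have a1 := ang_gt0 i0; have a2 := ang_le_max im.
have b1 := ang_ge0 j; have b2 := ang_le_max jm; have cases := ang_cases i j.
have := apex_dist t0 t6 a1 a2 b1 b2 cases.
have := apex_right_gt0 t0 t6 a1 a2 b1 b2 cases.
have := apex_left_gt0 t0 t6 a1 a2 b1 b2 cases.
have := apex_right_ge t0 t6 a1 a2 b1 b2 cases.
have := apex_left_ge t0 t6 a1 a2 b1 b2 cases.
rewrite -/c -/s; set v1 := cos _ - cos _; set v2 := 2 * s + sin _ - sin _.
set p := cos (2 * ang i - 2 * tau) * v1 + _; set q := cos (2 * ang i) * v1 + _.
move=> pV qV p0 q0 V4.
have rr : rho * c = 1 := rho_cos; have r0 := rho_gt0.
have E : apex_dist2 height (outer_axis j) z =
    x ^+ 2 + y ^+ 2 + 2 * x * y * cos (2 * tau) -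
    2 * (x * (rho * p) + y * (rho * q)) + rho ^+ 2 * (v1 ^+ 2 + v2 ^+ 2).
  rewrite -dE /apex_dist2 z1 z2.
  rewrite (_ : inner_axis i - tau = 2 * ang i - 2 * tau); last by rewrite /inner_axis; ring.
  rewrite (_ : inner_axis i + tau = 2 * ang i); last by rewrite /inner_axis; ring.
  rewrite /p /q /v1 /v2 -/(inner_axis i) -/(outer_axis j).
  have -> : height = s * rho by [].
  ring.
rewrite E; set N := x ^+ 2 + _ + _ in hd *.
have cos2 : cos (2 * tau) <= 1 := cos_le1 _.
have xy0 : 0 <= x * y by exact: mulr_ge0.
have Nxy : N <= (x + y) ^+ 2 by rewrite /N; nra.
set V := rho ^+ 2 * _.
have V0 : 0 <= V by rewrite /V mulr_ge0 ?sqr_ge0// addr_ge0// sqr_ge0.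
have {}V4 : V <= 4.
  have : rho ^+ 2 * (v1 ^+ 2 + v2 ^+ 2) <= rho ^+ 2 * (4 * c ^+ 2) by rewrite ler_wpM2l// sqr_ge0.
  rewrite -/V (_ : rho ^+ 2 * (4 * c ^+ 2) = 4 * (rho * c) ^+ 2); last by ring.
  by rewrite rr; lra.
have {}pV : V <= 4 * (rho * p).
  have : rho ^+ 2 * (v1 ^+ 2 + v2 ^+ 2) <= rho ^+ 2 * (4 * c * p) by rewrite ler_wpM2l// sqr_ge0.
  rewrite -/V (_ : rho ^+ 2 * (4 * c * p) = 4 * (rho * c) * (rho * p)); last by ring.
  by rewrite rr; lra.
have {}qV : V <= 4 * (rho * q).
  have : rho ^+ 2 * (v1 ^+ 2 + v2 ^+ 2) <= rho ^+ 2 * (4 * c * q) by rewrite ler_wpM2l// sqr_ge0.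
  rewrite -/V (_ : rho ^+ 2 * (4 * c * q) = 4 * (rho * c) * (rho * q)); last by ring.
  by rewrite rr; lra.
have P0 : 0 < rho * p by exact: mulr_gt0.
have Q0 : 0 < rho * q by exact: mulr_gt0.
move: (rho * p) (rho * q) pV qV P0 Q0 {E p0 q0} => P Q pV qV P0 Q0.
have xP : 0 <= x * (4 * P - V) by apply: mulr_ge0; lra.
have yQ : 0 <= y * (4 * Q - V) by apply: mulr_ge0; lra.
have r4 : 4 < r ^+ 2 by have := r2; nra.
have [S2|S2] := ltP (x + y) 2.
  have : 0 <= (4 - V) * (2 - (x + y)) by apply: mulr_ge0; lra.
  by nra.
(* For [x + y >= 2] strictness comes from [V > 0] when [x + y > 2], from [N <= 4 < r ^+ 2] when
   [x + y = 2], and from the positive inner products [P] and [Q] in the remaining case. *)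
have [Vp|Vn] := ltP 0 V.
  have [S2'|S2'] := ltP 2 (x + y); last by nra.
  by nra.
have yQ0 : 0 <= y * Q by rewrite mulr_ge0// ltW.
have xP0 : 0 <= x * P by rewrite mulr_ge0// ltW.
suff : 0 < x * P + y * Q by lra.
have [xp|xn] := ltP 0 x; first by have := mulr_gt0 xp P0; lra.
have yp : 0 < y by lra.
by have := mulr_gt0 yp Q0; lra.
Qed.

(** The notch between the outer sectors [j] and [j.+1] has its tip at the polygon vertex in
    direction [w] from the centre. The sum of the two side forms is [2 * s] times the component of
    [z] in that direction, so it is enough to stay below the vertex. *)
Lemma inner_notch i j z : (0 < i <= m)%N -> (j < m)%N -> inner i z ->
  side_right height (outer_axis j.+1) z + side_left height (outer_axis j) z < 2 * height.
Proof.
move=> /andP[i0 im] jm [hl hr hd].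
have [x [y [x0 y0 dE z1 z2]]] := sector_polar hl hr; rewrite dE in hd.
have a1 := ang_gt0 i0; have a2 := ang_le_max im.
have b1 := ang_gt0 (ltn0Sn j); have b2 := ang_le_max jm.
pose w := 2 * ang j.+1 - tau; set d := ang j.+1 - ang i.
have cs1 : c ^+ 2 + s ^+ 2 = 1 := cos2Dsin2 tau.
have tt1 : cos w ^+ 2 + sin w ^+ 2 = 1 := cos2Dsin2 w.
have E : side_right height (outer_axis j.+1) z + side_left height (outer_axis j) z =
    2 * s * (cos w * z.1 + sin w * (z.2 - height)).
  rewrite /side_right /side_left (_ : outer_axis j.+1 - tau = w + tau); last first.
    by rewrite /outer_axis /w; ring.
  rewrite (_ : outer_axis j + tau = w - tau); last by rewrite /outer_axis /w angS; ring.
  by rewrite (sinD w tau) (cosD w tau) (sinB w tau) (cosB w tau) -/c -/s; ring.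
rewrite E.
suff : cos w * z.1 + sin w * (z.2 - height) < rho.
  have -> : height = s * rho by [].
  by have := s0; nra.
have {}E : cos w * z.1 + sin w * (z.2 - height) =
    - 2 * height * sin w - rho * cos (2 * d) + (x * cos (2 * d + tau) + y * cos (2 * d - tau)).
  rewrite z1 z2 (_ : 2 * d = w - inner_axis i); last by rewrite /d /w /inner_axis; ring.
  rewrite (_ : w - inner_axis i + tau = w - (inner_axis i - tau)); last by ring.
  rewrite (_ : w - inner_axis i - tau = w - (inner_axis i + tau)); last by ring.
  by rewrite !(cosB w); ring.
have sw : 0 < sin w by apply: sin_gt0_pi; rewrite /w; have := t0; have := t6; lra.
have hw : 0 < height * sin w by rewrite mulr_gt0// height_gt0.
have rr : rho * c = 1 := rho_cos; have ro := rho_gt0.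
have c2 : cos (2 * tau) = c ^+ 2 - s ^+ 2.
  by rewrite (_ : 2 * tau = tau + tau) ?cosD -/c -/s; ring.
have c20 := cos_2tau_gt0 t0 t6.
have xy0 : 0 <= x * y by exact: mulr_ge0.
have r2rho : r < 2 * rho.
  by have := rc; have := c0; nra.
have r00 : 0 < r by have := r2; lra.
(* Inner sectors turned away from the notch: the projection [u * cos (2 * tau) + v] onto a side is
   at most [r < 2 * rho], and [two_cos_le] compares its multiple by the cosine with
   [1 + cos (2 * e)]. *)
have half u v : 0 <= u -> 0 <= v -> u ^+ 2 + v ^+ 2 + 2 * u * v * cos (2 * tau) <= r ^+ 2 ->
    forall e, 2 * tau <= e -> 2 * e <= pi - 4 * tau ->
    u * cos (2 * e + tau) + v * cos (2 * e - tau) < rho * (1 + cos (2 * e)).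
  move=> u0 v0 uv e et ep.
  have s20 : 0 < sin (2 * tau) := sin_2tau_gt0 t0 t6.
  have se : 0 <= sin (2 * e - tau) by apply: sin_ge0_pi; have := t0; lra.
  have ce : - 1 < cos (2 * e) by rewrite -cospi ltr_cos ?in_itv /=; have := t0; lra.
  have uE : cos (2 * e + tau) = cos (2 * e - tau) * cos (2 * tau) - sin (2 * e - tau) * sin (2 * tau).
    by rewrite -cosD; congr cos; ring.
  have us : 0 <= u * (sin (2 * e - tau) * sin (2 * tau)).
    by rewrite !mulr_ge0// ltW.
  have w0 : 0 <= u * cos (2 * tau) + v by rewrite addr_ge0 ?mulr_ge0 ?(ltW c20).
  have wr : u * cos (2 * tau) + v <= r.
    rewrite -(@ler_pXn2r _ 2) ?nnegrE ?(ltW r00)//; apply: le_trans uv.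
    have : 0 <= u ^+ 2 * (1 - cos (2 * tau) ^+ 2).
      by rewrite mulr_ge0 ?sqr_ge0// -sin2cos2 sqr_ge0.
    by nra.
  rewrite uE.
  have [ce0|ce0] := leP 0 (cos (2 * e - tau)).
    have : (u * cos (2 * tau) + v) * cos (2 * e - tau) <= (2 * rho) * cos (2 * e - tau).
      by apply: ler_wpM2r => //; lra.
    have := two_cos_le t0 t6 et ltac:(have := t0; lra).
    have : 0 < rho * (1 + cos (2 * e)) by rewrite mulr_gt0//; lra.
    have lt0 : (u * cos (2 * tau) + v) * cos (2 * e - tau) < 2 * rho * cos (2 * e - tau) \/
        cos (2 * e - tau) = 0.
      move: ce0; rewrite le_eqVlt => /orP[/eqP <-|cp]; first by right.
      by left; rewrite ltr_pM2r//; lra.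
    case: lt0 => [lt0|->]; last by nra.
    by nra.
  have : 0 < rho * (1 + cos (2 * e)) by rewrite mulr_gt0//; lra.
  by nra.
rewrite E; suff : x * cos (2 * d + tau) + y * cos (2 * d - tau) <= rho * (1 + cos (2 * d)) by lra.
have tp := t0.
have [d0|[d0|d0]] : d = 0 \/ (2 * tau <= d \/ d <= - 2 * tau).
- by case: (ang_cases i j.+1) => ?; [right; right|right; right|left|right; left]; rewrite /d; lra.
(* The inner sector points straight at the notch. The component along its axis, [(x + y) * c], is at
   most [r], and [r < 2 * rho] is exactly the upper bound imposed on [r]. *)
- rewrite d0 mulr0 add0r sub0r cosN cos0 -/c -mulrDl.
  have : (x + y) * c <= r.
    rewrite -(@ler_pXn2r _ 2) ?nnegrE ?(ltW r00) ?mulr_ge0 ?addr_ge0 ?(ltW c0)//.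
    apply: le_trans hd; rewrite c2; have := mulr_ge0 (sqr_ge0 s) (sqr_ge0 (x - y)).
    have -> : c ^+ 2 = 1 - s ^+ 2 by lra.
    by rewrite exprMn (_ : c ^+ 2 = 1 - s ^+ 2); [lra|lra].
  lra.
- by apply: ltW; apply: half => //; rewrite /d in d0 *; lra.
(* The mirror image of the previous case, with the two sides exchanged. *)
- rewrite -(cosN (2 * d + tau)) -(cosN (2 * d - tau)) -(cosN (2 * d)) addrC.
  rewrite (_ : - (2 * d - tau) = 2 * (- d) + tau); last by ring.
  rewrite (_ : - (2 * d + tau) = 2 * (- d) - tau); last by ring.
  rewrite (_ : - (2 * d) = 2 * (- d)); last by ring.
  by apply: ltW; apply: half; rewrite ?[y ^+ 2 + _]addrC /d in d0 *; lra.
Qed.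

(** A sweep over the outer sectors: a point not strictly inside the left side of sector [k] is
    strictly inside the right side of sector [k.+1], by [inner_notch]. The sweep starts and stops
    for free, because sectors [0] and [m] have lost one side each. *)
Lemma inners_sub_outers_int z : inners z -> outers_int z.
Proof.
move=> [i iP iz].
have step k : (k <= m)%N -> outers_int z \/
    ((0 < k)%N -> side_right height (outer_axis k) z < height).
  elim: k => [|k IH] km; first by right.
  have [|hr] := IH (ltnW km); first by left.
  have [hl|hl] := ltP (side_left height (outer_axis k) z) height.
    left; exists k; first exact: ltnW.
    by split => //; exact: inner_disc iP (ltnW km) iz.
  by right => _; have := inner_notch iP km iz; lra.
have [//|hr] := step m (leqnn m).
exists m => //; split => //; first by rewrite ltnn.
exact: inner_disc iP (leqnn m) iz.
Qed.

End Sectors.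

(** * The rotation about the pole, the mirror symmetry, and their action on sectors *)

Section SectorMotions.
Variables (R : realType) (m : nat) (r : R).
Hypothesis m0 : (0 < m)%N.
Local Notation tau := (tau R m).
Local Notation rho := (rho R m).
Local Notation height := (height R m).
Local Notation ang := (ang R m).

Definition pole : R * R := (-1, 0).
Definition turn : R * R -> R * R := rotation pole (2 * tau).
Definition back : R * R -> R * R := rotation pole (- (2 * tau)).
Definition mirror (z : R * R) : R * R := (- z.1, z.2).

Lemma turnK : cancel turn back. Proof. exact: rotationK. Qed.
Lemma backK : cancel back turn. Proof. exact: rotationVK. Qed.
Lemma mirrorK : involutive mirror.
Proof. by move=> [x y]; rewrite /mirror /= opprK. Qed.

Lemma turn_y z : (turn z).2 = sin (2 * tau) * (z.1 + 1) + cos (2 * tau) * z.2.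
Proof. by rewrite /turn /rotation /pole /=; ring. Qed.

Lemma back_y z : (back z).2 = cos (2 * tau) * z.2 - sin (2 * tau) * (z.1 + 1).
Proof. by rewrite /back /rotation /pole /= cosN sinN; ring. Qed.

Let t0 := tau_gt0 R m.
Let t6 := tau_le6 R m0.
Let c := cos tau.
Let s := sin tau.
Let c0 : 0 < c. Proof. exact: cos_tau_gt0 t0 t6. Qed.
Let s0 : 0 < s. Proof. exact: sin_tau_gt0 t0 t6. Qed.
Let h0 : 0 < height. Proof. exact: height_gt0. Qed.
Let s2 : sin (2 * tau) = 2 * s * c.
Proof. by rewrite mulr_natl sin_mulr2n -/c -/s; ring. Qed.
Let c2 : cos (2 * tau) = 1 - 2 * s ^+ 2. Proof. exact: cosx2. Qed.
Let cs1 : c ^+ 2 = 1 - s ^+ 2. Proof. exact: cos2sin2. Qed.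
Let hc : height * c = s. Proof. exact: height_cos. Qed.
Let rc : rho * c = 1. Proof. exact: rho_cos. Qed.
Let hs : height = s * rho. Proof. by []. Qed.
Let s20 : 0 < sin (2 * tau) := sin_2tau_gt0 t0 t6.
Let c20 : 0 < cos (2 * tau) := cos_2tau_gt0 t0 t6.

Lemma height_half1 : sin (2 * tau) * height = 1 - cos (2 * tau).
Proof. by rewrite s2 c2 -mulrA [c * _]mulrC hc; ring. Qed.

Lemma height_half2 : cos (2 * tau) * height = sin (2 * tau) - height.
Proof.
rewrite s2 c2; have -> : (1 - 2 * s ^+ 2) * height = 2 * (1 - s ^+ 2) * height - height by ring.
by rewrite -cs1 -hc; ring.
Qed.

(** The rotation carries the centre of the inner sectors to that of the outer ones: since [height]
    is the tangent of [tau], they are seen from the pole at the angles [- tau] and [tau]. *)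
Lemma turn_center z : (turn z).1 = cos (2 * tau) * z.1 - sin (2 * tau) * (z.2 - - height) /\
  (turn z).2 - height = sin (2 * tau) * z.1 + cos (2 * tau) * (z.2 - - height).
Proof.
have h1 := height_half1; have h2 := height_half2.
by rewrite turn_y /turn /rotation /pole /=; split; lra.
Qed.

Lemma side_left_turn t z : side_left m height (t + 2 * tau) (turn z) = side_left m (- height) t z.
Proof.
have [e1 e2] := turn_center z; rewrite /side_left e1 e2.
rewrite (_ : t + 2 * tau + tau = (t + tau) + 2 * tau); last by ring.
rewrite (cosD (t + tau)) (sinD (t + tau)).
move: (cos (t + tau)) (sin (t + tau)) (z.2 - _) z.1 => a b v u.
have := cos2Dsin2 (2 * tau); move: (cos _) (sin _) => C S CS.
transitivity ((C ^+ 2 + S ^+ 2) * (a * v - b * u)); first ring.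
by rewrite CS mul1r.
Qed.

Lemma side_right_turn t z : side_right m height (t + 2 * tau) (turn z) = side_right m (- height) t z.
Proof.
have [e1 e2] := turn_center z; rewrite /side_right e1 e2.
rewrite (_ : t + 2 * tau - tau = (t - tau) + 2 * tau); last by ring.
rewrite (cosD (t - tau)) (sinD (t - tau)).
move: (cos (t - tau)) (sin (t - tau)) (z.2 - _) z.1 => a b v u.
have := cos2Dsin2 (2 * tau); move: (cos _) (sin _) => C S CS.
transitivity ((C ^+ 2 + S ^+ 2) * (b * u - a * v)); first ring.
by rewrite CS mul1r.
Qed.

Lemma apex_dist2_turn t z : apex_dist2 m height (t + 2 * tau) (turn z) = apex_dist2 m (- height) t z.
Proof.
have [e1 e2] := turn_center z; rewrite /apex_dist2 e1 e2 (cosD t) (sinD t).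
move: (cos t) (sin t) (z.2 - _) z.1 => a b v u.
have := cos2Dsin2 (2 * tau); move: (cos _) (sin _) => C S CS.
transitivity ((C ^+ 2 + S ^+ 2) * ((u + rho * a) ^+ 2 + (v + rho * b) ^+ 2)); first ring.
by rewrite CS mul1r.
Qed.

Lemma outer_axisE i : outer_axis R m i = inner_axis R m i + 2 * tau.
Proof. by rewrite /outer_axis /inner_axis; ring. Qed.

Lemma side_left_top z : side_left m height (outer_axis R m m) z = height - z.2.
Proof.
rewrite /side_left (_ : outer_axis R m m + tau = pi); last by rewrite /outer_axis angm; ring.
by rewrite cospi sinpi; ring.
Qed.

(** For [i = m] the side condition dropped from [outer] amounts to a nonnegative ordinate, which is
    why the half-plane is assumed. *)
Lemma outer_turn i z : (0 < i <= m)%N -> 0 <= (turn z).2 ->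
  outer m r i (turn z) <-> inner m r i z.
Proof.
move=> /andP[i0 im] y0; rewrite /outer /inner /= outer_axisE.
rewrite side_left_turn side_right_turn apex_dist2_turn; split; last by move=> [? ? ?].
move=> [hl hr hd]; split => //; last exact: hr.
move: im; rewrite leq_eqVlt => /orP[/eqP ie|//].
by rewrite -side_left_turn -outer_axisE ie side_left_top; lra.
Qed.

Lemma outer_int_turn i z : (0 < i <= m)%N -> 0 < (turn z).2 ->
  outer_int m r i (turn z) <-> inner_int m r i z.
Proof.
move=> /andP[i0 im] y0; rewrite /outer_int /inner_int /= outer_axisE.
rewrite side_left_turn side_right_turn apex_dist2_turn; split; last by move=> [? ? ?].
move=> [hl hr hd]; split => //; last exact: hr.
move: im; rewrite leq_eqVlt => /orP[/eqP ie|//].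
by rewrite -side_left_turn -outer_axisE ie side_left_top; lra.
Qed.

Lemma outer0_left z : side_left m height (outer_axis R m 0) z = height + (back z).2.
Proof.
rewrite /side_left (_ : outer_axis R m 0 + tau = 2 * tau); last by rewrite /outer_axis ang0; ring.
by rewrite back_y; have := height_half2; lra.
Qed.

Lemma outer0_dist z : apex_dist2 m height (outer_axis R m 0) z = (z.1 + 1) ^+ 2 + z.2 ^+ 2.
Proof.
rewrite /apex_dist2 (_ : outer_axis R m 0 = tau); last by rewrite /outer_axis ang0; ring.
by rewrite rc -/s hs; congr (_ + _ ^+ 2); ring.
Qed.

Lemma outer0E z : outer m r 0 z <-> (back z).2 <= 0 /\ (z.1 + 1) ^+ 2 + z.2 ^+ 2 <= r ^+ 2.
Proof.
split=> [[hl _ hd]|[hl hd]].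
  by have {}hl := hl m0; rewrite outer0_left in hl; rewrite outer0_dist in hd; split => //; lra.
by split; rewrite ?outer0_dist// outer0_left => _; lra.
Qed.

Lemma outer0_intE z : outer_int m r 0 z <-> (back z).2 < 0 /\ (z.1 + 1) ^+ 2 + z.2 ^+ 2 < r ^+ 2.
Proof.
split=> [[hl _ hd]|[hl hd]].
  by have {}hl := hl m0; rewrite outer0_left in hl; rewrite outer0_dist in hd; split => //; lra.
by split; rewrite ?outer0_dist// outer0_left => _; lra.
Qed.

(** Outer sector [0] has its apex at the pole; every other one is a rotated inner sector. Both the
    contour and the tiling rest on this decomposition. *)
Lemma outersE z : 0 <= z.2 -> outers m r z <-> outer m r 0 z \/ inners m r (back z).
Proof.
move=> y0; have y0' : 0 <= (turn (back z)).2 by rewrite backK.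
split=> [[[|i] im w]|[w|[i iP w]]]; first by left.
- by right; exists i.+1 => //; apply/outer_turn => //; rewrite ?backK.
- by exists 0%N.
- exists i; first by case/andP: iP.
  by rewrite -(backK z); apply/outer_turn.
Qed.

Lemma outers_intE z : 0 < z.2 -> outers_int m r z <-> outer_int m r 0 z \/ inners_int m r (back z).
Proof.
move=> y0; have y0' : 0 < (turn (back z)).2 by rewrite backK.
split=> [[[|i] im w]|[w|[i iP w]]]; first by left.
- by right; exists i.+1 => //; apply/outer_int_turn => //; rewrite ?backK.
- by exists 0%N.
- exists i; first by case/andP: iP.
  by rewrite -(backK z); apply/outer_int_turn.
Qed.

Lemma side_left_mirror o t z : side_left m o (pi - t) (mirror z) = side_right m o t z.
Proof.
rewrite /side_left /side_right /= (_ : pi - t + tau = pi - (t - tau)); last by ring.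
by rewrite sinBpi cosBpi; ring.
Qed.

Lemma side_right_mirror o t z : side_right m o (pi - t) (mirror z) = side_left m o t z.
Proof.
rewrite /side_left /side_right /= (_ : pi - t - tau = pi - (t + tau)); last by ring.
by rewrite sinBpi cosBpi; ring.
Qed.

Lemma apex_dist2_mirror o t z : apex_dist2 m o (pi - t) (mirror z) = apex_dist2 m o t z.
Proof. by rewrite /apex_dist2 /= sinBpi cosBpi; ring. Qed.

Lemma angB k l : (l <= k)%N -> ang (k - l) = ang k - ang l.
Proof. by move=> lk; rewrite /ang natrB//; ring. Qed.

Lemma inner_axis_mirror i : (i <= m)%N -> inner_axis R m (m.+1 - i) = pi - inner_axis R m i.
Proof.
move=> im; rewrite /inner_axis angB ?(leqW im)// angS.
by have := angm R m; lra.
Qed.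

Lemma outer_axis_mirror i : (i <= m)%N -> outer_axis R m (m - i) = pi - outer_axis R m i.
Proof. by move=> im; rewrite /outer_axis angB//; have := angm R m; lra. Qed.

Lemma inners_mirror z : inners m r z -> inners m r (mirror z).
Proof.
move=> [i /andP[i0 im] [hl hr hd]]; exists (m.+1 - i)%N.
  by rewrite subn_gt0 ltnS im leq_subLR -add1n leq_add2r.
by rewrite /inner /= inner_axis_mirror// side_left_mirror side_right_mirror apex_dist2_mirror.
Qed.

Lemma inners_int_mirror z : inners_int m r z -> inners_int m r (mirror z).
Proof.
move=> [i /andP[i0 im] [hl hr hd]]; exists (m.+1 - i)%N.
  by rewrite subn_gt0 ltnS im leq_subLR -add1n leq_add2r.
by rewrite /inner_int /= inner_axis_mirror// side_left_mirror side_right_mirror apex_dist2_mirror.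
Qed.

Lemma outers_mirror z : outers m r z -> outers m r (mirror z).
Proof.
move=> [i im [hl hr hd]]; exists (m - i)%N; first exact: leq_subr.
rewrite /outer /= outer_axis_mirror// side_left_mirror side_right_mirror apex_dist2_mirror.
by split => //; [rewrite ltn_subrL => /andP[/hr]|rewrite subn_gt0 => /hl].
Qed.

Lemma outers_int_mirror z : outers_int m r z -> outers_int m r (mirror z).
Proof.
move=> [i im [hl hr hd]]; exists (m - i)%N; first exact: leq_subr.
rewrite /outer_int /= outer_axis_mirror// side_left_mirror side_right_mirror apex_dist2_mirror.
by split => //; [rewrite ltn_subrL => /andP[/hr]|rewrite subn_gt0 => /hl].
Qed.

(** A certificate that the rotation keeps the upper part of an inner sector above the axis: on the
    right, the ordinate, a constant and the slack of the left side condition all enter with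
    nonnegative weights. *)
Lemma inner_left_turn i z : (0 < i <= m)%N ->
  sin (2 * ang i) * (turn z).2 = sin (2 * ang i + 2 * tau) * z.2 +
    2 * sin (2 * tau) * rho * sin (ang i) * cos (ang i + tau) +
    sin (2 * tau) * (height - side_left m (- height) (inner_axis R m i) z).
Proof.
move=> /andP[i0 im]; rewrite turn_y /side_left.
rewrite (_ : inner_axis R m i + tau = 2 * ang i); last by rewrite /inner_axis; ring.
rewrite (sinD (2 * ang i)) (cosD (ang i) tau) -/c -/s.
have sa : sin (2 * ang i) = 2 * (cos (ang i) * sin (ang i)).
  by rewrite [in LHS]mulr_natl sin_mulr2n; ring.
have ca : 2 * sin (ang i) ^+ 2 = 1 - cos (2 * ang i) by rewrite cosx2; ring.
have -> : 2 * sin (2 * tau) * rho * sin (ang i) * (cos (ang i) * c - sin (ang i) * s) =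
    sin (2 * tau) * ((rho * c) * (2 * (cos (ang i) * sin (ang i))) - (s * rho) * (2 * sin (ang i) ^+ 2)).
  by ring.
by rewrite rc -hs -sa ca; ring.
Qed.

Let left_pos i : (0 < i <= m)%N -> [/\ 0 < sin (2 * ang i), 0 <= sin (2 * ang i + 2 * tau) &
  0 <= 2 * sin (2 * tau) * rho * sin (ang i) * cos (ang i + tau)].
Proof.
move=> /andP[i0 im]; have t := t0; have a1 := ang_gt0 R m i0; have a2 := ang_le_max R im.
split; first by apply: sin_gt0_pi; lra.
  by apply: sin_ge0_pi; lra.
rewrite mulr_ge0//; last by apply: cos_ge0_pihalf; lra.
rewrite mulr_ge0//; last by apply: sin_ge0_pi; lra.
by rewrite mulr_ge0 ?(ltW (rho_gt0 R m0))// mulr_ge0// ltW.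
Qed.

Lemma inners_turn z : 0 <= z.2 -> inners m r z -> 0 <= (turn z).2.
Proof.
move=> y0 [i iP [hl _ _]]; have [sa sb e] := left_pos iP.
rewrite -(pmulr_rge0 _ sa) inner_left_turn// addr_ge0 ?mulr_ge0 ?subr_ge0//; last exact: ltW.
by rewrite addr_ge0// mulr_ge0.
Qed.

Lemma inners_int_turn z : 0 <= z.2 -> inners_int m r z -> 0 < (turn z).2.
Proof.
move=> y0 [i iP [hl _ _]]; have [sa sb e] := left_pos iP.
rewrite -(pmulr_rgt0 _ sa) inner_left_turn// ltr_wpDl ?mulr_gt0 ?subr_gt0//.
by rewrite addr_ge0// mulr_ge0.
Qed.

(** On the axis, the ordinate after rotation is a positive multiple of [x + 1]. Applied to the point
    and to its mirror image, [inners_int_turn] gives both bounds. *)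
Lemma inners_int_axis x : inners_int m r (x, 0) -> `|x| < 1.
Proof.
move=> ix; have s2p := s20; have := @inners_int_turn (x, 0) (lexx 0) ix.
have := @inners_int_turn (mirror (x, 0)) (lexx 0) (inners_int_mirror ix).
rewrite !turn_y /= !mulr0 !addr0 !pmulr_rgt0// => ? ?.
by rewrite ltr_norml; lra.
Qed.

(** Inner sector [m] is carried to outer sector [m], with apex [(1, 0)], whose dropped side runs
    along the axis to [(1 - r, 0)]. The axis segment beyond the pole is thus a rotated piece of an
    inner sector. *)
Lemma inners_flap x : 1 <= x -> x <= r - 1 -> inners m r (back (- x, 0)).
Proof.
move=> x1 xr; exists m; first by rewrite m0 leqnn.
rewrite /inner /= -side_left_turn -side_right_turn -apex_dist2_turn -outer_axisE backK.
have tt := angm R m; have h := h0; split.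
- by rewrite side_left_top /= subr0.
- rewrite /side_right (_ : _ - tau = pi - 2 * tau); last by rewrite /outer_axis; lra.
  rewrite sinBpi cosBpi /=.
  have : 0 <= sin (2 * tau) * x by rewrite mulr_ge0 ?(ltW s20)//; lra.
  by have := mulr_gt0 c20 h0; have := height_half2; have := s20; nra.
- rewrite /apex_dist2 (_ : outer_axis _ _ _ = pi - tau); last by rewrite /outer_axis; lra.
  rewrite sinBpi cosBpi /= mulrN rc -/s hs.
  have -> : (- x - 1) ^+ 2 + (0 - s * rho + rho * s) ^+ 2 = (x + 1) ^+ 2 by ring.
  by rewrite ler_pXn2r ?nnegrE//; lra.
Qed.

Lemma back_pole : back pole = pole.
Proof. by rewrite /back /rotation /= !subrr !mulr0 subrr !addr0. Qed.

Hypotheses (r2 : 2 < r) (rc2 : r * c < 2).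

Lemma inners_pole : inners m r pole.
Proof. by rewrite -back_pole; apply: inners_flap; have := r2; lra. Qed.

Lemma inners_dist z : inners m r z -> (z.1 + 1) ^+ 2 + z.2 ^+ 2 < r ^+ 2.
Proof. by move=> [i iP iz]; rewrite -outer0_dist; exact: (inner_disc m0 r2 iP (leq0n m) iz). Qed.

Lemma turn_dist z : ((turn z).1 + 1) ^+ 2 + (turn z).2 ^+ 2 = (z.1 + 1) ^+ 2 + z.2 ^+ 2.
Proof.
rewrite turn_y /turn /rotation /pole /=.
have := cos2Dsin2 (2 * tau); move: (cos _) (sin _) => C S CS.
transitivity ((C ^+ 2 + S ^+ 2) * ((z.1 + 1) ^+ 2 + z.2 ^+ 2)); first ring.
by rewrite CS mul1r.
Qed.

Lemma outers_dist z : 0 <= z.2 -> outers m r z -> (z.1 + 1) ^+ 2 + z.2 ^+ 2 <= r ^+ 2.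
Proof.
move=> y0 /(outersE y0)[/outer0E[]//|/inners_dist iz].
by rewrite -(backK z) turn_dist ltW.
Qed.

Lemma outers_axis x : outers m r (x, 0) -> `|x| <= r - 1.
Proof.
move=> ox; have r2' := r2; have := @outers_dist (x, 0) (lexx 0) ox; have := @outers_dist (mirror (x, 0)) (lexx 0) (outers_mirror ox).
rewrite /= expr0n /= addr0 ler_norml => d1 d2.
by apply/andP; split; nra.
Qed.

Lemma outers_axis_right : outers m r (r - 1, 0).
Proof.
exists 0%N => //; apply/outer0E; rewrite back_y /= mulr0 sub0r subrK expr0n addr0; split => //.
by rewrite oppr_le0 mulr_ge0 ?(ltW s20)//; have := r2; lra.
Qed.

End SectorMotions.

(** * Gauges of discs, half-planes and unions of sectors *)

Section Gauges.
Variable R : realType.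
Implicit Types A B : set (R * R).

Definition has_gauge A B := exists g : R * R -> R,
  [/\ gauge g, forall z, g z <= 1 <-> A z & forall z, g z < 1 <-> B z].

(** The gauge is the positive root [x] of [G x ^+ 2 + 2 B x = N], the condition for [z / x] to lie
    on the circle; [G > 0] because the origin is interior to the disc. *)
Lemma has_gauge_disc (k : R * R) (r2 : R) : k.1 ^+ 2 + k.2 ^+ 2 < r2 ->
  has_gauge [set z | (z.1 - k.1) ^+ 2 + (z.2 - k.2) ^+ 2 <= r2]
            [set z | (z.1 - k.1) ^+ 2 + (z.2 - k.2) ^+ 2 < r2].
Proof.
move=> kr; pose G := r2 - (k.1 ^+ 2 + k.2 ^+ 2); have G0 : 0 < G by rewrite subr_gt0.
pose B (z : R * R) := z.1 * k.1 + z.2 * k.2.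
pose N (z : R * R) := z.1 ^+ 2 + z.2 ^+ 2.
pose S z := Num.sqrt (B z ^+ 2 + G * N z).
have N0 z : 0 <= N z by rewrite addr_ge0// sqr_ge0.
have D0 z : 0 <= B z ^+ 2 + G * N z by rewrite addr_ge0 ?sqr_ge0// mulr_ge0// ltW.
have S0 z : 0 <= S z by exact: sqrtr_ge0.
have S2 z : S z ^+ 2 = B z ^+ 2 + G * N z by rewrite sqr_sqrtr.
exists (fun z => (S z - B z) / G); split.
- split.
  + move=> z; have c1 := @continuous_fst R z; have c2 := @continuous_snd R z.
    have cst (b : R) : {for z, continuous (fun _ : R * R => b)} by exact: cvg_cst.
    have cB : {for z, continuous B}.
      exact: (continuousD (continuousM c1 (cst k.1)) (continuousM c2 (cst k.2))).
    have cN : {for z, continuous N}.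
      exact: (continuousD (continuousM c1 c1) (continuousM c2 c2)).
    have cD : {for z, continuous (fun z => B z ^+ 2 + G * N z)}.
      exact: (continuousD (continuousM cB cB) (continuousM (cst G) cN)).
    have cS : {for z, continuous S}.
      exact: (@continuous_comp _ _ _ _ Num.sqrt z cD (@sqrt_continuous R _)).
    exact: (continuousM (continuousB cS cB) (cst G^-1)).
  + move=> t z t0; have -> : B (t * z.1, t * z.2) = t * B z by rewrite /B /=; ring.
    have -> : S (t * z.1, t * z.2) = t * S z.
      rewrite /S; have -> : B (t * z.1, t * z.2) ^+ 2 + G * N (t * z.1, t * z.2) =
        t ^+ 2 * (B z ^+ 2 + G * N z) by rewrite /B /N /=; ring.
      by rewrite sqrtrM ?sqr_ge0// sqrtr_sqr gtr0_norm.
    by rewrite -mulrBr mulrA.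
  + move=> z zn; rewrite divr_gt0// subr_gt0.
    have Np : 0 < N z.
      rewrite lt_neqAle N0 andbT eq_sym; apply/eqP => e; apply: zn.
      by case: z e => x y; rewrite /N /= => e; congr pair; nra.
    have := S2 z; have := mulr_gt0 G0 Np; have := S0 z; nra.
- move=> z /=; rewrite ler_pdivrMr// mul1r lerBlDr.
  have -> : ((z.1 - k.1) ^+ 2 + (z.2 - k.2) ^+ 2 <= r2) = (N z <= G + 2 * B z).
    by rewrite /N /G /B; apply/idP/idP; lra.
  have e := S2 z; have p := S0 z; have n := N0 z; rewrite -(ler_pM2l G0 (N z)); split=> h.
    have : S z ^+ 2 <= (G + B z) ^+ 2 by rewrite ler_pXn2r ?nnegrE//; lra.
    by lra.
  have gb : 0 <= G + B z by rewrite ler_pM2l// in h; lra.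
  by rewrite -(@ler_pXn2r _ 2) ?nnegrE//; lra.
- move=> z /=; rewrite ltr_pdivrMr// mul1r ltrBlDr.
  have -> : ((z.1 - k.1) ^+ 2 + (z.2 - k.2) ^+ 2 < r2) = (N z < G + 2 * B z).
    by rewrite /N /G /B; apply/idP/idP; lra.
  have e := S2 z; have p := S0 z; have n := N0 z; rewrite -(ltr_pM2l G0 (N z)); split=> h.
    have : S z ^+ 2 < (G + B z) ^+ 2 by rewrite ltr_pXn2r ?nnegrE//; lra.
    by lra.
  have gb : 0 <= G + B z by rewrite ltr_pM2l// in h; lra.
  by rewrite -(@ltr_pXn2r _ 2) ?nnegrE//; lra.
Qed.

Lemma has_gauge_ext A A' B B' : has_gauge A B ->
  (forall z, A z <-> A' z) -> (forall z, B z <-> B' z) -> has_gauge A' B'.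
Proof.
move=> [g [gg gA gB]] AA BB; exists g; split => // z.
  by rewrite gA.
by rewrite gB.
Qed.

(** The linear form over [d] is homogeneous but takes negative values; its maximum with a gauge is a
    gauge. Intersection corresponds to the maximum here and union to the minimum in
    [has_gauge_union]. *)
Lemma has_gauge_halfplane A B (l1 l2 d : R) : 0 < d -> has_gauge A B ->
  has_gauge [set z | A z /\ l1 * z.1 + l2 * z.2 <= d]
            [set z | B z /\ l1 * z.1 + l2 * z.2 < d].
Proof.
move=> d0 [g [[cg hg pg] gA gB]].
pose l (z : R * R) := l1 / d * z.1 + l2 / d * z.2.
have lE z : l z = (l1 * z.1 + l2 * z.2) / d by rewrite /l; field; rewrite gt_eqF.
exists (fun z => Num.max (g z) (l z)); split.
- split.
  + move=> z; have c1 := @continuous_fst R z; have c2 := @continuous_snd R z.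
    have cst (b : R) : {for z, continuous (fun _ : R * R => b)} by exact: cvg_cst.
    have cl : {for z, continuous l}.
      exact: (continuousD (continuousM (cst (l1 / d)) c1) (continuousM (cst (l2 / d)) c2)).
    exact: (continuous_max (@cg z) cl).
  + move=> t z t0; rewrite hg// (_ : l _ = t * l z); last by rewrite /l /=; ring.
    by rewrite maxr_pMr// ltW.
  + by move=> z zn; rewrite lt_max pg.
- move=> z; rewrite ge_max lE ler_pdivrMr// mul1r; split=> [/andP[/gA ? ?]//|[/gA ? ?]].
  exact/andP.
- move=> z; rewrite gt_max lE ltr_pdivrMr// mul1r; split=> [/andP[/gB ? ?]//|[/gB ? ?]].
  exact/andP.
Qed.

Lemma has_gauge_union A B A' B' : has_gauge A B -> has_gauge A' B' ->
  has_gauge [set z | A z \/ A' z] [set z | B z \/ B' z].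
Proof.
move=> [g [[cg hg pg] gA gB]] [g' [[cg' hg' pg'] gA' gB']].
exists (fun z => Num.min (g z) (g' z)); split.
- split.
  + by move=> z; exact: (continuous_min (@cg z) (@cg' z)).
  + by move=> t z t0; rewrite hg// hg'// minr_pMr// ltW.
  + by move=> z zn; rewrite lt_min pg ?pg'.
- move=> z; rewrite ge_min; split=> [/orP[/gA|/gA']|[/gA|/gA'] ->]; rewrite ?orbT//; by [left|right].
- move=> z; rewrite gt_min; split=> [/orP[/gB|/gB']|[/gB|/gB'] ->]; rewrite ?orbT//; by [left|right].
Qed.

Lemma has_gauge_bigcup (F G : nat -> set (R * R)) k :
  (forall i, (i <= k)%N -> has_gauge (F i) (G i)) ->
  has_gauge [set z | exists2 i, (i <= k)%N & F i z] [set z | exists2 i, (i <= k)%N & G i z].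
Proof.
elim: k => [|k IH] FG.
  apply: (has_gauge_ext (FG 0%N (leqnn _))) => z; split=> [?|[[|]//]]; by exists 0%N.
have := has_gauge_union (IH (fun i ik => FG i (leqW ik))) (FG k.+1 (leqnn _)).
move/has_gauge_ext; apply => z /=; split=> [[[i ik ?]|?]|[i]].
- by exists i => //; exact: leqW.
- by exists k.+1.
- by rewrite leq_eqVlt => /orP[/eqP -> ?|ik ?]; [right|left; exists i].
- by exists i => //; exact: leqW.
- by exists k.+1.
- by rewrite leq_eqVlt => /orP[/eqP -> ?|ik ?]; [right|left; exists i].
Qed.

Variables (m : nat) (r : R).
Hypotheses (m0 : (0 < m)%N) (r2 : 2 < r).
Local Notation tau := (tau R m).
Local Notation rho := (rho R m).
Local Notation height := (height R m).
Local Notation ang := (ang R m).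

Let t0 := tau_gt0 R m.
Let t6 := tau_le6 R m0.

(** An apex is at distance at most [rho + height = (1 + sin tau) / cos tau] from the origin, and
    this is less than 2 because [sin tau <= 1 / 2]. *)
Let norm_apex o t : o ^+ 2 = height ^+ 2 ->
  (- rho * cos t) ^+ 2 + (o - rho * sin t) ^+ 2 < r ^+ 2.
Proof.
move=> oh; have r2' := r2.
have cs1 : cos tau ^+ 2 = 1 - sin tau ^+ 2 := cos2sin2 _.
have c0 := cos_tau_gt0 t0 t6; have s0 := sin_tau_gt0 t0 t6; have sl := sin_tau_le t0 t6.
have rc : rho * cos tau = 1 := rho_cos R m0; have h0 := height_gt0 R m0.
have hc : height * cos tau = sin tau := height_cos R m0; have ro := rho_gt0 R m0.
have tt := cos2Dsin2 t; have s1 := sin_le1 t; have s1' := sin_geN1 t.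
have os : - (2 * o * rho * sin t) <= 2 * height * rho.
  have : `|o| = height by rewrite -sqrtr_sqr oh sqrtr_sqr gtr0_norm.
  move=> on; have : `|2 * o * rho * sin t| <= 2 * height * rho * 1.
    rewrite !normrM on (gtr0_norm ro) (ger0_norm (ler0n _ 2)).
    by apply: ler_wpM2l; [rewrite !mulr_ge0// ltW|exact: sin_max].
  by rewrite mulr1 ler_norml; lra.
have E : (- rho * cos t) ^+ 2 + (o - rho * sin t) ^+ 2 =
    rho ^+ 2 * (cos t ^+ 2 + sin t ^+ 2) + o ^+ 2 - 2 * o * rho * sin t by ring.
rewrite E tt oh.
have : (rho + height) ^+ 2 < 4.
  have : (rho + height) * cos tau = 1 + sin tau by rewrite mulrDl rc hc.
  have : 0 < rho + height by lra.
  move: (rho + height) => q q0 qE.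
  rewrite -(@ltr_pM2r _ (cos tau ^+ 2)) ?exprn_gt0// -exprMn qE cs1; nra.
have : 4 < r ^+ 2 by nra.
nra.
Qed.

Let disc o t : o ^+ 2 = height ^+ 2 ->
  has_gauge [set z | apex_dist2 m o t z <= r ^+ 2] [set z | apex_dist2 m o t z < r ^+ 2].
Proof.
move=> oh; have E z : apex_dist2 m o t z =
    (z.1 - - rho * cos t) ^+ 2 + (z.2 - (o - rho * sin t)) ^+ 2.
  by rewrite /apex_dist2; ring.
by apply: (has_gauge_ext (@has_gauge_disc (- rho * cos t, o - rho * sin t) _ (norm_apex t oh))) => z;
  rewrite /= E.
Qed.

Let left_gauge A B o t : 0 < height + o * cos (t + tau) -> has_gauge A B ->
  has_gauge [set z | A z /\ side_left m o t z <= height] [set z | B z /\ side_left m o t z < height].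
Proof.
move=> d0 /(has_gauge_halfplane (- sin (t + tau)) (cos (t + tau)) d0) /has_gauge_ext.
by apply=> z /=; rewrite /side_left; split=> -[? ?]; split => //; lra.
Qed.

Let right_gauge A B o t : 0 < height - o * cos (t - tau) -> has_gauge A B ->
  has_gauge [set z | A z /\ side_right m o t z <= height] [set z | B z /\ side_right m o t z < height].
Proof.
move=> d0 /(has_gauge_halfplane (sin (t - tau)) (- cos (t - tau)) d0) /has_gauge_ext.
by apply=> z /=; rewrite /side_right; split=> -[? ?]; split => //; lra.
Qed.

Let cos_lt1 x : 0 < x -> x < pi -> 0 < height * (1 - cos x) /\ 0 < height * (1 + cos x).
Proof.
move=> x0 xpi; have h0 := height_gt0 R m0; have pi0 := pi_gt0 R.
have : cos x < 1 by rewrite -cos0 ltr_cos ?in_itv /=; lra.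
have : - 1 < cos x by rewrite -cospi ltr_cos ?in_itv /=; lra.
by move=> ? ?; split; apply: mulr_gt0; lra.
Qed.

Lemma has_gauge_inners : has_gauge (inners m r) (inners_int m r).
Proof.
have t := t0.
have := @has_gauge_bigcup (fun i => inner m r i.+1) (fun i => inner_int m r i.+1) m.-1.
have lem i : (i <= m.-1)%N -> has_gauge (inner m r i.+1) (inner_int m r i.+1).
  move=> im; have im' : (i.+1 <= m)%N by lia.
  have a1 := ang_gt0 R m (ltn0Sn i); have a2 := ang_le_max R im'.
  have d := disc (inner_axis R m i.+1) (sqrrN height).
  have [p1 _] := @cos_lt1 (2 * ang i.+1) ltac:(lra) ltac:(lra).
  have [_ p2] := @cos_lt1 (2 * ang i.+1 - 2 * tau) ltac:(lra) ltac:(lra).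
  have l0 : 0 < height + - height * cos (inner_axis R m i.+1 + tau).
    by rewrite (_ : inner_axis R m i.+1 + tau = 2 * ang i.+1) /inner_axis; lra.
  have q0 : 0 < height - - height * cos (inner_axis R m i.+1 - tau).
    by rewrite (_ : inner_axis R m i.+1 - tau = 2 * ang i.+1 - 2 * tau) /inner_axis; lra.
  apply: (has_gauge_ext (right_gauge q0 (left_gauge l0 d))) => z /=.
    by split=> [[[? ?] ?]|[? ? ?]]; split.
  by split=> [[[? ?] ?]|[? ? ?]]; split.
move=> /(_ lem) /has_gauge_ext; apply => z /=; split.
- by move=> [i im iz]; exists i.+1 => //; lia.
- by move=> [[//|i] im iz]; exists i => //; lia.
- by move=> [i im iz]; exists i.+1 => //; lia.
- by move=> [[//|i] im iz]; exists i => //; lia.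
Qed.

Lemma has_gauge_outers : has_gauge (outers m r) (outers_int m r).
Proof.
have t := t0; apply: has_gauge_bigcup => j jm.
have b1 := ang_ge0 R m j; have b2 := ang_le_max R jm.
have d := disc (outer_axis R m j) (erefl (height ^+ 2)).
have {}d : has_gauge
    [set z | apex_dist2 m height (outer_axis R m j) z <= r ^+ 2 /\
      ((j < m)%N -> side_left m height (outer_axis R m j) z <= height)]
    [set z | apex_dist2 m height (outer_axis R m j) z < r ^+ 2 /\
      ((j < m)%N -> side_left m height (outer_axis R m j) z < height)].
  have [jm'|jm'] := ltnP j m; last first.
    by apply: (has_gauge_ext d) => z /=; split=> // -[].
  have b3 := ang_le_max R jm'; have b4 := ang_gt0 R m (ltn0Sn j).
  have [_ p2] := @cos_lt1 (2 * ang j.+1 - 2 * tau) ltac:(lra) ltac:(lra).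
  have l0 : 0 < height + height * cos (outer_axis R m j + tau).
    rewrite (_ : outer_axis R m j + tau = 2 * ang j.+1 - 2 * tau); first lra.
    by rewrite /outer_axis angS; lra.
  by apply: (has_gauge_ext (left_gauge l0 d)) => z /=; split=> -[? h]; split => //; exact: h.
have [j0|j0] := ltnP 0 j; last first.
  apply: (has_gauge_ext d) => z /=; rewrite /outer /outer_int /=; split=> [[? ?]|[? ? ?]]; split => //; by rewrite ltnNge j0.
have b3 := ang_gt0 R m j0.
have [p1 _] := @cos_lt1 (2 * ang j) ltac:(lra) ltac:(lra).
have q0 : 0 < height - height * cos (outer_axis R m j - tau).
  by rewrite (_ : outer_axis R m j - tau = 2 * ang j) /outer_axis; lra.
apply: (has_gauge_ext (right_gauge q0 d)) => z /=; rewrite /outer /outer_int /=.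
  by split=> [[[? ?] ?]|[? h ?]]; split => //; exact: h.
by split=> [[[? ?] ?]|[? h ?]]; split => //; exact: h.
Qed.

End Gauges.

(** * The tile and its two generating curves *)

Section WedgeTile.
Variables (R : realType) (m : nat) (r : R).
Hypotheses (m0 : (0 < m)%N) (r2 : 2 < r) (rc : r * cos (tau R m) < 2).
Local Notation tau := (tau R m).
Local Notation L := (inners m r).
Local Notation Lo := (inners_int m r).
Local Notation K := (outers m r).
Local Notation Ko := (outers_int m r).
Local Notation pole := (pole R).
Local Notation turn := (@turn R m).
Local Notation back := (@back R m).

Definition wedge_tile := [set z : R * R | [/\ 0 <= z.2, K z & ~ Lo z]].
Definition wedge_open := [set z : R * R | [/\ 0 < z.2, Ko z & ~ L z]].
Definition wedge_edge := wedge_tile `\` wedge_open.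

Let f := sval (cid (has_gauge_outers m0 r2)).
Let g := sval (cid (has_gauge_inners m0 r2)).
Let gf : gauge f. Proof. by case: (svalP (cid (has_gauge_outers m0 r2))). Qed.
Let gg : gauge g. Proof. by case: (svalP (cid (has_gauge_inners m0 r2))). Qed.
Let fK z : f z <= 1 <-> K z. Proof. by case: (svalP (cid (has_gauge_outers m0 r2))). Qed.
Let fKo z : f z < 1 <-> Ko z. Proof. by case: (svalP (cid (has_gauge_outers m0 r2))). Qed.
Let gL z : g z <= 1 <-> L z. Proof. by case: (svalP (cid (has_gauge_inners m0 r2))). Qed.
Let gLo z : g z < 1 <-> Lo z. Proof. by case: (svalP (cid (has_gauge_inners m0 r2))). Qed.

Let LoL z : Lo z -> L z. Proof. by rewrite -gL -gLo; exact: ltW. Qed.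
Let KoK z : Ko z -> K z. Proof. by rewrite -fK -fKo; exact: ltW. Qed.
Let LKo z : L z -> Ko z. Proof. exact: inners_sub_outers_int m0 r2 rc z. Qed.
Let s20 : 0 < sin (2 * tau) := sin_2tau_gt0 (tau_gt0 R m) (tau_le6 R m0).

(** Scaled to the inner curve, [z] lies in the inner region, hence in the interior of the outer
    one. *)
Let fg z : z <> (0, 0) -> 0 <= z.2 -> f z < g z.
Proof.
move=> zn _; have g0 : 0 < g z by case: gg => _ _; apply.
have gi : 0 < (g z)^-1 by rewrite invr_gt0.
have : g ((g z)^-1 * z.1, (g z)^-1 * z.2) <= 1.
  by rewrite gauge_scale ?(ltW gi)// mulVf// gt_eqF.
move/gL/LKo/fKo; rewrite gauge_scale ?(ltW gi)//.
by rewrite -(ltr_pM2l g0) mulr1 mulrA divff ?mul1r// gt_eqF.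
Qed.

Lemma wedge_tileE : wedge_tile = polar_closed f g.
Proof.
apply/seteqP; split=> z [y0 kz lz]; split => //.
- exact/fK.
- by rewrite leNgt; apply/negP => /gLo.
- exact/fK.
- by move=> /gLo; rewrite ltNge lz.
Qed.

Lemma wedge_openE : wedge_open = polar_open f g.
Proof.
apply/seteqP; split=> z [y0 kz lz]; split => //.
- exact/fKo.
- by rewrite ltNge; apply/negP => /gL.
- exact/fKo.
- by move=> /gL; rewrite leNgt lz.
Qed.

Lemma wedge_boundary : tile_boundary wedge_tile wedge_edge.
Proof. by rewrite /wedge_edge wedge_tileE wedge_openE; exact: tile_boundary_polar. Qed.

Lemma wedge_boundary_unique d : tile_boundary wedge_tile d -> d = wedge_edge.
Proof.
apply: (@tile_boundary_unique _ _ wedge_open).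
- by rewrite /wedge_edge wedge_tileE wedge_openE; exact: bounds_polar.
- rewrite setDUK// => z [y0 kz lz]; split; [exact: ltW|exact: KoK|by move=> /LoL].
- by rewrite wedge_tileE wedge_openE; exact: polar_open_max.
Qed.

(** Along the axis the inner region ends exactly at the poles and, by [f_axis], the outer one at
    abscissa [r - 1]. This locates the end-points of [eta] and makes [r] visible on the tile. *)
Let g_axis x : g (x, 0) = `|x|.
Proof.
have gR : g (1, 0) = 1.
  apply/eqP; rewrite eq_le; apply/andP; split.
    by apply/gL; have := inners_mirror (inners_pole m0 r2); rewrite /mirror /= opprK.
  by rewrite leNgt; apply/negP => /gLo /(inners_int_axis m0); rewrite normr1 ltxx.
have gM : g (-1, 0) = 1.
  apply/eqP; rewrite eq_le; apply/andP; split.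
    by apply/gL; exact: inners_pole.
  by rewrite leNgt; apply/negP => /gLo /(inners_int_axis m0); rewrite normrN1 ltxx.
have [x0|x0] := leP 0 x.
  by have := gauge_scale (1, 0) gg x0; rewrite /= mulr1 mulr0 gR mulr1 ger0_norm.
have x0' : 0 <= - x by lra.
by have := gauge_scale (-1, 0) gg x0'; rewrite /= mulrN1 opprK mulr0 gM mulr1 ltr0_norm.
Qed.

Let f_axis x : f (x, 0) = `|x| / (r - 1).
Proof.
have r1 : 0 < r - 1 by have := r2; lra.
have fR : f (r - 1, 0) = 1.
  apply/eqP; rewrite eq_le; apply/andP; split; first exact/fK/outers_axis_right.
  rewrite leNgt; apply/negP => lt1.
  have fr0 : 0 < f (r - 1, 0) by case: gf => _ _; apply => -[]; lra.
  have : K ((f (r - 1, 0))^-1 * (r - 1), (f (r - 1, 0))^-1 * 0).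
    by apply/fK; rewrite (gauge_scale (r - 1, 0) gf) ?invr_ge0 ?(ltW fr0)// mulVf// gt_eqF.
  rewrite mulr0 => /(outers_axis m0 r2).
  rewrite ger0_norm; last by rewrite mulr_ge0 ?invr_ge0 ?(ltW fr0) ?(ltW r1).
  by rewrite ler_pdivrMl// => ?; nra.
have fM : f (- (r - 1), 0) = 1.
  apply/eqP; rewrite eq_le; apply/andP; split.
    by apply/fK; have := outers_mirror (outers_axis_right m0 r2); rewrite /mirror.
  rewrite -fR leNgt; apply/negP => /[1!fR] lt1.
  have fr0 : 0 < f (- (r - 1), 0) by case: gf => _ _; apply => -[]; lra.
  have : K ((f (- (r - 1), 0))^-1 * (- (r - 1)), (f (- (r - 1), 0))^-1 * 0).
    by apply/fK; rewrite (gauge_scale (- (r - 1), 0) gf) ?invr_ge0 ?(ltW fr0)// mulVf// gt_eqF.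
  rewrite mulr0 => /(outers_axis m0 r2).
  rewrite mulrN normrN ger0_norm; last by rewrite mulr_ge0 ?invr_ge0 ?(ltW fr0) ?(ltW r1).
  by rewrite ler_pdivrMl// => ?; nra.
have [x0|x0] := leP 0 x.
  have q0 : 0 <= x / (r - 1) by rewrite divr_ge0// ltW.
  have := gauge_scale (r - 1, 0) gf q0; rewrite /= divfK ?gt_eqF// mulr0 fR mulr1 => ->.
  by rewrite ger0_norm.
have q0 : 0 <= - x / (r - 1) by rewrite divr_ge0//; lra.
have := gauge_scale (- (r - 1), 0) gf q0; rewrite /= mulrN divfK ?gt_eqF// opprK mulr0 fM mulr1 => ->.
by rewrite ltr0_norm.
Qed.

Let Lo_axis x : Lo (x, 0) <-> `|x| < 1. Proof. by rewrite -gLo g_axis. Qed.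
Let K_axis x : K (x, 0) <-> `|x| <= r - 1.
Proof. by rewrite -fK f_axis ler_pdivrMr ?mul1r//; have := r2; lra. Qed.

Lemma wedge_axis x : wedge_tile (x, 0) <-> 1 <= `|x| <= r - 1.
Proof.
split=> [[_ /K_axis k /Lo_axis l]|/andP[l k]].
  by rewrite k andbT leNgt; apply/negP.
by split => //=; [exact/K_axis|move=> /Lo_axis; rewrite ltNge l].
Qed.

Definition eta := polar_path f g.

Lemma eta_image : eta @` `[0, 1] =
  [set z | wedge_tile z /\ (L z \/ z.2 = 0 /\ 0 < z.1)].
Proof.
rewrite polar_path_image// wedge_tileE; apply/seteqP; split=> z [zc zE]; split => //.
  by case: zE => [gz|]; [left; apply/gL; rewrite gz|right].
case: zE => [/gL gz|]; [left|by right].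
by case: zc => _ _ ?; apply/eqP; rewrite eq_le gz.
Qed.

Lemma eta0 : eta 0 = pole.
Proof. by rewrite /eta polar_path0 g_axis normrN1 invr1. Qed.

Lemma eta1 : eta 1 = (r - 1, 0).
Proof. by rewrite /eta polar_path1 f_axis normr1 mul1r invrK. Qed.

Let alpha := 2 * tau.

Lemma rotation_y t x : (rotation pole t (x, 0)).2 = (x + 1) * sin t.
Proof. by rewrite /rotation /pole /=; ring. Qed.

Lemma rotation_dist t z : ((rotation pole t z).1 + 1) ^+ 2 + (rotation pole t z).2 ^+ 2 =
  (z.1 + 1) ^+ 2 + z.2 ^+ 2.
Proof.
rewrite /rotation /pole /=; have := cos2Dsin2 t; move: (cos _) (sin _) => C S CS.
transitivity ((C ^+ 2 + S ^+ 2) * ((z.1 + 1) ^+ 2 + z.2 ^+ 2)); first ring.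
by rewrite CS mul1r.
Qed.

Let tau_small : 0 < tau /\ 6 * tau <= pi.
Proof. by split; [exact: tau_gt0|exact: tau_le6]. Qed.

Let not_Ko z : 0 < z.2 -> 0 <= (back z).2 -> ~ Lo (back z) -> ~ Ko z.
Proof.
by move=> y0 b0 nl /(outers_intE r m0 y0)[/outer0_intE[] //|//]; lra.
Qed.

(** Above the axis, an interior point of the outer region comes either from [Lo] or, in sector [0],
    from below the axis. The image of [w] does neither. *)
Let edge_turn w : 0 <= w.2 -> ~ Lo w -> 0 <= (turn w).2 -> K (turn w) -> wedge_edge (turn w).
Proof.
move=> w0 nl y0 kz; have b : back (turn w) = w := turnK m w.
move: y0; rewrite le_eqVlt => /orP[/eqP ye|y0]; last first.
  have nk : ~ Ko (turn w) by apply: not_Ko; rewrite ?b.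
  by split; [split => //; [exact: ltW|move=> /LoL/LKo]|move=> []].
split; last by move=> []; rewrite -ye ltxx.
split => //; first by rewrite -ye.
move: ye kz b; case: (turn w) => x y /= <- kz b /Lo_axis x1.
move: w0; rewrite -b back_y /= mulr0 sub0r oppr_ge0 pmulr_rle0//.
by move: x1; rewrite ltr_norml; lra.
Qed.

Let edge_turn_eta w : wedge_tile w -> L w \/ w.2 = 0 /\ 0 < w.1 -> wedge_edge (turn w).
Proof.
move=> [w0 kw nl] wE; have b : back (turn w) = w := turnK m w.
case: wE => [lw|].
  have y0 := inners_turn m0 w0 lw.
  by apply: edge_turn => //; apply/outersE => //; right; rewrite b.
case: w w0 kw nl b => x y /= _ kw nl b [ye x0]; rewrite ye in kw nl b *.
have y0 : 0 < (turn (x, 0)).2 by rewrite turn_y /= mulr0 addr0 mulr_gt0//; lra.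
apply: edge_turn => //; first exact: ltW.
apply/outersE; [exact: m0|exact: ltW|left; apply/outer0E => //].
by rewrite b turn_dist /=; split => //; exact: (outers_dist m0 r2 (z := (x, 0)) (lexx 0)).
Qed.

Let edge_arc t : 0 <= t <= alpha -> wedge_edge (rotation pole t (r - 1, 0)).
Proof.
move=> ta; have [t0 t6] := tau_small; have r2' := r2; rewrite /alpha in ta.
set z := rotation pole t (r - 1, 0).
have d : (z.1 + 1) ^+ 2 + z.2 ^+ 2 = r ^+ 2 by rewrite /z rotation_dist /=; ring.
have bE : back z = rotation pole (- (2 * tau) + t) (r - 1, 0) by rewrite /back /z rotationD.
have b0 : (back z).2 <= 0.
  rewrite bE rotation_y mulr_ge0_le0//; first lra.
  by rewrite -oppr_ge0 -sinN; apply: sin_ge0_pi; lra.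
have y0 : 0 <= z.2 by rewrite rotation_y mulr_ge0//; [lra|apply: sin_ge0_pi; lra].
have kz : K z by apply/outersE => //; left; apply/outer0E => //; rewrite d.
move: (y0); rewrite le_eqVlt => /orP[/eqP ye|yp]; last first.
  have nk : ~ Ko z.
    move=> /(outers_intE r m0 yp)[/outer0_intE[//|_]|/LoL/(inners_dist m0 r2)].
      by rewrite d ltxx.
    by rewrite bE rotation_dist -(rotation_dist t) -/z d ltxx.
  by split; [split => //; move=> /LoL/LKo|move=> []].
split; last by move=> []; rewrite -ye ltxx.
split => //; move: ye d; case: (z) => x y /= <- d /Lo_axis.
by rewrite ltr_norml; rewrite expr0n /= addr0 in d; nra.
Qed.

(** The two axis segments have to fit in as well: the right one ends [eta] and is rotated onto the
    left side of sector [0], while the left one is, by [inners_flap], the rotate of a piece of the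
    inner curve. The arc bounds sector [0]. *)
Lemma contour_eta : contour eta pole alpha = wedge_edge.
Proof.
have [t0 t6] := tau_small; have r2' := r2.
apply/seteqP; split=> z.
  rewrite /contour eta_image; move=> [[[[zt zE]|[w [wt wE] <-]]|]|].
  - split => // -[y0 _ nl]; case: zE => // -[ye _]; by move: y0; rewrite ye ltxx.
  - exact: edge_turn_eta.
  - rewrite eta0 => -[t _ <-]; have -> : rotation pole t pole = pole.
      by rewrite /rotation /pole /= !subrr !mulr0 subrr !addr0.
    split; last by move=> []; rewrite /= ltxx.
    by apply/wedge_axis; rewrite normrN1 lexx; lra.
  - by rewrite eta1 => -[t /=]; rewrite in_itv /= => ta <-; exact: edge_arc.
have etaP w : wedge_tile w -> L w \/ w.2 = 0 /\ 0 < w.1 -> (eta @` `[0, 1]) w.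
  by move=> wt wE; rewrite eta_image.
have turnP : (eta @` `[0, 1]) (back z) -> contour eta pole alpha z.
  by move=> bz; left; left; right; exists (back z) => //; exact: backK.
move=> [zt nz]; have [y0 kz nlo] := zt.
have [lz|nl] := pselect (L z); first by left; left; left; apply: etaP => //; left.
move: (y0); rewrite le_eqVlt => /orP[/eqP ye|yp].
  case: z zt {nz nlo nl y0 kz} turnP ye => x y zt turnP /= ye; rewrite -ye in zt turnP *.
  have [x0|x0] := ltP 0 x.
    by left; left; left; apply: etaP => //; right.
  move: (zt) => /wedge_axis; rewrite ler0_norm// => /andP[x1 xr].
  have lb : L (back (x, 0)) by have := inners_flap m0 x1 xr; rewrite opprK.
  have b0 : 0 <= (back (x, 0)).2.
    by rewrite back_y /= mulr0 sub0r oppr_ge0 pmulr_rle0//; lra.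
  apply: turnP; apply: etaP; last by left.
  split => //; first exact/KoK/LKo.
  by move=> /(inners_int_turn m0 b0); rewrite backK /= ltxx.
have nk : ~ Ko z by move=> kz'; apply: nz.
have nb : ~ Lo (back z) by move=> lb; apply: nk; apply/(outers_intE r m0 yp); right.
have inner_case : (back z).2 < 0 -> ~ (z.1 + 1) ^+ 2 + z.2 ^+ 2 < r ^+ 2.
  by move=> b0 d; apply: nk; apply/(outers_intE r m0 yp); left; apply/outer0_intE.
move: (kz) => /(outersE r m0 y0)[/outer0E-/(_ m0)[b0 d]|lb]; last first.
  have b0 : 0 <= (back z).2.
    rewrite leNgt; apply/negP => /inner_case; apply.
    by rewrite -(backK m z) turn_dist; exact: (inners_dist m0 r2 lb).
  by apply: turnP; apply: etaP; [split => //; exact/KoK/LKo|left].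
move: d; rewrite le_eqVlt => /orP[/eqP d|d].
  right; rewrite eta1.
  have [|t [ti tpi ct st]] := @unit_circle_angle R ((z.1 + 1) / r) (z.2 / r).
    by rewrite !expr_div_n -mulrDl d divff// expf_neq0// gt_eqF//; lra.
  have rn0 : r != 0 by rewrite gt_eqF//; lra.
  have zE : rotation pole t (r - 1, 0) = z.
    rewrite /rotation /pole /= ct st [RHS]surjective_pairing; congr pair; field; exact: rn0.
  exists t => //=; rewrite in_itv /= ti /= leNgt; apply/negP => at_.
  have tp : t < pi.
    rewrite ltNge; apply/negP => pt.
    have : 0 <= sin (t - pi) by apply: sin_ge0_pi; lra.
    rewrite sinB cospi sinpi mulrN1 mulr0 subr0 st oppr_ge0.
    by rewrite leNgt divr_gt0//; lra.
  move: b0; rewrite -zE /back rotationD rotation_y leNgt => /negP; apply.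
  by apply: mulr_gt0; [lra|apply: sin_gt0_pi; rewrite /alpha in at_; lra].
(* What remains is on the left side of sector [0], the rotate of the axis segment from [(1, 0)] to
   [(r - 1, 0)]. *)
have {}b0 : (back z).2 = 0.
  by apply/eqP; rewrite eq_le b0 /= leNgt; apply/negP => /inner_case.
apply: turnP; have zE : turn (back z) = z := backK m z.
move: b0 nb zE d; case: (back z) => x y /= -> nb zE d.
have x0 : 0 < x + 1 by move: yp; rewrite -zE turn_y /= mulr0 addr0 pmulr_rgt0.
have x1 : 1 <= x.
  rewrite leNgt; apply/negP => x1; apply: nb; apply/Lo_axis.
  by rewrite ltr_norml; lra.
apply: etaP; last by right; split => //=; lra.
apply/wedge_axis; rewrite ger0_norm; last lra.
rewrite x1 /=; move: d; rewrite -zE turn_dist /= expr0n /= addr0; nra.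
Qed.

Lemma radially_generated_pole : radially_generated wedge_tile eta pole alpha.
Proof.
have [t0 t6] := tau_small.
split.
- exact: polar_path_segment.
- by exists 0 => //=; [rewrite in_itv /= lexx ler01|exact: eta0].
- by rewrite /alpha; apply/andP; split; lra.
- by rewrite contour_eta; exact: wedge_boundary.
Qed.

Lemma mirror_rotation t z : mirror (rotation pole t z) = rotation (1, 0) (- t) (mirror z).
Proof. by rewrite /mirror /rotation /pole /= cosN sinN; congr pair; ring. Qed.

Lemma mirror_tile z : wedge_tile z -> wedge_tile (mirror z).
Proof.
move=> [y0 kz lz]; split => //; first exact: outers_mirror.
by move=> /inners_int_mirror; rewrite mirrorK.
Qed.

Lemma mirror_open z : wedge_open z -> wedge_open (mirror z).
Proof.
move=> [y0 kz lz]; split => //; first exact: outers_int_mirror.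
by move=> /inners_mirror; rewrite mirrorK.
Qed.

Lemma mirror_edge : (@mirror R) @` wedge_edge = wedge_edge.
Proof.
have sub z : wedge_edge z -> wedge_edge (mirror z).
  by move=> [zt zo]; split; [exact: mirror_tile|move=> /mirror_open; rewrite mirrorK].
apply/seteqP; split=> [_ [z /sub ? <-] //|z /sub mz].
by exists (mirror z) => //; exact: mirrorK.
Qed.

(** The mirror reverses rotations. The curve to be rotated anticlockwise about [(1, 0)] is therefore
    the mirror image of the rotated [eta], and it lands on the mirror image of [eta]. *)
Definition nu := (@mirror R) \o (turn \o eta).

Lemma contour_nu : contour nu (1, 0) alpha = wedge_edge.
Proof.
rewrite -mirror_edge -contour_eta.
have nuE t : nu t = mirror (turn (eta t)) by [].
have arc e : circular_arc (1, 0) alpha (mirror (turn e)) = (@mirror R) @` circular_arc pole alpha e.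
  apply/seteqP; split=> z.
    move=> [t /=]; rewrite in_itv /= => ta <-.
    exists (rotation pole (alpha - t) e).
      by exists (alpha - t) => //=; rewrite in_itv /=; lra.
    by rewrite mirror_rotation /turn mirror_rotation rotationD -/alpha; congr rotation; ring.
  move=> [w [t /=]]; rewrite in_itv /= => ta <- <-.
  exists (alpha - t); first by rewrite /= in_itv /=; lra.
  by rewrite /turn !mirror_rotation rotationD -/alpha; congr rotation; ring.
have back_nu t : rotation (1, 0) alpha (nu t) = mirror (eta t).
  by rewrite nuE /turn mirror_rotation rotationD -/alpha subrr rotation0.
rewrite /contour !nuE !arc; apply/seteqP; split=> z.
  move=> [[[[t ti <-]|[_ [t ti <-] <-]]|[w wa <-]]|[w wa <-]].
  - by exists (turn (eta t)) => //; left; left; right; exists (eta t) => //; exists t.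
  - by rewrite back_nu; exists (eta t) => //; left; left; left; exists t.
  - by exists w => //; left; right.
  - by exists w => //; right.
move=> [x [[[[t ti <-]|[y [t ti <-] <-]]|wa]|wa] <-].
- by left; left; right; exists (nu t); [exists t|exact: back_nu].
- by left; left; left; exists t.
- by left; right; eexists; first exact: wa.
- by right; eexists; first exact: wa.
Qed.

Lemma continuous_mirror : continuous (@mirror R).
Proof.
move=> z; have c1 := @continuous_fst R z; have c2 := @continuous_snd R z.
change {for z, continuous (fun z : R * R => (- z.1, z.2))}.
exact: continuous_at_pair (continuousN c1) c2.
Qed.

Lemma turn_pole : turn pole = pole.
Proof. by rewrite /turn /rotation /pole /= !subrr !mulr0 subrr !addr0. Qed.

Lemma radially_generated_right : radially_generated wedge_tile nu (1, 0) alpha.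
Proof.
have [se _ a0 _] := radially_generated_pole.
split => //; last by rewrite contour_nu; exact: wedge_boundary.
  apply: (curve_segment_comp continuous_mirror (@mirrorK R)).
  exact: (curve_segment_comp (@continuous_rotation R _ _) (@turnK R m)).
exists 0; first by rewrite /= in_itv /= lexx ler01.
by rewrite /nu /= eta0 turn_pole /mirror /= opprK.
Qed.

End WedgeTile.

(** * Generating points and tilings *)

Section WedgeCenters.
Variables (R : realType) (m : nat) (r : R).
Hypotheses (m0 : (0 < m)%N) (r2 : 2 < r) (rc : r * cos (tau R m) < 2).
Local Notation tau := (tau R m).
Local Notation rho := (rho R m).
Local Notation height := (height R m).
Local Notation ang := (ang R m).

(** Excludes the inner apexes as generating points, since the tile is in the upper half-plane. *)
Lemma inner_apex_below i : (0 < i <= m)%N -> - height - rho * sin (inner_axis R m i) < 0.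
Proof.
move=> /andP[i0 im]; have t0 := tau_gt0 R m; have h0 := height_gt0 R m0; have ro := rho_gt0 R m0.
have a1 := ang_gt0 R m i0; have a2 := ang_le_max R im.
have : 0 < rho * sin (inner_axis R m i).
  by rewrite mulr_gt0//; apply: sin_gt0_pi; rewrite /inner_axis; lra.
lra.
Qed.

(** As [height = rho * sin tau], it suffices that the sine of the axis, at least
    [sin (2 * tau) = 2 * sin tau * cos tau], exceeds [sin tau]. *)
Lemma outer_apex_below j : (0 < j < m)%N -> height - rho * sin (outer_axis R m j) < 0.
Proof.
move=> /andP[j0 jm]; have t0 := tau_gt0 R m; have t6 := tau_le6 R m0.
have ro := rho_gt0 R m0; have s0 := sin_tau_gt0 t0 t6; have c0 := cos_tau_gt0 t0 t6.
have sl := sin_tau_le t0 t6; have cs1 : cos tau ^+ 2 = 1 - sin tau ^+ 2 := cos2sin2 _.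
have a1 := ang_gt0 R m j0; have a2 := ang_le_max R jm; rewrite angS in a2.
have : sin (2 * tau) <= sin (outer_axis R m j) by apply: sin_mono_sym; rewrite /outer_axis; lra.
rewrite mulr_natl sin_mulr2n => s2.
have hs : height = rho * sin tau by rewrite /height mulrC.
by rewrite hs -mulrBr pmulr_rlt0// subr_lt0; nra.
Qed.

Lemma outer_apex0 : (- rho * cos (outer_axis R m 0), height - rho * sin (outer_axis R m 0)) = pole R.
Proof.
have rc1 : rho * cos tau = 1 := rho_cos R m0.
rewrite /outer_axis ang0 mulr0 add0r mulNr rc1.
by congr pair; rewrite /height; ring.
Qed.

Lemma outer_apexm : (- rho * cos (outer_axis R m m), height - rho * sin (outer_axis R m m)) = (1, 0).
Proof.
have rc1 : rho * cos tau = 1 := rho_cos R m0.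
rewrite (_ : outer_axis R m m = pi - tau); last by rewrite /outer_axis angm; ring.
rewrite cosBpi sinBpi mulNr mulrN rc1 opprK.
by congr pair; rewrite /height; ring.
Qed.

Let unit_neq0 x y (t : R) : (x, y) = (- sin t, cos t) \/ (x, y) = (sin t, - cos t) ->
  (x, y) <> (0, 0).
Proof.
have cs1 := cos2Dsin2 t.
by move=> [|] [-> ->] [/eqP + /eqP +]; rewrite ?oppr_eq0 => /eqP a /eqP b;
  move: cs1; rewrite a b; lra.
Qed.

Lemma finite_arc_side_left o t C (p e : R * R) : e <> p ->
  finite_set [set u : R | 0 <= u < 2 * pi /\ side_left m o t (rotation p u e) = C].
Proof.
move=> ep; have n0 : (- sin (t + tau), cos (t + tau)) <> (0, 0) by apply: (@unit_neq0 _ _ (t + tau)); left.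
apply: (sub_finite_set _ (finite_arc_line (C + cos (t + tau) * o) n0 ep)).
by move=> u [ui uC]; split => //; rewrite -uC /side_left; ring.
Qed.

Lemma finite_arc_side_right o t C (p e : R * R) : e <> p ->
  finite_set [set u : R | 0 <= u < 2 * pi /\ side_right m o t (rotation p u e) = C].
Proof.
move=> ep; have n0 : (sin (t - tau), - cos (t - tau)) <> (0, 0) by apply: (@unit_neq0 _ _ (t - tau)); right.
apply: (sub_finite_set _ (finite_arc_line (C - cos (t - tau) * o) n0 ep)).
by move=> u [ui uC]; split => //; rewrite -uC /side_right; ring.
Qed.

Lemma finite_arc_apex_dist2 o t C (p e : R * R) : e <> p ->
  (- rho * cos t, o - rho * sin t) <> p ->
  finite_set [set u : R | 0 <= u < 2 * pi /\ apex_dist2 m o t (rotation p u e) = C].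
Proof.
move=> ep kp; apply: (sub_finite_set _ (finite_arc_circle C kp ep)).
by move=> u [ui uC]; split => //; rewrite -uC /apex_dist2 /=; ring.
Qed.

(* The edge is a finite union of segments and circular arcs, and the only
   centers of these arcs that lie in the closed upper half-plane are the two
   poles: every other circle meets the edge in a finite set. *)
Lemma wedge_arc_center (p e : R * R) (a : R) : 0 < a <= 2 * pi -> e <> p -> 0 <= p.2 ->
  (forall t, 0 <= t < a -> wedge_edge m r (rotation p t e)) ->
  p = pole R \/ p = (1, 0).
Proof.
move=> /andP[a0 a2] ep p2 arc; apply: contrapT => /not_orP[pp pq].
apply: (infinite_segment a0).
pose I i := [set u : R | 0 <= u < 2 * pi /\ side_left m (- height) (inner_axis R m i) (rotation p u e) = height]
  `|` [set u : R | 0 <= u < 2 * pi /\ side_right m (- height) (inner_axis R m i) (rotation p u e) = height]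
  `|` [set u : R | 0 <= u < 2 * pi /\ apex_dist2 m (- height) (inner_axis R m i) (rotation p u e) = r ^+ 2].
pose O j := [set u : R | 0 <= u < 2 * pi /\ side_left m height (outer_axis R m j) (rotation p u e) = height]
  `|` [set u : R | 0 <= u < 2 * pi /\ side_right m height (outer_axis R m j) (rotation p u e) = height]
  `|` [set u : R | 0 <= u < 2 * pi /\ apex_dist2 m height (outer_axis R m j) (rotation p u e) = r ^+ 2].
pose A := [set u : R | 0 <= u < 2 * pi /\ 0 * (rotation p u e).1 + 1 * (rotation p u e).2 = 0].
have fA : finite_set A by apply: finite_arc_line => // -[/eqP]; rewrite oner_eq0.
have fI i : (0 < i <= m)%N -> finite_set (I i).
  move=> iP; rewrite !finite_setU; split; first split => //.
  - exact: finite_arc_side_left.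
  - exact: finite_arc_side_right.
  - apply: finite_arc_apex_dist2 => // pE; have := inner_apex_below iP.
    by rewrite -pE /= in p2; lra.
have fO j : (j <= m)%N -> finite_set (O j).
  move=> jm; rewrite !finite_setU; split; first split => //.
  - exact: finite_arc_side_left.
  - exact: finite_arc_side_right.
  - apply: finite_arc_apex_dist2 => // pE.
    move: jm; rewrite leq_eqVlt => /orP[/eqP jm|jm].
      by apply: pq; rewrite -pE jm outer_apexm.
    have [j0|j0] := posnP j; first by apply: pp; rewrite -pE j0 outer_apex0.
    have := @outer_apex_below j; rewrite j0 jm => /(_ isT).
    by rewrite -pE /= in p2; lra.
have : finite_set (A `|` \bigcup_(i in [set i | (0 < i <= m)%N]) I i
    `|` \bigcup_(j in [set j | (j <= m)%N]) O j).
  rewrite !finite_setU; split; first split => //.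
    apply: bigcup_finite => //; apply: (sub_finite_set _ (finite_II m.+1)).
    by move=> i /= /andP[_]; rewrite ltnS.
  apply: bigcup_finite => //; apply: (sub_finite_set _ (finite_II m.+1)).
  by move=> i /=; rewrite ltnS.
apply: sub_finite_set => u /= ua; have u2 : 0 <= u < 2 * pi by lra.
have [[y0 kz nlo] nz] := arc _ ua.
have eqP' (x y : R) : x <= y -> ~ x < y -> x = y.
  by move=> xy nxy; apply/eqP; rewrite eq_le xy leNgt; apply/negP.
have [[i iP iz]|nl] := pselect (inners m r (rotation p u e)).
  left; right; exists i => //; have [hl hr hd] := iz.
  have [l|nl] := pselect (side_left m (- height) (inner_axis R m i) (rotation p u e) < height); last first.
    by left; left; split => //; exact: eqP'.
  have [l'|nl'] := pselect (side_right m (- height) (inner_axis R m i) (rotation p u e) < height); last first.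
    by left; right; split => //; exact: eqP'.
  right; split => //; apply: eqP' => // d.
  by apply: nlo; exists i.
have [ye|yp] := eqVneq (rotation p u e).2 0.
  by left; left; split => //; rewrite ye; ring.
have nk : ~ outers_int m r (rotation p u e).
  by move=> k; apply: nz; split => //; rewrite lt_neqAle eq_sym yp.
right; have [j jm jz] := kz; exists j => //; have [hl hr hd] := jz.
have [l|/not_implyP[jm' nl']] := pselect ((j < m)%N -> side_left m height (outer_axis R m j) (rotation p u e) < height); last first.
  by left; left; split => //; exact: eqP' (hl jm') nl'.
have [l'|/not_implyP[j0 nl']] := pselect ((0 < j)%N -> side_right m height (outer_axis R m j) (rotation p u e) < height); last first.
  by left; right; split => //; exact: eqP' (hr j0) nl'.
right; split => //; apply: eqP' => // d.
by apply: nk; exists j.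
Qed.

(** By injectivity, one end of a generating curve differs from [p] and sweeps a genuine arc about
    [p]; uniqueness of the boundary puts this arc on [wedge_edge]. *)
Lemma generated_by_wedge : generated_by (wedge_tile m r) = [set pole R; (1, 0)].
Proof.
apply/seteqP; split=> p; last first.
  move=> [->|->].
    by exists (eta m0 r2), (2 * tau); exact: radially_generated_pole.
  by exists (nu m0 r2), (2 * tau); exact: radially_generated_right.
move=> [e [a [[ce ie] pe /andP[a0 a2] tb]]].
have cE := wedge_boundary_unique m0 r2 rc tb.
have pedge : wedge_edge m r p by rewrite -cE; left; left; left.
have p2 : 0 <= p.2 by case: pedge => -[].
have [e0|e0] := pselect (e 0 = p); last first.
  apply: (@wedge_arc_center p (e 0) a) => //; first by rewrite a0 ltW.
  move=> t ta; rewrite -cE; left; right; exists t => //=.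
  by rewrite in_itv /=; lra.
apply: (@wedge_arc_center p (e 1) a) => //; first by rewrite a0 ltW.
  rewrite -e0 => /ie; rewrite !in_itv /= lexx ler01 lexx => /(_ isT isT) /eqP.
  by rewrite oner_eq0.
move=> t ta; rewrite -cE; right; exists t => //=.
by rewrite in_itv /=; lra.
Qed.

End WedgeCenters.

(** * The rotates of the tile about the pole fill the disk *)

Section Tiling.
Variables (R : realType) (m : nat) (r : R).
Hypotheses (m0 : (0 < m)%N) (r2 : 2 < r) (rc : r * cos (tau R m) < 2).
Local Notation tau := (tau R m).
Local Notation L := (inners m r).
Local Notation Lo := (inners_int m r).
Local Notation K := (outers m r).
Local Notation Ko := (outers_int m r).
Local Notation pole := (pole R).
Local Notation turn := (@turn R m).
Local Notation back := (@back R m).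
Local Notation T := (wedge_tile m r).
Local Notation N := (4 * m + 2)%N.

Lemma iter_turn k z : iter k turn z = rotation pole (2 * tau * k%:R) z.
Proof.
elim: k => [|k IH]; first by rewrite mulr0 rotation0.
by rewrite iterS IH /turn rotationD -natr1; congr rotation; ring.
Qed.

Lemma full_turn : 2 * tau * N%:R = 2 * pi.
Proof. by rewrite -(tau_pi R m) natrD natrM; ring. Qed.

Lemma half_turn k z : (iter (k + (2 * m + 1)) turn z).2 = - (iter k turn z).2.
Proof.
rewrite addnC iterD iter_turn /rotation (_ : 2 * tau * _ = pi) ?cospi ?sinpi /=; first by ring.
by rewrite -(tau_pi R m) natrD natrM; ring.
Qed.

Lemma iter_turn_period z : iter N turn z = z.
Proof.
rewrite iter_turn full_turn mulr_natl /rotation cos2pi sin2pi [RHS]surjective_pairing.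
by congr pair; rewrite /=; ring.
Qed.

Lemma iter_turn_mod k z : iter (k %% N) turn z = iter k turn z.
Proof.
have per q : iter (q * N) turn z = z.
  by elim: q => [//|q IH]; rewrite (mulSn q N) iterD IH iter_turn_period.
by rewrite [in RHS](divn_eq k N) (addnC (k %/ N * N)%N) iterD per.
Qed.

(** By periodicity the inverse of an iterate is an iterate, so orbits can be indexed by natural
    numbers. *)
Lemma iter_turnK k z : iter (N.-1 * k) turn (iter k turn z) = z.
Proof.
rewrite -iterD -iter_turn_mod -{2}[k]mul1n -mulnDl (_ : N.-1 + 1 = N)%N; last by lia.
by rewrite modnMr.
Qed.

Lemma iter_turn_polar (d t : R) k z : z.1 + 1 = d * cos t -> z.2 = d * sin t ->
  (iter k turn z).2 = d * sin (t + 2 * tau * k%:R).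
Proof.
move=> z1 z2; rewrite iter_turn /rotation /pole /= opprK z1 subr0 z2 sinD; ring.
Qed.

Lemma LoL z : Lo z -> L z.
Proof. by move=> [i iP [hl hr hd]]; exists i => //; split; exact: ltW. Qed.

Lemma KoK z : Ko z -> K z.
Proof.
by move=> [j jm [hl hr hd]]; exists j => //; split; [move/hl/ltW|move/hr/ltW|exact: ltW].
Qed.

Let LKo z : L z -> Ko z. Proof. exact: inners_sub_outers_int m0 r2 rc z. Qed.

(** Polar coordinates about the pole tell when the orbit is above the axis. There, a point whose
    predecessor is above the axis can be in the outer region only if the predecessor is in the inner
    one. If the angle is still at most [pi] at step [j], the orbit starts outside [L] and so stays
    outside [K]. If it has passed [2 * pi], the same induction with [Lo] and [Ko], started at [w],
    shows that the orbit cannot come back to [z]. *)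
Lemma wedge_open_disjoint j z : (0 < j < N)%N -> wedge_open m r z -> ~ T (iter j turn z).
Proof.
move=> /andP[j0 jN] [y0 koz nlz] [yj kj nloj].
have t0 := tau_gt0 R m; have pi0 := pi_gt0 R; have ft := full_turn.
have [d [t [d0 ti tpi [z1 z2]]]] := polar_coordinates (z.1 + 1) z.2.
have yE k := iter_turn_polar k z1 z2.
have dp : 0 < d.
  by rewrite lt_neqAle d0 andbT eq_sym; apply/eqP => de; move: y0; rewrite z2 de mul0r ltxx.
have neg x : pi < x -> x < 2 * pi -> sin x < 0.
  by move=> x1 x2; rewrite -[x](subrK pi) sinDpi oppr_lt0; apply: sin_gt0_pi; lra.
have tp : 0 < t < pi.
  apply/andP; split.
    rewrite lt_neqAle ti andbT eq_sym; apply/eqP => te.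
    by move: y0; rewrite z2 te sin0 mulr0 ltxx.
  rewrite ltNge; apply/negP; rewrite le_eqVlt => /orP[/eqP te|te].
    by move: y0; rewrite z2 -te sinpi mulr0 ltxx.
  by move: y0; rewrite z2 pmulr_rgt0// ltNge ltW// neg.
have step i : 2 * tau * i.+1%:R = 2 * tau * i%:R + 2 * tau :> R by rewrite -natr1; ring.
have le_step i k : (i <= k)%N -> 2 * tau * i%:R <= 2 * tau * k%:R.
  by move=> ik; rewrite ler_wpM2l ?ler_nat// mulr_ge0// ltW.
have ge0 i : 0 <= 2 * tau * i%:R by rewrite !mulr_ge0// ltW.
have jlt : 2 * tau * j%:R < 2 * pi by rewrite -ft ltr_pM2l ?ltr_nat// mulr_gt0.
have [tj|tj] := leP (t + 2 * tau * j%:R) pi.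
  have down i : (i <= j)%N -> (0 < i)%N -> ~ K (iter i turn z).
    elim: i => [//|i IH] ij _ ki.
    have ij' := le_step _ _ ij; have i0 := ge0 i; rewrite step in ij'.
    have b : back (iter i.+1 turn z) = iter i turn z by rewrite iterS turnK.
    have yi1 : 0 <= (iter i.+1 turn z).2.
      by rewrite yE step mulr_ge0//; apply: sin_ge0_pi; lra.
    have yi : 0 < (iter i turn z).2.
      by rewrite yE mulr_gt0//; apply: sin_gt0_pi; lra.
    move: ki => /(outersE r m0 yi1)[/outer0E-/(_ m0)[]|]; rewrite b; first by lra.
    move=> li; case: (posnP i) => [i0'|ipos]; first by apply: nlz; rewrite i0' in li.
    by apply: IH => //; [exact: ltnW|exact/KoK/LKo].
  exact: (down j).
(* An angle strictly between [pi] and [2 * pi] would put the [j]-th point below the axis. *)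
have {}tj : 2 * pi <= t + 2 * tau * j%:R.
  rewrite leNgt; apply/negP => tj'.
  by move: yj; rewrite yE pmulr_rge0// leNgt neg.
set w := iter j turn z in yj kj nloj.
have wE i : iter i turn w = iter (i + j) turn z by rewrite /w iterD.
have up i : (i + j <= N)%N -> (0 < i)%N -> ~ Ko (iter i turn w).
  elim: i => [//|i IH] ij _ ki.
  have yEi k : (iter k turn w).2 = d * sin (t + 2 * tau * j%:R - 2 * pi + 2 * tau * k%:R).
    rewrite wE yE natrD [in RHS](_ : _ + _ = t + 2 * tau * (k%:R + j%:R) - pi - pi); last by ring.
    by rewrite !sinB cosB !sinpi !cospi; ring.
  have ij' := le_step _ _ ij; have i0 := ge0 i; rewrite ft natrD mulrDr step in ij'.
  have b : back (iter i.+1 turn w) = iter i turn w by rewrite iterS turnK.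
  have yi1 : 0 < (iter i.+1 turn w).2.
    by rewrite yEi step mulr_gt0//; apply: sin_gt0_pi; lra.
  have yi : 0 <= (iter i turn w).2.
    by rewrite yEi mulr_ge0//; apply: sin_ge0_pi; lra.
  move: ki => /(outers_intE r m0 yi1)[/outer0_intE-/(_ m0)[]|]; rewrite b; first by lra.
  move=> li; case: (posnP i) => [i0'|ipos]; first by apply: nloj; rewrite i0' in li.
  by apply: IH => //; [exact: ltnW|exact/LKo/LoL].
apply: (up (N - j)%N); [by rewrite subnK// ltnW|by rewrite subn_gt0|].
by rewrite wE subnK ?iter_turn_period// ltnW.
Qed.

(** Half a turn changes the sign of the ordinate, so the orbit crosses the axis upwards, and it does
    so into sector [0]. As long as it misses the tile it is in [Lo], hence its next point is again
    above the axis and in the outer region; this would last forever, against the next half turn. *)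
Lemma wedge_cover z : (z.1 + 1) ^+ 2 + z.2 ^+ 2 <= r ^+ 2 -> exists k, T (iter k turn z).
Proof.
move=> zr; have dist k : ((iter k turn z).1 + 1) ^+ 2 + (iter k turn z).2 ^+ 2 <= r ^+ 2.
  by elim: k => [//|k IH]; rewrite iterS turn_dist.
have [k yk0 yk1] : exists2 k, (iter k turn z).2 <= 0 & 0 <= (iter k.+1 turn z).2.
  apply: contrapT => nk.
  have neg k : (iter k turn z).2 <= 0 -> (iter k.+1 turn z).2 < 0.
    by move=> yk; rewrite ltNge; apply/negP => yk'; apply: nk; exists k.
  have [k yk] : exists k, (iter k turn z).2 <= 0.
    have [z0|z0] := leP z.2 0; first by exists 0%N.
    by exists (0 + (2 * m + 1))%N; rewrite half_turn /=; lra.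
  have later i : (iter (k.+1 + i) turn z).2 < 0.
    elim: i => [|i IH]; first by rewrite addn0; exact: neg.
    by rewrite addnS; apply: neg; exact: ltW.
  have := later (2 * m + 1)%N; rewrite half_turn; have := later 0%N; rewrite addn0; lra.
apply: contrapT => nT.
have all j : 0 <= (iter (k.+1 + j) turn z).2 /\ K (iter (k.+1 + j) turn z).
  elim: j => [|j [yj kj]].
    rewrite addn0; split => //; apply/outersE => //; left; apply/outer0E => //.
    by rewrite iterS turnK -iterS.
  have lo : Lo (iter (k.+1 + j) turn z).
    by apply: contrapT => nlo; apply: nT; exists (k.+1 + j)%N.
  have yp : 0 < (iter (k.+1 + j.+1) turn z).2 by rewrite addnS iterS; exact: (inners_int_turn m0 yj lo).
  split; first exact: ltW.
  apply/outersE => //; [exact: ltW|right].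
  by rewrite addnS iterS turnK; exact: LoL.
have [y1 k1] := all 0%N.
have lo : Lo (iter (k.+1 + 0) turn z).
  by apply: contrapT => nlo; apply: nT; exists (k.+1 + 0)%N.
have yp : 0 < (iter (k.+1 + 1) turn z).2.
  by rewrite addnS iterS; exact: (inners_int_turn m0 y1 lo).
have [yn _] := all (1 + (2 * m + 1))%N.
by move: yn; rewrite addnA half_turn; lra.
Qed.

(** The index runs over all natural numbers although copies recur with period [N]: as a set of sets,
    the range identifies equal copies, and only distinct ones are compared. *)
Definition wedge_copies : set (set (R * R)) := range (fun k => iter k turn @` T).

Lemma iter_turn_image k A : iter k turn @` A = rotation pole (2 * tau * k%:R) @` A.
Proof. by apply: eq_imagel => z _; exact: iter_turn. Qed.

Lemma wedge_copies_meet a b : iter a turn @` T <> iter b turn @` T ->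
  (iter a turn @` T) `&` (iter b turn @` T) `<=` iter a turn @` wedge_edge m r.
Proof.
move=> ne z [[w Tw wz] [v Tv vz]]; exists w => //; split => // ow.
(* [N.-1 * b] turns undo [b] turns, so [j] is [a - b] modulo [N]. *)
pose j := (N.-1 * b + a)%N.
have vE : v = iter j turn w by rewrite /j iterD wz -vz iter_turnK.
have [j0|jpos] := posnP (j %% N)%N.
  apply: ne; apply: eq_imagel => x _.
  transitivity (iter b turn (iter j turn x)); last by rewrite -(iter_turn_mod j) j0.
  rewrite -(iter_turnK b (iter a turn x)) -!iterD; congr (iter _ turn x).
  by rewrite /j; lia.
apply: (@wedge_open_disjoint (j %% N)%N w) => //.
  by rewrite jpos ltn_mod; lia.
by rewrite iter_turn_mod -vE.
Qed.

Lemma wedge_tiles_the_disk : tiles_the_disk T.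
Proof.
have isom k : congruent T (iter k turn @` T).
  exists (rotation pole (2 * tau * k%:R)); first exact: rotation_isometry.
  by rewrite iter_turn_image.
have tb k : tile_boundary (iter k turn @` T) (iter k turn @` wedge_edge m r).
  by rewrite !iter_turn_image; exact: (tile_boundary_congruent_rotation _ _ (wedge_boundary m0 r2 rc)).
exists pole, r, wedge_copies; split.
- by have := r2; lra.
- split.
  + by move=> _ [k _ <-]; exists (iter k turn @` wedge_edge m r).
  + move=> _ _ [a _ <-] [b _ <-].
    exists (rotation pole (2 * tau * (b%:R - a%:R))); first exact: rotation_isometry.
    rewrite !iter_turn_image image_comp; apply: eq_imagel => z _ /=.
    by rewrite rotationD; congr rotation; ring.
  + move=> _ _ [a _ <-] [b _ <-] ne.
    exists (iter a turn @` wedge_edge m r), (iter b turn @` wedge_edge m r); split => //.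
    move=> z zab; split; first exact: (wedge_copies_meet ne).
    by move: zab; rewrite setIC; apply: wedge_copies_meet => e; apply: ne.
  + have diskE z : closed_disk pole r z <-> (z.1 + 1) ^+ 2 + z.2 ^+ 2 <= r ^+ 2.
      have r0 : 0 <= r by have := r2; lra.
      rewrite /closed_disk /eucl_dist /= -{1}(ger0_norm r0) -sqrtr_sqr.
      rewrite ler_sqrt ?sqr_ge0// (_ : (-1 - z.1) ^+ 2 + (0 - z.2) ^+ 2 = (z.1 + 1) ^+ 2 + z.2 ^+ 2) //.
      by ring.
    apply/seteqP; split=> z.
      move=> [_ [k _ <-] [w [w0 kw _] <-]]; apply/diskE.
      elim: k => [|k IH]; first exact: (outers_dist m0 r2 w0 kw).
      by rewrite iterS turn_dist.
    move=> /diskE /wedge_cover[k Tk].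
    exists (iter (N.-1 * k) turn @` T); first by exists (N.-1 * k)%N.
    by exists (iter k turn z) => //; exact: iter_turnK.
- by move=> _ [k _ <-].
Qed.

End Tiling.

(** * Uncountably many tiles with two given generating points *)

Lemma wedge_tile_inj (R : realType) (m : nat) (r r' : R) : (0 < m)%N -> 2 < r -> 2 < r' ->
  wedge_tile m r = wedge_tile m r' -> r = r'.
Proof.
move=> m0 r2 r2' E.
have le x y : 2 < x -> 2 < y -> wedge_tile m x = wedge_tile m y -> x <= y.
  (* The point of abscissa [x - 1] is the right end of the tile on the axis. *)
  move=> x2 y2 xy; have : wedge_tile m x (x - 1, 0).
    by apply/(wedge_axis m0 x2); rewrite ger0_norm; lra.
  by rewrite xy => /(wedge_axis m0 y2) /andP[_]; rewrite ger0_norm; lra.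
by apply/eqP; rewrite eq_le !le.
Qed.

Theorem theorem3p5 (R : realType) (n : nat) (n_ge3 : (3 <= n)%N) (n_odd : odd n)
    (p q : R * R) (pq : p <> q) :
  ~ countable [set T : set (R * R) |
      [/\ n_wedge n T, wedge_form n p q T & tiles_the_disk T]].
Proof.
set A := [set T | _] => cA; pose m := n./2.
have nE : n = (2 * m + 1)%N by rewrite -[n in LHS](odd_double_half n) n_odd -mul2n addnC.
have m0 : (0 < m)%N by move: n_ge3; rewrite nE; case: (m).
have aE : 2 * tau R m = pi / n%:R.
  have m1 : 0 <= m%:R :> R by [].
  rewrite /tau nE natrD natrM; field.
  by rewrite !gt_eqF//; lra.
have c0 : 0 < cos (tau R m) := cos_tau_gt0 (tau_gt0 R m) (tau_le6 R m0).
have c1 : cos (tau R m) < 1.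
  have t0 := tau_gt0 R m; have t6 := tau_le6 R m0.
  by rewrite -cos0 ltr_cos ?in_itv /=; lra.
(* Twice the circumradius [rho]: the condition [r * cos tau < 2] reads [r < hi]. *)
pose hi := 2 / cos (tau R m).
have hi2 : 2 < hi by rewrite ltr_pdivlMr//; lra.
pose c : R * R := ((p.1 + q.1) / 2, (p.2 + q.2) / 2).
pose a : R * R := ((q.1 - p.1) / 2, (q.2 - p.2) / 2).
have a0 : a <> (0, 0).
  move=> [h1 h2]; apply: pq; case: p q h1 h2 {A cA c a} => p1 p2 [q1 q2] /= h1 h2.
  by congr pair; lra.
have Sp : similarity c a (pole R) = p.
  by rewrite [RHS]surjective_pairing /similarity /pole /=; congr pair; field.
have Sq : similarity c a (1, 0) = q.
  by rewrite [RHS]surjective_pairing /similarity /=; congr pair; field.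
have [c' [a' [SK KS _]]] := similarity_inv c a0.
pose W r := similarity c a @` wedge_tile m r.
(* The interval contains its left end while [r] must exceed 2 strictly, so it starts halfway between
   2 and [hi]. *)
pose I := [set r : R | (2 + hi) / 2 <= r < hi].
have Ir r : I r -> 2 < r /\ r * cos (tau R m) < 2.
  by move=> /andP[r1 r2]; split; [lra|rewrite -ltr_pdivlMr].
have WA : W @` I `<=` A.
  move=> _ [r /Ir[r2 rc] <-].
  have wf : wedge_form n (pole R) (1, 0) (wedge_tile m r).
    exists (eta m0 r2), (nu m0 r2); rewrite -aE.
    by split; [exact: radially_generated_pole|exact: radially_generated_right].
  have wf' : wedge_form n p q (W r).
    by rewrite -Sp -Sq; exact: wedge_form_similarity.
  split => //; last first.
    by apply: tiles_the_disk_similarity => //; exact: wedge_tiles_the_disk.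
  split; last by exists p, q.
  apply: wedge_similarity => //; split.
    by exists (wedge_edge m r); exact: wedge_boundary.
  exists (pole R), (1, 0); split; last exact: generated_by_wedge.
  by move=> -[]; lra.
have Winj : {in I &, injective W}.
  move=> r r'; rewrite !inE => /Ir[r2 _] /Ir[r2' _] e.
  apply: (wedge_tile_inj m0 r2 r2').
  have back T : similarity c' a' @` (similarity c a @` T) = T.
    rewrite image_comp; apply/seteqP; split=> [_ [w Tw <-]|w Tw]; first by rewrite /= SK.
    by exists w => //=; rewrite SK.
  by rewrite -(back (wedge_tile m r)) -/(W r) e back.
apply: (@uncountable_segment R ((2 + hi) / 2) hi); first by lra.
rewrite -/I -(eq_countable (inj_card_eq Winj)).
exact: sub_countable (subset_card_le WA) cA.
Qed.
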